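(* Let $N\ge 1$ be an integer and let $p\ge q\ge 1$ be real numbers with $pq>1$. Consider the Lane-Emden system $$-\Delta u=v^p,\quad -\Delta v=u^q,\quad u>0,\ v>0\quad\text{in }\mathbb{R}^N,$$ put $\alpha=\frac{2(p+1)}{pq-1}$, $\beta=\frac{2(q+1)}{pq-1}$, and consider the inequality $$(\ast)\qquad \Big[\frac{(N-2)^2-(\alpha-\beta)^2}{4}\Big]^2\ \ge\ pq\,\alpha\beta\,(N-2-\alpha)(N-2-\beta).$$ (i) If $N\ge 11$ and $(\ast)$ holds, then any radially symmetric solution $(u,v)$ of the Lane-Emden system is stable and satisfies $u<u_s$ and $v<v_s$ in $\mathbb{R}^N\setminus\{0\}$, where $(u_s,v_s)$ is the singular solution defined in the context. (ii) If $N\le 10$, or if $N\ge 11$ and $(\ast)$ fails, then there is no stable radially symmetric solution of the Lane-Emden system.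
   Context: Solutions $(u,v)$ of the Lane-Emden system are classical, $(u,v)\in C^2(\mathbb{R}^N)^2$, with $u,v>0$. A solution $(u,v)$ is called stable if there exists $(\phi,\psi)\in C^2(\mathbb{R}^N)^2$ with $\phi,\psi>0$ in $\mathbb{R}^N$ and $$-\Delta\phi\ge p v^{p-1}\psi,\qquad -\Delta\psi\ge q u^{q-1}\phi\qquad\text{in }\mathbb{R}^N.$$ Singular solution: when $\frac1{p+1}+\frac1{q+1}\le 1-\frac2N$ (in which case $0<\alpha,\beta<N-2$), set $S=\alpha(N-2-\alpha)$, $T=\beta(N-2-\beta)$, $a=(ST^p)^{\frac1{pq-1}}$, $b=(S^qT)^{\frac1{pq-1}}$ and $$u_s(x)=a|x|^{-\alpha},\qquad v_s(x)=b|x|^{-\beta},\qquad x\in\mathbb{R}^N\setminus\{0\}.$$ It is a known result (Mitidieri, Serrin-Zou) that the Lane-Emden system has a radially symmetric solution if and only if $\frac1{p+1}+\frac1{q+1}\le 1-\frac2N$; hence $(u_s,v_s)$ is well defined whenever a radially symmetric solution exists. *)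

(* Defs.v *)
From mathcomp Require Import all_boot all_order all_algebra.
From mathcomp Require Import all_classical all_reals all_analysis.

Set Implicit Arguments.
Unset Strict Implicit.
Unset Printing Implicit Defensive.

Import Order.TTheory GRing.Theory Num.Theory.
Import numFieldNormedType.Exports.

Local Open Scope ring_scope.
Local Open Scope classical_set_scope.

Section RN.
Context {R : realType} {N : nat}.
Implicit Types (f : 'rV[R]_N -> R) (x : 'rV[R]_N).

(* The library norm `|x| on 'rV_N is the sup norm, hence this definition. *)
Definition enorm x : R := Num.sqrt (\sum_(i < N) x 0 i ^+ 2).

Definition radial f : Prop := forall x y, enorm x = enorm y -> f x = f y.

Definition partial (i : 'I_N) f : 'rV[R]_N -> R :=
  fun x => 'D_(delta_mx 0 i) f x.

Definition C1 f : Prop :=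
  continuous f /\
  forall i : 'I_N,
    (forall x, derivable f x (delta_mx 0 i)) /\ continuous (partial i f).

Definition C2 f : Prop := C1 f /\ forall i : 'I_N, C1 (partial i f).

Definition laplacian f : 'rV[R]_N -> R :=
  fun x => \sum_(i < N) partial i (partial i f) x.

End RN.

Section LaneEmden.
Context {R : realType} (N : nat) (p q : R).
Implicit Types u v : 'rV[R]_N -> R.

Definition lane_emden_solution u v : Prop :=
  [/\ C2 u, C2 v, (forall x, 0 < u x /\ 0 < v x),
      (forall x, - laplacian u x = v x `^ p) &
      (forall x, - laplacian v x = u x `^ q)].

Definition stable u v : Prop :=
  exists phi psi : 'rV[R]_N -> R,
    [/\ C2 phi, C2 psi, (forall x, 0 < phi x /\ 0 < psi x),
        (forall x, - laplacian phi x >= p * v x `^ (p - 1) * psi x) &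
        (forall x, - laplacian psi x >= q * u x `^ (q - 1) * phi x)].

Definition LEalpha : R := 2 * (p + 1) / (p * q - 1).
Definition LEbeta : R := 2 * (q + 1) / (p * q - 1).

Definition LES : R := LEalpha * (N%:R - 2 - LEalpha).
Definition LET : R := LEbeta * (N%:R - 2 - LEbeta).

(* Meant for x != 0 and 1/(p+1) + 1/(q+1) <= 1 - 2/N, that is
   LEalpha + LEbeta <= N - 2, which makes LES and LET positive; otherwise these
   total functions carry the default values of powR. *)
Definition u_sing : 'rV[R]_N -> R :=
  fun x => (LES * LET `^ p) `^ (p * q - 1)^-1 * enorm x `^ (- LEalpha).
Definition v_sing : 'rV[R]_N -> R :=
  fun x => (LES `^ q * LET) `^ (p * q - 1)^-1 * enorm x `^ (- LEbeta).

Definition stability_ineq : Prop :=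
  (((N%:R - 2) ^+ 2 - (LEalpha - LEbeta) ^+ 2) / 4) ^+ 2 >=
  p * q * LEalpha * LEbeta * (N%:R - 2 - LEalpha) * (N%:R - 2 - LEbeta).

End LaneEmden.

(* Main.v *)
(** In the variable [t = ln |x|] a radial solution is a pair [(U, V)] with
    [U'' + (N - 2) U' = - e^(2t) V^p] and symmetrically for [V]. The Pohozaev identity
    forces [alpha + beta <= N - 2].

    If the inequality holds, the system linearized at the singular solution has a
    positive power solution. A Wronskian-type pairing of it with [(us - u, vs - v)], a
    subsolution by convexity, stays positive; it would be negative at a point where the
    orbit has crossed the singular solution, so [u < us] and [v < vs]. Then
    [(us - u, vs - v)] is a positive singular supersolution of the linearization at
    [(u, v)], and a smooth concave 1-homogeneous "minimum" of it with a polynomial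
    supersolution near the origin is a [C^2] one.

    If [(u, v)] is stable, a strict subsolution of the linearized system cannot be
    positive inside a shell and nonpositive on its boundary. Applied to the differences
    of [(u, v)] and its rescalings this makes [r^alpha u] and [r^beta v] monotone, hence
    convergent to the constants of the singular solution. When the inequality fails the
    linearization at infinity oscillates, and one period of an oscillating solution is
    a forbidden bump. For [N <= 10] the inequality always fails. *)

Require Import Defs.
From mathcomp Require Import all_boot all_order all_algebra.
From mathcomp Require Import all_classical all_reals all_analysis.
From mathcomp Require Import ring lra.
Import Order.TTheory GRing.Theory Num.Theory.
Import numFieldNormedType.Exports.
Local Open Scope ring_scope.
Local Open Scope classical_set_scope.
Set Implicit Arguments.
Unset Strict Implicit.
Unset Printing Implicit Defensive.

(** * Differential calculus on the line *)

(** Both halves use one dichotomy, [crossing], for the pair of differences between the solution and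
    a comparison pair: where one difference is nonnegative, the flux of the other does not increase.
    So either both stay nonnegative, or there is a time where both are nonpositive with nonpositive
    derivatives, and a time where both are negative. The Wronskian pairing excludes the first kind
    of time, stability the second. This replaces a phase-space analysis of the four-dimensional
    system.

    Convexity of the powers enters through one tangent inequality. Taken at either end point, it
    yields the linearization at the singular solution (for the pairing) or at $(u,v)$ (for
    stability).

    Stability must be witnessed by $C^2$ functions on all of $\mathbb R^N$, whereas the natural
    supersolution blows up at the origin and an ordinary minimum has corners; hence the smoothing.
    Conversely, the maximum principle wants strict subsolutions: a small paraboloid supplies
    strictness for rescalings, and small constants added to the trigonometric factors supply it at
    infinity, where they absorb the error of linearizing at the limit. *)

Definition der (R : realType) (t : R) (f : R -> R) (d : R) : Prop := is_derive t 1 f d.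

Section Calculus.
Context {R : realType}.
Implicit Types (f g : R -> R) (t a b d : R).

Lemma der_eq f t a b : der t f a -> a = b -> der t f b.
Proof. by move=> ? <-. Qed.

Lemma der_cst (c t : R) : der t (fun _ : R => c) 0.
Proof. exact: is_derive_cst. Qed.

Lemma der_id t : der t (fun x : R => x) 1.
Proof. exact: is_derive_id. Qed.

Lemma derD f g t a b : der t f a -> der t g b -> der t (fun x => f x + g x) (a + b).
Proof. exact: is_deriveD. Qed.

Lemma derN f t a : der t f a -> der t (fun x => - f x) (- a).
Proof. exact: is_deriveN. Qed.

Lemma derM f g t a b : der t f a -> der t g b ->
  der t (fun x => f x * g x) (a * g t + f t * b).
Proof.
move=> df dg; apply: der_eq (is_deriveM df dg) _.
by rewrite /GRing.scale /= addrC [g t * a]mulrC.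
Qed.

Lemma derX f t a (k : nat) : der t f a -> der t (fun x => f x ^+ k.+1) (k.+1%:R * f t ^+ k * a).
Proof.
move=> df; rewrite (_ : (fun x => _) = f ^+ k.+1); first exact: (@is_deriveX _ _ _ k.+1).
by apply/funext => x; rewrite fctE.
Qed.

Lemma der_comp f g t a b : der (g t) f a -> der t g b -> der t (fun x => f (g x)) (a * b).
Proof. exact: is_derive1_comp. Qed.

Lemma der_expR f t a : der t f a -> der t (fun x => expR (f x)) (expR (f t) * a).
Proof. by move=> df; exact: der_comp (is_derive_expR _) df. Qed.

Lemma der_ln f t a : 0 < f t -> der t f a -> der t (fun x => ln (f x)) ((f t)^-1 * a).
Proof. by move=> f0 df; exact: der_comp (is_derive1_ln f0) df. Qed.

Lemma der_powR f t a e : 0 < f t -> der t f a ->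
  der t (fun x => f x `^ e) (e * f t `^ (e - 1) * a).
Proof.
move=> f0 df; exact: (der_comp (f := fun x => x `^ e)) (is_derive1_powR _ f0) df.
Qed.

Lemma derV f t a : f t != 0 -> der t f a -> der t (fun x => (f x)^-1) (- (f t) ^- 2 * a).
Proof. by move=> f0 df; exact: is_deriveV f0 df. Qed.

Lemma der_cos f t a : der t f a -> der t (fun x => cos (f x)) (- sin (f t) * a).
Proof. by move=> df; exact: der_comp (is_derive_cos _) df. Qed.

Lemma der_sin f t a : der t f a -> der t (fun x => sin (f x)) (cos (f t) * a).
Proof. by move=> df; exact: der_comp (is_derive_sin _) df. Qed.

Lemma der_cont f t a : der t f a -> {for t, continuous f}.
Proof. by move=> [df _]; apply/differentiable_continuous/derivable1_diffP. Qed.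

Lemma der_near f g t a : (\forall x \near t, f x = g x) -> der t f a -> der t g a.
Proof.
move=> fg [df <-]; split; first exact: near_eq_derivable df.
exact/esym/near_eq_derive.
Qed.

End Calculus.

Ltac der_step :=
  first
  [ eassumption
  | match goal with H : forall _, der _ ?f _ |- der _ ?f _ => apply: H end
  | match goal with H : forall _, der _ ?f _ |- der _ (fun x => ?f x) _ => apply: H end
  | apply: der_cst | apply: der_id
  | apply: derD | apply: derN | apply: derM | apply: derX
  | apply: der_expR | apply: der_cos | apply: der_sin
  | apply: der_ln | apply: der_powR | apply: derV
  | match goal with H : forall _, der _ ?f _ |- der _ (fun x => ?f _) _ =>
       apply: (der_comp (f := f)); [apply: H|] end ].
Ltac der := apply: der_eq; [repeat der_step | cbv beta delta [idfun]].

(** * Monotonicity from the sign of the derivative, and convexity of powers *)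

Section MeanValue.
Context {R : realType}.
Implicit Types (f g : R -> R) (t a b d : R).

Lemma der_mvt f (f1 : R -> R) a b : a < b ->
  (forall t, a <= t <= b -> der t f (f1 t)) ->
  exists2 c, a < c < b & f b - f a = f1 c * (b - a).
Proof.
move=> ab df; have [| |c] := @MVT R f f1 a b ab.
- by move=> x; rewrite in_itv/= => /andP[ax xb]; apply: df; rewrite !ltW.
- apply: continuous_in_subspaceT => x; rewrite inE/= in_itv/= => xab.
  by have /der_cont := df _ xab.
by rewrite in_itv/=; exists c.
Qed.

Lemma der_le f (f1 : R -> R) a b : a <= b ->
  (forall t, a <= t <= b -> der t f (f1 t)) -> (forall t, a < t < b -> f1 t <= 0) -> f b <= f a.
Proof.
rewrite le_eqVlt => /predU1P[->//|ab] df f1le.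
have [c cab e] := der_mvt ab df; rewrite -subr_le0 e.
by rewrite mulr_le0_ge0 ?f1le// subr_ge0 ltW.
Qed.

Lemma der_lt f (f1 : R -> R) a b : a < b ->
  (forall t, a <= t <= b -> der t f (f1 t)) -> (forall t, a < t < b -> f1 t < 0) -> f b < f a.
Proof.
move=> ab df f1le.
have [c cab e] := der_mvt ab df; rewrite -subr_lt0 e.
by rewrite nmulr_rlt0 ?f1le// subr_gt0.
Qed.

Lemma der_ge f (f1 : R -> R) a b : a <= b ->
  (forall t, a <= t <= b -> der t f (f1 t)) -> (forall t, a < t < b -> 0 <= f1 t) -> f a <= f b.
Proof.
move=> ab df f1ge; rewrite -lerN2.
apply: (@der_le (fun x => - f x) (fun x => - f1 x)) => // t tab.
  by apply/derN/df.
by rewrite oppr_le0 f1ge.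
Qed.

Lemma der_gt f (f1 : R -> R) a b : a < b ->
  (forall t, a <= t <= b -> der t f (f1 t)) -> (forall t, a < t < b -> 0 < f1 t) -> f a < f b.
Proof.
move=> ab df f1ge; rewrite -ltrN2.
apply: (@der_lt (fun x => - f x) (fun x => - f1 x)) => // t tab.
  by apply/derN/df.
by rewrite oppr_lt0 f1ge.
Qed.

(** Convexity of the power, by the mean value theorem. Which of two solutions is taken as the point
    of tangency decides at which of them a difference is compared with a linearized equation. *)
Lemma powR_tangent (p x y : R) : 1 <= p -> 0 < x -> 0 < y ->
  y `^ p + p * y `^ (p - 1) * (x - y) <= x `^ p.
Proof.
move=> p1 x0 y0.
have [xy|yx|->] := ltgtP x y; last by rewrite subrr mulr0 addr0.
- have [t|c /andP[xc cy] e] := @der_mvt (fun z => z `^ p) (fun z => p * z `^ (p - 1) * 1) x y xy.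
    by move=> /andP[xt _]; apply: der_powR; [exact: lt_le_trans xt|exact: der_id].
  suff : p * c `^ (p - 1) * 1 * (y - x) <= p * y `^ (p - 1) * (y - x) by move: e; lra.
  rewrite mulr1 ler_wpM2r ?subr_ge0 ?(ltW xy)// ler_wpM2l//; first by lra.
  by rewrite ge0_ler_powR ?nnegrE ?subr_ge0// ltW// (lt_trans x0).
- have [t|c /andP[yc cx] e] := @der_mvt (fun z => z `^ p) (fun z => p * z `^ (p - 1) * 1) y x yx.
    by move=> /andP[yt _]; apply: der_powR; [exact: lt_le_trans yt|exact: der_id].
  suff : p * y `^ (p - 1) * (x - y) <= p * c `^ (p - 1) * 1 * (x - y) by move: e; lra.
  rewrite mulr1 ler_wpM2r ?subr_ge0 ?(ltW yx)// ler_wpM2l//; first by lra.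
  by rewrite ge0_ler_powR ?nnegrE ?subr_ge0// ltW// (lt_trans y0).
Qed.

Lemma powRD_gt0 (x r s : R) : 0 < x -> x `^ (r + s) = x `^ r * x `^ s.
Proof. by move=> x0; rewrite powRD//; apply/implyP => _; rewrite gt_eqF. Qed.

Lemma powRS_gt0 (x r : R) : 0 < x -> x `^ (r + 1) = x `^ r * x.
Proof. by move=> x0; rewrite powRD_gt0// powRr1// ltW. Qed.

End MeanValue.

(** * Radial solutions in logarithmic variables *)

Section Emden.
Context {R : realType}.
Implicit Types (n p : R) (F U V : R -> R).

(** Convergence to $0$ as $t\to-\infty$, that is, at the origin of $\mathbb R^N$. *)
Definition ninf0 F := forall e : R, 0 < e -> exists T, forall t, t <= T -> `|F t| <= e.

Lemma ninf0_le F t : ninf0 F -> (forall s, s <= t -> F t <= F s) -> F t <= 0.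
Proof.
move=> F0 Fle; rewrite leNgt; apply/negP => Ft.
have [|T FT] := F0 (F t / 2); first by lra.
have := FT (Num.min T t); rewrite ge_min lexx => /(_ isT).
have := Fle (Num.min T t); rewrite ge_min lexx orbT => /(_ isT).
have := ler_norm (F (Num.min T t)); lra.
Qed.

Lemma ninf0_expM k F : 0 <= k -> ninf0 F -> ninf0 (fun t => expR (k * t) * F t).
Proof.
move=> k0 F0 e e0; have [T FT] := F0 e e0.
exists (Num.min T 0) => t; rewrite le_min => /andP[tT t0].
rewrite normrM ger0_norm ?expR_ge0// -[e]mul1r ler_pM ?expR_ge0 ?FT//.
by rewrite expR_le1 mulr_ge0_le0.
Qed.

Lemma ninf0_ext F V : ninf0 F -> F =1 V -> ninf0 V.
Proof. by move=> F0 /funext <-. Qed.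

(* [U t = u (e^t)] solves [- u'' - (n+1)/r u' = v^p] with [u' -> 0] at the origin;
   [n] stands for [N - 2]. *)
Record emden n p U U1 V : Prop := Emden {
  emden_der : forall t, der t U (U1 t);
  emden_der1 : forall t, der t U1 (- n * U1 t - expR (2 * t) * V t `^ p);
  emden_pos : forall t, 0 < U t;
  emden_ninf : ninf0 (fun t => expR (- t) * U1 t) }.

(** Divergence form of the radial Laplacian: $e^{nt}U_1=r^{N-1}u'(r)$. *)
Lemma emden_flux n p U U1 V t : emden n p U U1 V ->
  der t (fun s => expR (n * s) * U1 s) (- (expR ((n + 2) * t) * V t `^ p)).
Proof.
move=> [_ d1 _ _]; der.
rewrite (_ : (n + 2) * t = n * t + 2 * t) ?expRD; last by ring.
ring.
Qed.

Lemma emden_flux0 n p U U1 V : -1 <= n -> emden n p U U1 V ->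
  ninf0 (fun s => expR (n * s) * U1 s).
Proof.
move=> n1 [_ _ _ h]; have n10 : 0 <= n + 1 by lra.
apply: ninf0_ext (ninf0_expM n10 h) _ => t.
by rewrite mulrA -expRD; congr (expR _ * _); ring.
Qed.

(** The flux decreases strictly from its limit $0$ at the origin. *)
Lemma emden_neg n p U U1 V t : -1 <= n -> emden n p U U1 V -> (forall t, 0 < V t) -> U1 t < 0.
Proof.
move=> n1 h V0; set F := fun s => expR (n * s) * U1 s.
have Flt a b : a < b -> F b < F a.
  move=> ab; apply: der_lt ab (fun t _ => emden_flux t h) _ => s _.
  by rewrite oppr_lt0 mulr_gt0 ?expR_gt0 ?powR_gt0.
have F0 : F (t - 1) <= 0.
  apply: ninf0_le (emden_flux0 n1 h) _ => s; rewrite le_eqVlt => /predU1P[->//|/Flt].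
  exact: ltW.
have : F t < 0 by apply: lt_le_trans F0; apply: Flt; lra.
by rewrite /F pmulr_rlt0 ?expR_gt0.
Qed.

Lemma emden_decr n p U U1 V s t : -1 <= n -> emden n p U U1 V -> (forall t, 0 < V t) ->
  s <= t -> U t <= U s.
Proof.
move=> n1 h V0 st; apply: der_le st (fun t _ => emden_der h t) _ => x _.
exact/ltW/(emden_neg _ n1 h).
Qed.

(** This is the flux identity integrated from the origin. [F] adds to the flux of $U$ an explicit
    term for the source with $V$ frozen at time $t$; as $V$ decreases, [F] is nonincreasing up to
    $t$, and it starts from $0$. *)
Lemma emden_bound n p U U1 V t : -1 <= n -> 0 <= p -> emden n p U U1 V ->
  (forall t, 0 < V t) -> (forall s, s <= t -> V t <= V s) ->
  (n + 2) * U1 t <= - (expR (2 * t) * V t `^ p).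
Proof.
move=> n1 p0 h V0 Vdecr; have n2 : 0 < n + 2 by lra.
pose F s := expR (n * s) * U1 s + V t `^ p / (n + 2) * expR ((n + 2) * s).
have dF s : der s F (expR ((n + 2) * s) * (V t `^ p - V s `^ p)).
  apply: der_eq; first by apply: derD (emden_flux s h) _; repeat der_step.
  by cbv beta delta [idfun]; field; lra.
have F0 : ninf0 F.
  move=> e e0; have e20 : 0 < e / 2 by lra.
  have [T hT] := emden_flux0 n1 h e20.
  set c := V t `^ p / (n + 2).
  have c0 : 0 < c by rewrite divr_gt0 ?powR_gt0.
  have Fe s : F s = expR (n * s) * U1 s + c * expR ((n + 2) * s) by [].
  clearbody c F; have ec0 : 0 < e / 2 / c by rewrite divr_gt0.
  exists (Num.min T (ln (e / 2 / c) / (n + 2))) => s; rewrite le_min => /andP[/hT sT].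
  rewrite ler_pdivlMr// mulrC -ler_expR lnK ?posrE// ler_pdivlMr// => sc.
  rewrite Fe; apply: le_trans (ler_normD _ _) _.
  have ce : `|c * expR ((n + 2) * s)| <= e / 2.
    by rewrite ger0_norm ?mulr_ge0 ?expR_ge0 ?(ltW c0)// mulrC.
  by move: sT ce; lra.
have Ft : F t <= 0.
  apply: ninf0_le F0 _ => s st; apply: der_le st (fun t _ => dF t) _ => x /andP[_ xt].
  rewrite mulr_ge0_le0 ?expR_ge0// subr_le0 ge0_ler_powR ?nnegrE ?(ltW (V0 _))//.
  by apply: Vdecr; exact: ltW.
have : F t = expR (n * t) / (n + 2) * ((n + 2) * U1 t + expR (2 * t) * V t `^ p).
  rewrite /F (_ : (n + 2) * t = n * t + 2 * t) ?expRD; last by ring.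
  by field; lra.
move=> e; move: Ft; rewrite e pmulr_rle0 ?divr_gt0 ?expR_gt0//; lra.
Qed.

Lemma pos_not_linear U U1 T c : 0 < c -> (forall t, der t U (U1 t)) -> (forall t, 0 < U t) ->
  ~ (forall t, T <= t -> U1 t <= - c).
Proof.
move=> c0 dU U0 h; set x := T + U T / c.
have Tx : T <= x by rewrite lerDl divr_ge0 ?(ltW (U0 _)) ?(ltW c0).
have : U x + c * x <= U T + c * T.
  apply: (@der_le R (fun x => U x + c * x) (fun x => U1 x + c)) Tx _ _ => t.
    by move=> _; der; ring.
  by move=> /andP[/ltW Tt _]; have := h _ Tt; lra.
have e : c * x = c * T + U T by rewrite /x; field; lra.
have := U0 x; lra.
Qed.

(** In dimensions one and two the flux bound would force $U$ to fall at least linearly in $t=\ln r$: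
    the Liouville property of positive superharmonic functions. *)
Lemma emden_dim n p U U1 V : -1 <= n -> emden n p U U1 V -> (forall t, 0 < V t) -> 0 < n.
Proof.
move=> n1 h V0; rewrite ltNge; apply/negP => n0.
have U10 : 0 < - U1 0 by rewrite oppr_gt0; exact: emden_neg n1 h V0.
apply: (@pos_not_linear U U1 0 _ U10 (emden_der h) (emden_pos h)) => t t0.
have le0 : expR (n * t) * U1 t <= U1 0.
  have := @der_le _ _ _ _ _ t0 (fun t _ => emden_flux t h).
  rewrite mulr0 expR0 mul1r; apply => s _.
  by rewrite oppr_le0 mulr_ge0 ?expR_ge0 ?powR_ge0.
have : expR (n * t) <= 1 by rewrite expR_le1 mulr_le0_ge0.
have := emden_neg t n1 h V0; have := expR_gt0 (n * t); nra.
Qed.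

(** [n * U + U1] is nonincreasing; were it negative once, $U_1$ would stay below a negative
    constant. The conclusion means that $r^{N-2}u$ is nondecreasing. *)
Lemma emden_low n p U U1 V t : 0 <= n -> emden n p U U1 V -> (forall t, 0 < V t) ->
  0 <= n * U t + U1 t.
Proof.
move=> n0 h V0; have n1 : -1 <= n by lra.
rewrite leNgt; apply/negP => neg.
have c0 : 0 < - (n * U t + U1 t) by lra.
apply: (@pos_not_linear U U1 t _ c0 (emden_der h) (emden_pos h)) => s ts.
have : n * U s + U1 s <= n * U t + U1 t.
  apply: (@der_le _ (fun s => n * U s + U1 s) (fun s => - (expR (2 * s) * V s `^ p))) ts _ _.
    by move=> x _; have dU := emden_der h; have dU1 := emden_der1 h; der; ring.
  by move=> x _; rewrite oppr_le0 mulr_ge0 ?expR_ge0 ?powR_ge0.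
have := emden_pos h s; nra.
Qed.

Lemma emden_incr n p U U1 V s t : 0 <= n -> emden n p U U1 V -> (forall t, 0 < V t) ->
  s <= t -> expR (n * s) * U s <= expR (n * t) * U t.
Proof.
move=> n0 h V0 st.
apply: (@der_ge _ (fun s => expR (n * s) * U s)
   (fun s => expR (n * s) * (n * U s + U1 s))) st _ _ => x _.
  by have dU := emden_der h; der; ring.
by rewrite mulr_ge0 ?expR_ge0// (emden_low _ n0 h).
Qed.

(** One unit of logarithmic time suffices: $U(t)\ge U(t)-U(t+1)=-U_1(c)$, to which [emden_bound]
    applies, and between $t$ and $c$ the function $V$ loses at most the factor $e^{-n}$. *)
Lemma emden_growth n p q U U1 V V1 t : 0 <= n -> 0 <= p ->
  emden n p U U1 V -> emden n q V V1 U ->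
  expR (- n) `^ p / (n + 2) * (expR (2 * t) * V t `^ p) <= U t.
Proof.
move=> n0 p0 hU hV; have n1 : -1 <= n by lra.
have U0 := emden_pos hU; have V0 := emden_pos hV.
have t1 : t < t + 1 by lra.
have [c /andP[tc ct] e] := der_mvt t1 (fun t _ => emden_der hU t).
have Vd s : s <= c -> V c <= V s by move=> sc; apply: emden_decr n1 hV U0 sc.
have := emden_bound n1 p0 hU V0 Vd.
have Vt : expR (- n) * V t <= V c.
  have := emden_incr n0 hV U0 (ltW tc).
  rewrite -ler_pdivlMl ?expR_gt0// -expRN mulrA -expRD => le1.
  apply: le_trans (ler_wpM2l (expR_ge0 (- n)) le1) _.
  by rewrite mulrA -expRD ler_piMl ?(ltW (V0 _))// expR_le1; nra.
have : (expR (- n) * V t) `^ p <= V c `^ p.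
  by rewrite ge0_ler_powR ?nnegrE ?mulr_ge0 ?expR_ge0 ?(ltW (V0 _)).
rewrite powRM ?expR_ge0 ?(ltW (V0 _))// => le2.
have : expR (2 * t) <= expR (2 * c) by rewrite ler_expR; lra.
move=> le3.
have : expR (2 * t) * (expR (- n) `^ p * V t `^ p) <= expR (2 * c) * V c `^ p.
  by rewrite ler_pM ?mulr_ge0 ?expR_ge0 ?powR_ge0.
move=> le4 le5; have : (n + 2) * (U (t + 1) - U t) <= - (expR (2 * t) * (expR (- n) `^ p * V t `^ p)).
  by rewrite e (_ : t + 1 - t = 1); [move: le5 le4; lra | ring].
have := U0 (t + 1) => Ut1 le6.
have n2 : 0 < n + 2 by lra.
rewrite mulrAC ler_pdivrMr//; nra.
Qed.

(** Inserting one growth bound into the other gives $U\ge c\,e^{2(p+1)t}U^{pq}$, which can be solved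
    for $U$ because $pq>1$. Logarithms make the two bounds linear. *)
Lemma emden_decay n p q a U U1 V V1 : 0 <= n -> 0 <= p -> 0 <= q -> 1 < p * q ->
  a * (p * q - 1) = 2 * (p + 1) ->
  emden n p U U1 V -> emden n q V V1 U ->
  exists2 C, 0 < C & forall t, U t <= C * expR (- (a * t)).
Proof.
move=> n0 p0 q0 pq ea hU hV.
have U0 := emden_pos hU; have V0 := emden_pos hV.
pose c r := expR (- n) `^ r / (n + 2).
have c0 r : 0 < c r by rewrite divr_gt0 ?powR_gt0 ?expR_gt0//; lra.
have lnle r (X Y : R -> R) t : 0 < X t -> 0 < Y t -> c r * (expR (2 * t) * Y t `^ r) <= X t ->
    ln (c r) + 2 * t + r * ln (Y t) <= ln (X t).
  move=> X0 Y0 le1; have cr := c0 r.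
  have Yr : 0 < Y t `^ r by rewrite powR_gt0.
  have EY : 0 < expR (2 * t) * Y t `^ r by rewrite mulr_gt0 ?expR_gt0.
  have : ln (c r * (expR (2 * t) * Y t `^ r)) <= ln (X t).
    by rewrite ler_ln ?posrE//; apply: mulr_gt0.
  by rewrite (lnM cr EY) (lnM (expR_gt0 _) Yr) expRK ln_powR addrA.
have lU t : ln (c p) + 2 * t + p * ln (V t) <= ln (U t).
  exact: lnle (U0 _) (V0 _) (emden_growth t n0 p0 hU hV).
have lV t : ln (c q) + 2 * t + q * ln (U t) <= ln (V t).
  exact: lnle (V0 _) (U0 _) (emden_growth t n0 q0 hV hU).
set K := (ln (c p) + p * ln (c q)).
exists (expR (- K / (p * q - 1))); first exact: expR_gt0.
move=> t; rewrite -expRD -[U t]lnK ?posrE// ler_expR.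
rewrite (_ : - K / (p * q - 1) - a * t = (- K - 2 * (p + 1) * t) / (p * q - 1)); last first.
  by rewrite -ea; field; lra.
rewrite ler_pdivlMr; last by lra.
have := lU t; have := lV t.
have := ler_wpM2l p0 (lV t); rewrite /K; lra.
Qed.
End Emden.

(** * The Pohozaev identity *)

Section Pohozaev.
Context {R : realType}.

Lemma ninf0_exp (k K : R) : 0 < k -> 0 <= K -> ninf0 (fun t => K * expR (k * t)).
Proof.
move=> k0 K0 e e0; have K1 : 0 < K + 1 by lra.
have eK : 0 < e / (K + 1) by rewrite divr_gt0.
exists (ln (e / (K + 1)) / k) => t.
rewrite ler_pdivlMr// mulrC -ler_expR lnK ?posrE// ler_pdivlMr// => le1.
rewrite ger0_norm ?mulr_ge0 ?expR_ge0//.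
have := expR_ge0 (k * t); nra.
Qed.

Lemma ninf0_ge (G : R -> R) y t : ninf0 G -> (forall s, s <= t -> y <= G s) -> y <= 0.
Proof.
move=> G0 h; rewrite leNgt; apply/negP => y0.
have [|T hT] := G0 (y / 2); first by lra.
have := hT (Num.min T t); rewrite ge_min lexx => /(_ isT).
have := h (Num.min T t); rewrite ge_min lexx orbT => /(_ isT).
have := ler_norm (G (Num.min T t)); lra.
Qed.

(** Near the origin $|U_1|\le e^t$ is integrable in $t$; later $U$ decreases. *)
Lemma emden_ub (n p : R) U U1 V : -1 <= n -> emden n p U U1 V -> (forall t, 0 < V t) ->
  exists2 M, 0 < M & forall t, U t <= M.
Proof.
move=> n1 h V0; have [T hT] := emden_ninf h ltr01.
exists (U T + expR T); first by rewrite addr_gt0 ?expR_gt0 ?(emden_pos h).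
move=> t; have [tT|Tt] := leP t T; last first.
  have := emden_decr n1 h V0 (ltW Tt); have := expR_gt0 T; lra.
have dU := emden_der h.
have : U t + expR t <= U T + expR T.
  apply: (@der_ge _ (fun s => U s + expR s) (fun s => U1 s + expR s)) tT _ _ => s.
    by move=> _; der; ring.
  move=> /andP[_ /ltW sT].
  have := hT s sT; rewrite normrM ger0_norm ?expR_ge0// expRN ler_pdivrMl ?expR_gt0//.
  rewrite mulr1 => le1; have := ler_norm (- U1 s); rewrite normrN; lra.
have := expR_gt0 t; lra.
Qed.

(** $a+b>n$ is the subcritical range $\frac N{p+1}+\frac N{q+1}>N-2$. There the Pohozaev function
    [E] would be strictly increasing, while its limit is at least $0$ at the origin and at most $0$
    at infinity. *)
Lemma emden_pohozaev (n p q a b : R) U U1 V V1 :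
  0 < n -> 0 < p -> 0 < q -> 1 < p * q ->
  a * (p * q - 1) = 2 * (p + 1) -> b * (p * q - 1) = 2 * (q + 1) ->
  emden n p U U1 V -> emden n q V V1 U -> a + b <= n.
Proof.
move=> n0 p0 q0 pq ea eb hU hV; have n1 : -1 <= n by lra.
have U0 := emden_pos hU; have V0 := emden_pos hV.
have dU := emden_der hU; have dV := emden_der hV.
have dU1 := emden_der1 hU; have dV1 := emden_der1 hV.
rewrite leNgt; apply/negP => nab.
have pq1 : 0 < p * q - 1 by lra.
have sub : n * (p * q - 1) < 2 * (p + q + 2).
  have : n * (p * q - 1) < (a + b) * (p * q - 1) by rewrite ltr_pM2r.
  by move: ea eb; lra.
have pq2 : 0 < p + q + 2 by lra.
(* [A] and [B] are the same fraction of $N/(p+1)$ and $N/(q+1)$, with sum $n$; by [sub] this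
   fraction is below $1$, so both coefficients in the derivative of [E] are positive. *)
pose A := n * (q + 1) / (p + q + 2); pose B := n * (p + 1) / (p + q + 2).
have A0 : 0 <= A by rewrite divr_ge0 ?mulr_ge0//; lra.
have B0 : 0 <= B by rewrite divr_ge0 ?mulr_ge0//; lra.
have AN : A < (n + 2) / (p + 1).
  rewrite /A ltr_pdivrMr// mulrAC ltr_pdivlMr; last by lra.
  by lra.
have BN : B < (n + 2) / (q + 1).
  rewrite /B ltr_pdivrMr// mulrAC ltr_pdivlMr; last by lra.
  by lra.
have AB : A + B = n by rewrite /A /B; field; lra.
clearbody A B.
have pp : 0 < p + 1 by lra.
have qq : 0 < q + 1 by lra.
pose E t := expR (n * t) * (U1 t * V1 t + expR (2 * t) *
   (V t `^ (p + 1) / (p + 1) + U t `^ (q + 1) / (q + 1)) + A * (U1 t * V t) + B * (U t * V1 t)).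
have Vp t : V t `^ (p + 1) = V t `^ p * V t by exact: powRS_gt0.
have Uq t : U t `^ (q + 1) = U t `^ q * U t by exact: powRS_gt0.
have dE t : der t E (expR (n * t) * expR (2 * t) *
    (((n + 2) / (p + 1) - A) * V t `^ (p + 1) + ((n + 2) / (q + 1) - B) * U t `^ (q + 1))).
  der => //.
  rewrite (_ : p + 1 - 1 = p); last by ring.
  rewrite (_ : q + 1 - 1 = q); last by ring.
  rewrite Vp Uq -AB; field; lra.
have Elt s t : s < t -> E s < E t.
  move=> st; apply: der_gt st (fun t _ => dE t) _ => x _.
  by rewrite !mulr_gt0 ?expR_gt0// addr_gt0// mulr_gt0 ?powR_gt0// subr_gt0.
have low1 t : - (n * U t) <= U1 t by have := emden_low t (ltW n0) hU V0; lra.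
have low2 t : - (n * V t) <= V1 t by have := emden_low t (ltW n0) hV U0; lra.
have U1n t : U1 t < 0 := emden_neg t n1 hU V0.
have V1n t : V1 t < 0 := emden_neg t n1 hV U0.
have [M M0 UM] := emden_ub n1 hU V0; have [M' M'0 VM] := emden_ub n1 hV U0.
have E0 : 0 <= E (-1).
  rewrite -oppr_le0.
  apply: (@ninf0_ge (fun t => n * n * M * M' * expR (n * t)) _ (-1)).
    by apply: ninf0_exp => //; rewrite !mulr_ge0 // ltW.
  move=> s s0; apply: (@le_trans _ _ (- E s)).
    by rewrite lerN2; move: s0; rewrite le_eqVlt => /predU1P[->//|/Elt /ltW].
  rewrite /E -mulrN [leRHS]mulrC ler_wpM2l ?expR_ge0//.
  have UV : U s * V s <= M * M' by rewrite ler_pM ?(ltW (U0 _)) ?(ltW (V0 _)).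
  have h1 : - (n * (U s * V s)) <= U1 s * V s by have := low1 s; have := V0 s; nra.
  have h2 : - (n * (U s * V s)) <= U s * V1 s by have := low2 s; have := U0 s; nra.
  have h3 : 0 <= U1 s * V1 s by have := U1n s; have := V1n s; nra.
  have h4 : 0 <= expR (2 * s) * (V s `^ (p + 1) / (p + 1) + U s `^ (q + 1) / (q + 1)).
    by rewrite mulr_ge0 ?expR_ge0 ?addr_ge0// divr_ge0 ?powR_ge0// ltW.
  have h5 : A * - (n * (U s * V s)) <= A * (U1 s * V s) by rewrite ler_wpM2l.
  have h6 : B * - (n * (U s * V s)) <= B * (U s * V1 s) by rewrite ler_wpM2l.
  have h7 : n * n * (U s * V s) <= n * n * (M * M') by rewrite ler_wpM2l ?mulr_ge0// ltW.
  have h8 : (A + B) * (n * (U s * V s)) = n * n * (U s * V s) by rewrite AB; ring.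
  nra.
have E00 : 0 < E 0 by apply: le_lt_trans E0 (Elt _ _ _); lra.
have [Cu Cu0 hCu] := emden_decay (ltW n0) (ltW p0) (ltW q0) pq ea hU hV.
have eb' : b * (q * p - 1) = 2 * (q + 1) by rewrite [q * p]mulrC.
have qp : 1 < q * p by rewrite mulrC.
have [Cv Cv0 hCv] := emden_decay (ltW n0) (ltW q0) (ltW p0) qp eb' hV hU.
have gU t := emden_growth t (ltW n0) (ltW p0) hU hV.
have gV t := emden_growth t (ltW n0) (ltW q0) hV hU.
move: gU gV; set cp := expR (- n) `^ p / (n + 2); set cq := expR (- n) `^ q / (n + 2) => gU gV.
have cp0 : 0 < cp by rewrite divr_gt0 ?powR_gt0 ?expR_gt0//; lra.
have cq0 : 0 < cq by rewrite divr_gt0 ?powR_gt0 ?expR_gt0//; lra.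
clearbody cp cq.
pose K := n * n + cp^-1 + cq^-1.
have K0 : 0 <= K by rewrite !addr_ge0 ?mulr_ge0 ?invr_ge0// ltW.
suff : E 0 <= 0 by rewrite leNgt E00.
have kn : 0 < a + b - n by lra.
(* The growth bounds dominate each positive term of [E] by a multiple of $e^{nt}UV$, and the decay
   bounds make this $O(e^{-(a+b-n)t})$. Time is reversed because [ninf0_ge] concerns $-\infty$. *)
apply: (@ninf0_ge (fun t => K * (Cu * Cv) * expR ((a + b - n) * t)) _ 0).
  by apply: ninf0_exp => //; rewrite !mulr_ge0// ltW.
move=> t t0; apply: (@le_trans _ _ (E (- t))).
  by move: t0; rewrite le_eqVlt => /predU1P[->|t0]; rewrite ?oppr0// ltW// Elt// oppr_gt0.
set s := - t; have -> : t = - s by rewrite opprK.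
apply: (@le_trans _ _ (expR (n * s) * (K * (U s * V s)))).
  rewrite /E ler_wpM2l ?expR_ge0//.
  have h1 : U1 s * V1 s <= n * n * (U s * V s).
    have -> : n * n * (U s * V s) = n * U s * (n * V s) by ring.
    by rewrite -mulrNN ler_pM ?oppr_ge0 ?(ltW (U1n _)) ?(ltW (V1n _))// lerNl.
  have h2 : A * (U1 s * V s) <= 0 by rewrite mulr_ge0_le0// mulr_le0_ge0// ltW.
  have h3 : B * (U s * V1 s) <= 0 by rewrite mulr_ge0_le0// mulr_ge0_le0// ltW.
  have h4 : expR (2 * s) * (V s `^ (p + 1) / (p + 1)) <= cp^-1 * (U s * V s).
    apply: (@le_trans _ _ (expR (2 * s) * V s `^ p * V s)).
      rewrite Vp mulrA ler_pdivrMr//.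
      have : 0 <= expR (2 * s) * V s `^ p * V s by rewrite !mulr_ge0 ?expR_ge0 ?powR_ge0// ltW.
      by move=> Z0; rewrite !mulrA ler_peMr// lerDr ltW.
    by rewrite mulrA ler_wpM2r ?(ltW (V0 _))// ler_pdivlMl.
  have h5 : expR (2 * s) * (U s `^ (q + 1) / (q + 1)) <= cq^-1 * (U s * V s).
    apply: (@le_trans _ _ (expR (2 * s) * U s `^ q * U s)).
      rewrite Uq mulrA ler_pdivrMr//.
      have : 0 <= expR (2 * s) * U s `^ q * U s by rewrite !mulr_ge0 ?expR_ge0 ?powR_ge0// ltW.
      by move=> Z0; rewrite !mulrA ler_peMr// lerDr ltW.
    by rewrite [U s * V s]mulrC mulrA ler_wpM2r ?(ltW (U0 _))// ler_pdivlMl.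
  by move: h1 h2 h3 h4 h5; rewrite /K; clear; lra.
have UV : U s * V s <= Cu * expR (- (a * s)) * (Cv * expR (- (b * s))).
  by rewrite ler_pM ?(ltW (U0 _)) ?(ltW (V0 _)).
have -> : K * (Cu * Cv) * expR ((a + b - n) * - s) =
   expR (n * s) * (K * (Cu * expR (- (a * s)) * (Cv * expR (- (b * s))))).
  rewrite (_ : (a + b - n) * - s = n * s + (- (a * s) + - (b * s))); last by ring.
  by rewrite !expRD; ring.
by rewrite ler_wpM2l ?expR_ge0// ler_wpM2l.
Qed.

End Pohozaev.

(** * Crossings and limits *)

Section Crossing.
Context {R : realType}.

Lemma cont_gt_near (h : R -> R) c y : {for c, continuous h} -> y < h c ->
  exists2 d : R, 0 < d & forall t, `|t - c| < d -> y < h t.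
Proof.
move=> hc yc; have /nbhs_ballP[d /= d0 hd] : nbhs c [set t | y < h t]%classic.
  exact: (@cvgr_gt _ _ _ _ _ _ hc y yc).
by exists d => // t tc; apply: hd; rewrite /ball/= distrC.
Qed.

Lemma cont_lt_near (h : R -> R) c y : {for c, continuous h} -> h c < y ->
  exists2 d : R, 0 < d & forall t, `|t - c| < d -> h t < y.
Proof.
move=> hc yc; have /nbhs_ballP[d /= d0 hd] : nbhs c [set t | h t < y]%classic.
  exact: (@cvgr_lt _ _ _ _ _ _ hc y yc).
by exists d => // t tc; apply: hd; rewrite /ball/= distrC.
Qed.

Lemma der_slope (f : R -> R) t d : der t f d ->
  exists g : R -> R, [/\ forall z, f z - f t = g z * (z - t), {for t, continuous g} & g t = d].
Proof. by move/is_derive1_caratheodory. Qed.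

Lemma der_neg_right (f : R -> R) t d : der t f d -> d < 0 ->
  exists2 e : R, 0 < e & forall s, t < s < t + e -> f s < f t.
Proof.
move=> /der_slope[g [fg gt <-]] /(cont_lt_near gt)[e e0 he].
exists e => // s /andP[ts se]; rewrite -subr_lt0 fg nmulr_rlt0 ?subr_gt0// he//.
by rewrite gtr0_norm ?subr_gt0//; lra.
Qed.

Lemma der_pos_right (f : R -> R) t d : der t f d -> 0 < d ->
  exists2 e : R, 0 < e & forall s, t < s < t + e -> f t < f s.
Proof.
move=> df d0; have [|e e0 he] := der_neg_right (derN df); first by rewrite oppr_lt0.
by exists e => // s /he; rewrite ltrN2.
Qed.

Lemma first_neg (h : R -> R) a b : continuous h -> a <= b -> 0 <= h a -> h b < 0 ->
  exists c, [/\ a <= c, forall t, a <= t <= c -> 0 <= h t, h c = 0 &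
    forall e, 0 < e -> exists2 t, c < t < c + e & h t < 0].
Proof.
move=> hc ab ha hb; pose S := [set t | a <= t /\ h t < 0]%classic.
have Sb : S b by [].
have lbS : lbound S a by move=> t [].
have hS : has_inf S by split; [exists b|exists a].
pose c := inf S.
have ac : a <= c by apply: lb_le_inf => //; exists b.
have cS t : S t -> c <= t by move=> St; apply: ge_inf => //; exists a.
have pre t : a <= t -> t < c -> 0 <= h t.
  by move=> at_ tc; rewrite leNgt; apply/negP => ht; have := cS t (conj at_ ht); rewrite leNgt tc.
have hc0 : 0 <= h c.
  rewrite leNgt; apply/negP => hc_lt.
  have [e e0 he] := cont_lt_near (hc c) hc_lt.
  move: ac; rewrite le_eqVlt => /predU1P[ace|ac].
    by move: ha; rewrite ace leNgt hc_lt.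
  pose s := Num.max a (c - e / 2).
  have sc : s < c by rewrite gt_max ac/=; lra.
  have sa : a <= s by rewrite le_max lexx.
  have se : c - e / 2 <= s by rewrite le_max lexx orbT.
  have := pre s sa sc; rewrite leNgt he//.
  by rewrite distrC gtr0_norm ?subr_gt0//; lra.
have adh e : 0 < e -> exists2 t, S t & t < c + e.
  by move=> e0; apply: inf_adherent.
have hc1 : h c = 0.
  apply/eqP; rewrite eq_le hc0 andbT leNgt; apply/negP => hc_gt.
  have [e e0 he] := cont_gt_near (hc c) hc_gt.
  have [t St tc] := adh e e0; have ct := cS t St.
  case: St => _; rewrite ltNge ltW// he//.
  by rewrite ger0_norm ?subr_ge0//; lra.
exists c; split => //.
  move=> t /andP[at_]; rewrite le_eqVlt => /predU1P[->//|]; exact: pre.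
move=> e /adh[t St te]; exists t; last by case: St.
rewrite te andbT lt_neqAle cS// andbT; apply/eqP => ct.
by case: St => _; rewrite -ct hc1 ltxx.
Qed.

(** That is, $\limsup f\ge0$ at $+\infty$: a decreasing $f$ cannot become negative for good. *)
Definition not_below_neg (f : R -> R) :=
  forall c T : R, 0 < c -> exists2 t, T <= t & - c < f t.

(* [x'' + n x' = e^(-nt) (e^(nt) x')'], so a sign of the left-hand side makes
   [e^(nt) x'] monotone. *)
Lemma flux_neg (n : R) (f1 f2 : R -> R) s t : s <= t -> (forall t, der t f1 (f2 t)) ->
  (forall x, s < x < t -> f2 x + n * f1 x <= 0) -> f1 s < 0 -> f1 t < 0.
Proof.
move=> st d1 h fs; have : expR (n * t) * f1 t <= expR (n * s) * f1 s.
  apply: (@der_le _ (fun t => expR (n * t) * f1 t)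
     (fun t => expR (n * t) * (f2 t + n * f1 t))) st _ _ => x.
    by move=> _; der; ring.
  by move=> /h ?; rewrite mulr_ge0_le0 ?expR_ge0.
have : expR (n * s) * f1 s < 0 by rewrite pmulr_rlt0 ?expR_gt0.
by move=> lt0 /le_lt_trans/(_ lt0); rewrite pmulr_rlt0 ?expR_gt0.
Qed.

(** The two applications use different halves: the pairing functional is negative at [t1], and
    stability forbids [t2]. *)
Definition crossed (f f1 g g1 : R -> R) := exists t1,
  [/\ f t1 <= 0, g t1 <= 0, f1 t1 <= 0, g1 t1 <= 0 &
      (f1 t1 < 0 \/ g1 t1 < 0) /\ exists t2, f t2 < 0 /\ g t2 < 0].

(** While $g\ge0$ the flux of $f$ stays negative, so $f$ sinks below $0$ and keeps decreasing.
    [not_below_neg] then forces $g$ to become negative later; when $g$ reaches $0$, $f$ is already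
    negative, and $g$ has negative values arbitrarily soon after. *)
Lemma crossing_aux (n : R) (f f1 f2 g g1 : R -> R) r :
  (forall t, der t f (f1 t)) -> (forall t, der t f1 (f2 t)) ->
  (forall t, der t g (g1 t)) ->
  (forall t, 0 <= g t -> f2 t + n * f1 t <= 0) ->
  not_below_neg f -> f r = 0 -> f1 r < 0 -> 0 <= g r -> g1 r < 0 ->
  crossed f f1 g g1.
Proof.
move=> df df1 dg hf nbf fr f1r gr g1r.
have cf : continuous f by move=> x; exact: der_cont (df x).
have cg : continuous g by move=> x; exact: der_cont (dg x).
move: gr; rewrite le_eqVlt => /predU1P[gr|gr].
  exists r; rewrite fr -gr; split => //; [exact: ltW|exact: ltW|split; first by left].
  have [e e0 he] := der_neg_right (df r) f1r; have [e' e'0 he'] := der_neg_right (dg r) g1r.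
  pose d := Num.min e e' / 2.
  have d0 : 0 < Num.min e e' by rewrite lt_min e0.
  have de : Num.min e e' <= e by rewrite ge_min lexx.
  have de' : Num.min e e' <= e' by rewrite ge_min lexx orbT.
  exists (r + d); split; [rewrite -fr; apply: he|rewrite gr; apply: he'];
    by rewrite /d; apply/andP; split; lra.
have [[t3 rt3 gt3]|gpos] := pselect (exists2 t, r <= t & g t < 0); last first.
  have gge t : r <= t -> 0 <= g t.
    by move=> rt; rewrite leNgt; apply/negP => gt; apply: gpos; exists t.
  have f1n t : r <= t -> f1 t < 0.
    by move=> rt; apply: (flux_neg rt df1) f1r => x /andP[/ltW/gge]; auto.
  have fr1 : f (r + 1) < 0.
    rewrite -fr; apply: der_lt (fun t _ => df t) _; first by lra.
    by move=> t /andP[/ltW/f1n].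
  have [|t rt] := nbf (- f (r + 1)) (r + 1); first by lra.
  have : f t <= f (r + 1).
    apply: der_le rt (fun t _ => df t) _ => x /andP[rx _].
    by apply/ltW/f1n; lra.
  by lra.
have [c [rc gge gc adh]] := first_neg cg rt3 (ltW gr) gt3.
have rc' : r < c by rewrite lt_neqAle rc andbT; apply/eqP => rce; move: gr; rewrite rce gc ltxx.
have f1n t : r <= t <= c -> f1 t < 0.
  move=> /andP[rt tc]; apply: (flux_neg rt df1) f1r => x /andP[rx xt].
  by apply/hf/gge; lra.
have fc : f c < 0.
  rewrite -fr; apply: der_lt rc' (fun t _ => df t) _.
  by move=> t /andP[rt tc]; apply: f1n; lra.
have g1c : g1 c <= 0.
  rewrite leNgt; apply/negP => /(der_pos_right (dg c))[e /adh[t tc gt]] /(_ t tc).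
  by rewrite gc ltNge ltW.
exists c; rewrite gc; split => //; [exact: ltW|by apply/ltW/f1n; rewrite rc lexx|].
split; first by left; apply: f1n; rewrite rc lexx.
have [e e0 he] := cont_lt_near (cf c) fc.
have [t /andP[ct tc] gt] := adh e e0; exists t; split => //.
by apply: he; rewrite gtr0_norm ?subr_gt0//; lra.
Qed.

(** Up to the first zero of $\min(f,g)$ both fluxes remain negative, so at that zero one component
    vanishes with negative slope and [crossing_aux] applies to the pair in the suitable order. *)
Lemma crossing (n : R) (f f1 f2 g g1 g2 : R -> R) t0 :
  (forall t, der t f (f1 t)) -> (forall t, der t f1 (f2 t)) ->
  (forall t, der t g (g1 t)) -> (forall t, der t g1 (g2 t)) ->
  (forall t, 0 <= g t -> f2 t + n * f1 t <= 0) ->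
  (forall t, 0 <= f t -> g2 t + n * g1 t <= 0) ->
  not_below_neg f -> not_below_neg g ->
  (forall t, t <= t0 -> 0 <= f t /\ 0 <= g t) -> f1 t0 < 0 -> g1 t0 < 0 ->
  (forall t, 0 <= f t /\ 0 <= g t) \/ crossed f f1 g g1.
Proof.
move=> df df1 dg dg1 hf hg nbf nbg pos0 f10 g10.
have cf : continuous f by move=> x; exact: der_cont (df x).
have cg : continuous g by move=> x; exact: der_cont (dg x).
have [|/existsNP[s sneg]] := pselect (forall t, 0 <= f t /\ 0 <= g t); first by left.
right; pose h t := Num.min (f t) (g t).
have hge t : (0 <= h t) = (0 <= f t) && (0 <= g t) by rewrite le_min.
have ch : continuous h by move=> x; apply: continuous_min; [exact: cf|exact: cg].
have h0 : 0 <= h t0 by rewrite hge; have [-> ->] := pos0 t0 (lexx _).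
have hs : h s < 0 by rewrite ltNge hge; apply/negP => /andP[? ?]; exact: sneg.
have t0s : t0 <= s.
  by rewrite leNgt; apply/negP => /ltW/pos0.
have [c [t0c hpos hc _]] := first_neg ch t0s h0 hs.
have fgpos t : t0 <= t <= c -> 0 <= f t /\ 0 <= g t.
  by move=> /hpos; rewrite hge => /andP.
have [fc0 gc0] : 0 <= f c /\ 0 <= g c by apply: fgpos; rewrite t0c lexx.
have f1c : f1 c < 0.
  apply: (flux_neg t0c df1) f10 => x xt; apply: hf.
  by have [] : 0 <= f x /\ 0 <= g x by apply: fgpos; lra.
have g1c : g1 c < 0.
  apply: (flux_neg t0c dg1) g10 => x xt; apply: hg.
  by have [] : 0 <= f x /\ 0 <= g x by apply: fgpos; lra.
have [fc|gc] : f c = 0 \/ g c = 0.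
  by move: hc; rewrite /h minEle; case: ifP; [left|right].
  exact: crossing_aux df df1 dg hf nbf fc f1c gc0 g1c.
have [t [? ? ? ? [H [t2 [? ?]]]]] := crossing_aux dg dg1 df hg nbg gc g1c fc0 f1c.
by exists t; split => //; split; [case: H; [right|left]|exists t2].
Qed.

End Crossing.

(** * Identification of limits of bounded monotone orbits *)

Section Limits.
Context {R : realType}.

(** One integration gives $w'+cw\ge K+e(t-T)$. As $w$ is bounded, $w'\ge1$ eventually, whatever the
    sign of $c$, and $w$ is unbounded after all. *)
Lemma damped_growth (w w1 w2 : R -> R) c M e T : 0 < e ->
  (forall t, der t w (w1 t)) -> (forall t, der t w1 (w2 t)) -> (forall t, `|w t| <= M) ->
  ~ (forall t, T <= t -> e <= w2 t + c * w1 t).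
Proof.
move=> e0 dw dw1 wM h.
pose K := w1 T + c * w T.
have lin t : T <= t -> K + e * (t - T) <= w1 t + c * w t.
  move=> Tt; have := @der_ge _ (fun t => w1 t + c * w t - e * t) (fun t => w2 t + c * w1 t - e) T t Tt.
  rewrite /K => H; suff : w1 T + c * w T - e * T <= w1 t + c * w t - e * t by lra.
  apply: H => x.
    by move=> _; der; ring.
  by move=> /andP[/ltW/h]; lra.
have M0 : 0 <= M by apply: le_trans (wM 0).
have cw t : c * w t <= `|c| * M.
  by apply: le_trans (ler_norm _) _; rewrite normrM ler_wpM2l.
pose T' := T + (`|K| + `|c| * M + 1) / e.
have TT' : T <= T' by rewrite lerDl divr_ge0 ?addr_ge0 ?mulr_ge0// ltW.
have w1ge t : T' <= t -> 1 <= w1 t.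
  move=> T't; have := lin t (le_trans TT' T't); have := cw t.
  have : e * (T' - T) <= e * (t - T) by rewrite ler_wpM2l ?(ltW e0)//; lra.
  have -> : e * (T' - T) = `|K| + `|c| * M + 1 by rewrite /T'; field; lra.
  have := ler_norm (- K); rewrite normrN; lra.
have T'2 : T' <= T' + (2 * M + 1) by lra.
have := @der_ge _ (fun t => w t - t) (fun t => w1 t - 1) _ _ T'2.
have H : w T' - T' <= w (T' + (2 * M + 1)) - (T' + (2 * M + 1)) -> False.
  have := wM T'; have := wM (T' + (2 * M + 1)).
  by rewrite !ler_norml => /andP[? ?] /andP[? ?]; lra.
move=> H'; apply/H/H' => x.
  by move=> _; der; ring.
by move=> /andP[/ltW/w1ge]; lra.
Qed.

Lemma monotone_sup (w : R -> R) M : (forall s t, s <= t -> w s <= w t) -> (forall t, w t <= M) ->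
  exists A, (forall t, w t <= A) /\
    forall e : R, 0 < e -> exists T, forall t, T <= t -> A - e <= w t.
Proof.
move=> wm wM; have hs : has_sup (range w) by split; [exists (w 0), 0|exists M => _ [t _ <-]].
exists (sup (range w)); split; first by move=> t; apply: sup_upper_bound => //; exists t.
move=> e e0; have [_ [T _ <-] Te] := sup_adherent e0 hs.
by exists T => t Tt; apply: le_trans (ltW Te) (wm _ _ Tt).
Qed.

(** If $SA\ne B^p$, the right-hand side is eventually bounded away from $0$ with a fixed sign, and
    [damped_growth] contradicts the boundedness of $w$ or $-w$. Convergence of the derivatives is
    never discussed. *)
Lemma limit_balance (w w1 w2 z : R -> R) c S p A B : 1 <= p -> 0 < A -> 0 < B ->
  (forall t, der t w (w1 t)) -> (forall t, der t w1 (w2 t)) ->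
  (forall t, w2 t + c * w1 t = S * w t - z t `^ p) ->
  (forall t, 0 < w t <= A) -> (forall e : R, 0 < e -> exists T, forall t, T <= t -> A - e <= w t) ->
  (forall t, 0 < z t <= B) -> (forall e : R, 0 < e -> exists T, forall t, T <= t -> B - e <= z t) ->
  S * A = B `^ p.
Proof.
move=> p1 A0 B0 dw dw1 eq wA wlim zB zlim.
have wn t : `|w t| <= A by have /andP[? ?] := wA t; rewrite gtr0_norm.
pose L := S * A - B `^ p.
have close e : 0 < e -> exists T, forall t, T <= t -> `|S * w t - z t `^ p - L| <= e.
  move=> e0; pose D := `|S| + p * B `^ (p - 1) + 1.
  have pB : 0 <= p * B `^ (p - 1) by rewrite mulr_ge0 ?powR_ge0//; lra.
  have D0 : 0 < D by rewrite /D; have := normr_ge0 S; lra.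
  have [d d0 eqe] : exists2 d, 0 < d & D * d = e.
    by exists (e / D); rewrite ?divr_gt0//; field; lra.
  have [T1 h1] := wlim _ d0; have [T2 h2] := zlim _ d0.
  exists (Num.max T1 T2) => t; rewrite ge_max => /andP[/h1 H1 /h2 H2].
  have /andP[w0 wleA] := wA t; have /andP[z0 zleB] := zB t.
  have : `|S * (w t - A)| <= `|S| * d.
    rewrite normrM ler_wpM2l// ler_norml; apply/andP; split; lra.
  have zp : z t `^ p <= B `^ p.
    by rewrite ge0_ler_powR ?nnegrE ?(ltW z0) ?(ltW B0)//; lra.
  have := powR_tangent p1 z0 B0 => tan.
  have : p * B `^ (p - 1) * (B - z t) <= p * B `^ (p - 1) * d by rewrite ler_wpM2l//; lra.
  rewrite /D in eqe; rewrite /L !ler_norml => le1 /andP[le2 le3]; apply/andP; split; lra.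
have [L0|L0] := eqVneq L 0; first by apply/eqP; rewrite -subr_eq0; apply/eqP.
have L20 : 0 < `|L| / 2 by rewrite divr_gt0 ?normr_gt0.
have [T hT] := close _ L20.
case: (ltgtP L 0) => [Ln|Lp|/eqP]; last by rewrite (negbTE L0).
- exfalso; apply: (@damped_growth (fun t => - w t) (fun t => - w1 t) (fun t => - w2 t) c A _ T L20).
  + by move=> t; apply: derN.
  + by move=> t; apply: derN.
  + by move=> t; rewrite normrN.
  + move=> t /hT; have := eq t; rewrite (ltr0_norm Ln) ler_norml => e /andP[_]; lra.
- exfalso; apply: (@damped_growth w w1 w2 c A _ T L20 dw dw1 wn).
  by move=> t /hT; rewrite eq (gtr0_norm Lp) ler_norml => /andP[]; lra.
Qed.

End Limits.

(** * Radial functions on R^N *)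

Section RadialRN.
Context {R : realType} {N : nat}.
Implicit Types (f g : 'rV[R]_N -> R) (x z v : 'rV[R]_N) (i j : 'I_N).
Local Notation e_ i := (delta_mx 0 i : 'rV[R]_N).

(** Radial functions are handled as functions of $|x|^2$, which unlike $|x|$ is smooth at the
    origin. *)
Definition sqnorm x : R := \sum_(i < N) x 0 i ^+ 2.

Lemma sqnorm_ge0 x : 0 <= sqnorm x.
Proof. by apply: sumr_ge0 => i _; exact: sqr_ge0. Qed.

Lemma sqr_coord_le x i : x 0 i ^+ 2 <= sqnorm x.
Proof.
by rewrite /sqnorm (bigD1 i)//= lerDl; apply: sumr_ge0 => j _; exact: sqr_ge0.
Qed.

Lemma sqnorm_eq0 x : sqnorm x = 0 -> x = 0.
Proof.
move=> x0; apply/rowP => i; rewrite mxE; apply/eqP.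
by rewrite -sqrf_eq0 eq_le sqr_ge0 andbT -x0 sqr_coord_le.
Qed.

Lemma sqnorm_gt0 x : x != 0 -> 0 < sqnorm x.
Proof.
move=> x0; rewrite lt_neqAle sqnorm_ge0 andbT eq_sym.
by apply: contra x0 => /eqP/sqnorm_eq0 ->.
Qed.

Lemma sqnormZ (l : R) x : sqnorm (l *: x) = l ^+ 2 * sqnorm x.
Proof. by rewrite /sqnorm mulr_sumr; apply: eq_bigr => i _; rewrite mxE exprMn. Qed.

Lemma contM (T : topologicalType) (h k : T -> R) :
  continuous h -> continuous k -> continuous (fun y => h y * k y).
Proof. by move=> ch ck y; apply: (@continuousM R T h k y); [exact: ch|exact: ck]. Qed.

Lemma contD (T : topologicalType) (h k : T -> R) :
  continuous h -> continuous k -> continuous (fun y => h y + k y).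
Proof. by move=> ch ck y; apply: (@continuousD R R T h k y); [exact: ch|exact: ck]. Qed.

Lemma cont_cst (T : topologicalType) (k : R) : continuous (fun _ : T => k).
Proof. by move=> y; exact: cst_continuous. Qed.

Lemma continuous_sqnorm : continuous sqnorm.
Proof.
have -> : sqnorm = \sum_(i < N) (fun x => x 0 i ^+ 2).
  by apply/funext => x; rewrite fct_sumE.
elim/big_ind : _ => [x|f g cf cg x|i _ x].
- exact: cst_continuous.
- by apply: continuousD; [exact: cf|exact: cg].
- apply: (@continuous_comp _ _ _ (fun x => x 0 i) (fun y : R => y ^+ 2)).
    exact: coord_continuous.
  exact: exprn_continuous.
Qed.

Lemma sqnorm_slice x i (h : R) :
  sqnorm (h *: e_ i + x) = sqnorm x + (2 * x 0 i * h + h ^+ 2).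
Proof.
rewrite /sqnorm (bigD1 i)//= [in RHS](bigD1 i)//= !mxE !eqxx/= mulr1.
rewrite (eq_bigr (fun j => x 0 j ^+ 2)); last first.
  by move=> j ji; rewrite !mxE eqxx (negbTE ji)/= mulr0 add0r.
ring.
Qed.

Lemma is_derive_slice f x v d : is_derive x v f d <-> der 0 (fun h : R => f (h *: v + x)) d.
Proof.
have E : (fun h : R => h^-1 *: ((f \o shift x) (h *: v) - f x)) =
   (fun h : R => h^-1 *: (((fun h : R => f (h *: v + x)) \o shift 0) (h *: 1) - f (0 *: v + x))).
  by apply/funext => h /=; rewrite addr0 scale0r add0r [_%:A]mulr1.
split=> -[df <-]; split; rewrite /derivable /derive.
- by rewrite -E.
- by rewrite -E.
- by rewrite E.
- by rewrite E.
Qed.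

Lemma slice_cvg x v : (s *: v + x) @[s --> (0 : R)] --> x.
Proof.
suff : (s *: v + x) @[s --> (0 : R)] --> (0 : R) *: v + x by rewrite scale0r add0r.
by apply: cvgD; [exact: scalel_continuous|exact: cvg_cst].
Qed.

Lemma near_slice (P : set 'rV[R]_N) x v : (\forall z \near x, P z) ->
  exists2 e : R, 0 < e & forall s, `|s| < e -> P (s *: v + x).
Proof.
move=> xP; have /nbhs_ballP[e /= e0 h] := @slice_cvg x v _ xP; exists e => // s se.
by apply: h; rewrite /ball/= sub0r normrN.
Qed.

Lemma is_derive_coord x i j : is_derive x (e_ i) (fun z => z 0 j) (i == j)%:R.
Proof.
apply/is_derive_slice; have -> : (fun h : R => (h *: e_ i + x) 0 j) = (fun h => h * (i == j)%:R + x 0 j).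
  by apply/funext => h; rewrite !mxE eqxx/= eq_sym.
by der; ring.
Qed.

Lemma is_derive_sqnorm_comp (c : R -> R) d x i : der (sqnorm x) c d ->
  is_derive x (e_ i) (fun z => c (sqnorm z)) (2 * x 0 i * d).
Proof.
move=> dc; apply/is_derive_slice; under eq_fun do rewrite sqnorm_slice.
apply: (@der_eq _ _ _ (d * (2 * x 0 i))); last by ring.
apply: (der_comp (f := c)); first by rewrite mulr0 expr0n/= !addr0.
by der; ring.
Qed.

Lemma is_derive_mul f g x v a b : is_derive x v f a -> is_derive x v g b ->
  is_derive x v (fun z => f z * g z) (a * g x + f x * b).
Proof.
move=> df dg; apply: is_derive_eq (is_deriveM df dg) _.
by rewrite /GRing.scale /= addrC [g x * a]mulrC.
Qed.

Lemma is_derive_near f g x v a : (\forall z \near x, f z = g z) ->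
  is_derive x v f a -> is_derive x v g a.
Proof.
move=> fg [df <-]; split; first exact: near_eq_derivable df.
exact/esym/near_eq_derive.
Qed.

Lemma partial_eq f x i d : is_derive x (e_ i) f d -> partial i f x = d.
Proof. by move=> df; rewrite /partial derive_val. Qed.

(** The pointwise part of $C^2$ that allows a Laplacian to be computed and tested at a minimum; it
    also covers functions that are singular at the origin, at the other points. *)
Definition regular2 f x := forall i,
  (\forall z \near x, derivable f z (e_ i)) /\ derivable (partial i f) x (e_ i).

Section Profile.
Variables (c c1 : R -> R).

Lemma near_partial_radial x i : (\forall y \near sqnorm x, der y c (c1 y)) ->
  \forall z \near x, is_derive z (e_ i) (fun z => c (sqnorm z)) (2 * z 0 i * c1 (sqnorm z)).
Proof.
move=> dc; have : \forall z \near x, der (sqnorm z) c (c1 (sqnorm z)).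
  exact: (@continuous_sqnorm x _ dc).
by apply: filterS => z; exact: is_derive_sqnorm_comp.
Qed.

Lemma second_partial_radial x i j d : (\forall y \near sqnorm x, der y c (c1 y)) ->
  der (sqnorm x) c1 d ->
  is_derive x (e_ j) (partial i (fun z => c (sqnorm z)))
    (2 * (i == j)%:R * c1 (sqnorm x) + 4 * x 0 i * x 0 j * d).
Proof.
move=> dc dc1; apply: (@is_derive_near (fun z => z 0 i * (2 * c1 (sqnorm z)))).
  have := near_partial_radial i dc; apply: filterS => z /partial_eq ->; ring.
have d2 : is_derive x (e_ j) (fun z => 2 * c1 (sqnorm z)) (2 * x 0 j * (2 * d)).
  apply: (@is_derive_sqnorm_comp (fun y => 2 * c1 y)).
  by apply: der_eq; [apply: derM (der_cst _ _) dc1|ring].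
apply: is_derive_eq (is_derive_mul (is_derive_coord x j i) d2) _.
by rewrite eq_sym; ring.
Qed.

Lemma regular2_radial x d : (\forall y \near sqnorm x, der y c (c1 y)) ->
  der (sqnorm x) c1 d -> regular2 (fun z => c (sqnorm z)) x.
Proof.
move=> dc dc1 i; split; last by have [] := second_partial_radial i i dc dc1.
by have := near_partial_radial i dc; apply: filterS => z [].
Qed.

Lemma laplacian_radial x d : (\forall y \near sqnorm x, der y c (c1 y)) ->
  der (sqnorm x) c1 d ->
  laplacian (fun z => c (sqnorm z)) x = 4 * sqnorm x * d + 2 * N%:R * c1 (sqnorm x).
Proof.
move=> dc dc1; rewrite /laplacian.
rewrite (eq_bigr (fun i => 2 * c1 (sqnorm x) + 4 * d * x 0 i ^+ 2)) => [|i _].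
  rewrite big_split/= sumr_const card_ord -mulr_natr -mulr_sumr -/(sqnorm x); ring.
by rewrite (partial_eq (second_partial_radial i i dc dc1)) eqxx /=; ring.
Qed.

End Profile.

Lemma C2_radial (c c1 c2 : R -> R) : (forall y, der y c (c1 y)) ->
  (forall y, der y c1 (c2 y)) -> continuous c2 -> C2 (fun z => c (sqnorm z)).
Proof.
move=> dc dc1 cc2.
have cont (h : R -> R) : continuous h -> continuous (fun z => h (sqnorm z)).
  by move=> ch x; apply: continuous_comp; [exact: continuous_sqnorm|exact: ch].
have cc : continuous c by move=> y; exact: der_cont (dc y).
have cc1 : continuous c1 by move=> y; exact: der_cont (dc1 y).
have part i : partial i (fun z => c (sqnorm z)) = (fun z => 2 * z 0 i * c1 (sqnorm z)).
  by apply/funext => x; apply: partial_eq; exact: is_derive_sqnorm_comp.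
have coord (k : R) i : continuous (fun z : 'rV[R]_N => k * z 0 i).
  by apply: contM; [exact: cont_cst|move=> x; exact: coord_continuous].
have nearT x : \forall y \near sqnorm x, der y c (c1 y).
  by apply: (filterS _ (@filterT _ (nbhs (sqnorm x)) _)) => y _; exact: dc.
have cpart i : continuous (partial i (fun z => c (sqnorm z))).
  by rewrite part; exact: contM (coord _ _) (cont _ cc1).
split.
  split; first exact: cont.
  move=> i; split; last exact: cpart.
  by move=> x; have [] := is_derive_sqnorm_comp i (dc (sqnorm x)).
move=> i; split; first exact: cpart.
move=> j; split.
  by move=> x; have [] := second_partial_radial i j (nearT x) (dc1 (sqnorm x)).
have -> : partial j (partial i (fun z => c (sqnorm z))) =
   (fun x => 2 * (i == j)%:R * c1 (sqnorm x) + 4 * x 0 i * x 0 j * c2 (sqnorm x)).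
  apply/funext => x; apply: partial_eq; exact: second_partial_radial (nearT x) (dc1 _).
apply: contD; first by apply: contM; [exact: cont_cst|exact: cont].
apply: contM; last exact: cont.
by apply: contM; [exact: coord|move=> x; exact: coord_continuous].
Qed.

End RadialRN.

(** * Maximum principle *)

Section Touching.
Context {R : realType} {N : nat}.
Implicit Types (f g : 'rV[R]_N -> R) (x z v : 'rV[R]_N) (i j : 'I_N).
Local Notation e_ i := (delta_mx 0 i : 'rV[R]_N).

Lemma second_min (h h1 : R -> R) (e d : R) : 0 < e ->
  (forall s, `|s| < e -> der s h (h1 s)) -> (forall s, `|s| < e -> h 0 <= h s) ->
  der 0 h1 d -> 0 <= d.
Proof.
move=> e0 dh hmin dh1; have n00 : `|0 : R| < e by rewrite normr0.
have h10 : h1 0 = 0.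
  have [_ <-] := dh 0 n00; suff [] : is_derive (0 : R) (1 : R) h 0 by [].
  have ab : - e <= e by lra.
  apply: (derive1_at_min ab) => [t||t]; rewrite ?in_itv/=.
  - by move=> te; have [|] := dh t; rewrite // ltr_norml.
  - by apply/andP; split; lra.
  - by move=> te; apply: hmin; rewrite ltr_norml.
rewrite leNgt; apply/negP => /(der_neg_right dh1)[e' e'0 neg].
pose s := Num.min e e' / 2.
have m0 : 0 < Num.min e e' by rewrite lt_min e0.
have me : Num.min e e' <= e by rewrite ge_min lexx.
have me' : Num.min e e' <= e' by rewrite ge_min lexx orbT.
have s0 : 0 < s by rewrite /s; lra.
have se : s < e by rewrite /s; lra.
have se' : s < e' by rewrite /s; lra.
have : h s < h 0.
  apply: (der_lt s0) => t /andP[t0 ts].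
    by apply: dh; rewrite ger0_norm//; lra.
  by rewrite -h10 neg// t0 add0r; lra.
by rewrite ltNge hmin// gtr0_norm.
Qed.

Lemma der_slice f x v s d : is_derive (s *: v + x) v f d ->
  der s (fun h : R => f (h *: v + x)) d.
Proof.
move=> /is_derive_slice df.
have -> : (fun h : R => f (h *: v + x)) = (fun h => f ((h - s) *: v + (s *: v + x))).
  by apply/funext => h; rewrite addrA -scalerDl subrK.
apply: (@der_eq _ _ _ (d * (1 + - 0))); last by ring.
apply: (der_comp (f := fun h : R => f (h *: v + (s *: v + x)))); first by rewrite subrr.
by apply: derD (der_id _) _; apply: derN; exact: der_cst.
Qed.

Lemma laplacian_min f x : regular2 f x -> (\forall z \near x, f x <= f z) -> 0 <= laplacian f x.
Proof.
move=> reg fmin; apply: sumr_ge0 => i _; have [near_d dd] := reg i.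
have [e e0 he] := near_slice (e_ i) near_d.
have [e' e'0 he'] := near_slice (e_ i) fmin.
have m0 : 0 < Num.min e e' by rewrite lt_min e0.
apply: (@second_min (fun h : R => f (h *: e_ i + x))
  (fun h : R => partial i f (h *: e_ i + x)) _ _ m0).
- move=> s; rewrite lt_min => /andP[se _]; apply: der_slice.
  exact/derivableP/he.
- by move=> s; rewrite lt_min => /andP[_ /he']; rewrite scale0r add0r.
- by apply/is_derive_slice; exact: derivableP.
Qed.

Lemma is_derive_lin f g x v (k l d d' : R) : is_derive x v f d -> is_derive x v g d' ->
  is_derive x v (fun z => k * f z + l * g z) (k * d + l * d').
Proof.
move=> /is_derive_slice df /is_derive_slice dg; apply/is_derive_slice.
by der; ring.
Qed.

Lemma regular2_partial_near f x i : regular2 f x ->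
  \forall z \near x, is_derive z (e_ i) f (partial i f z).
Proof. by move=> /(_ i)[+ _]; apply: filterS => z; exact: derivableP. Qed.

Lemma second_partial_lin f g x i (k l : R) : regular2 f x -> regular2 g x ->
  is_derive x (e_ i) (partial i (fun z => k * f z + l * g z))
    (k * partial i (partial i f) x + l * partial i (partial i g) x).
Proof.
move=> rf rg; have [_ df] := rf i; have [_ dg] := rg i.
apply: (@is_derive_near _ _ (fun z => k * partial i f z + l * partial i g z)); last first.
  by apply: is_derive_lin; exact: derivableP.
apply: filterS2 (regular2_partial_near i rf) (regular2_partial_near i rg) => z dfz dgz.
by apply/esym/partial_eq; exact: is_derive_lin.
Qed.

Lemma regular2_lin f g x (k l : R) : regular2 f x -> regular2 g x ->
  regular2 (fun z => k * f z + l * g z) x.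
Proof.
move=> rf rg i; split; last by have [] := second_partial_lin i k l rf rg.
apply: filterS2 (regular2_partial_near i rf) (regular2_partial_near i rg) => z dfz dgz.
by have [] := is_derive_lin k l dfz dgz.
Qed.

Lemma laplacian_lin f g x (k l : R) : regular2 f x -> regular2 g x ->
  laplacian (fun z => k * f z + l * g z) x = k * laplacian f x + l * laplacian g x.
Proof.
move=> rf rg; rewrite /laplacian !mulr_sumr -big_split/=; apply: eq_bigr => i _.
by apply: partial_eq; exact: second_partial_lin.
Qed.

Lemma C2_regular2 f x : C2 f -> regular2 f x.
Proof.
move=> [[_ d1] d2] i; split; last by have [_ /(_ i)[+ _]] := d2 i; apply.
by apply: (filterS _ (@filterT _ (nbhs x) _)) => z _; have [+ _] := d1 i; apply.
Qed.

Lemma is_derive_scale f x v (l d : R) : is_derive (l *: x) v f d ->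
  is_derive x v (fun z => f (l *: z)) (l * d).
Proof.
move=> /is_derive_slice df; apply/is_derive_slice.
have -> : (fun h : R => f (l *: (h *: v + x))) = (fun h => f ((l * h) *: v + l *: x)).
  by apply/funext => h; rewrite scalerDr scalerA.
apply: (@der_eq _ _ _ (d * l)); last by ring.
apply: (der_comp (f := fun h : R => f (h *: v + l *: x))); first by rewrite mulr0.
by der; ring.
Qed.

Lemma second_partial_scale f x i (l : R) : C2 f ->
  is_derive x (e_ i) (partial i (fun z => f (l *: z))) (l ^+ 2 * partial i (partial i f) (l *: x)).
Proof.
move=> [[_ d1] d2].
have -> : partial i (fun z => f (l *: z)) =
    (fun z => l * partial i f (l *: z) + 0 * partial i f (l *: z)).
  apply/funext => z; rewrite mul0r addr0; apply/partial_eq/is_derive_scale.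
  by have [+ _] := d1 i => /(_ (l *: z))/derivableP.
have dd : is_derive x (e_ i) (fun z => partial i f (l *: z))
    (l * partial i (partial i f) (l *: x)).
  by apply: is_derive_scale; have [_ /(_ i)[+ _]] := d2 i => /(_ (l *: x))/derivableP.
by apply: is_derive_eq (is_derive_lin l 0 dd dd) _; ring.
Qed.

Lemma regular2_scale f x (l : R) : C2 f -> regular2 (fun z => f (l *: z)) x.
Proof.
move=> c2 i; split; last by have [] := second_partial_scale x i l c2.
apply: (filterS _ (@filterT _ (nbhs x) _)) => z _.
have [[_ /(_ i)[+ _]] _] := c2 => /(_ (l *: z))/derivableP.
by move=> /is_derive_scale[].
Qed.

Lemma laplacian_scale f x (l : R) : C2 f ->
  laplacian (fun z => f (l *: z)) x = l ^+ 2 * laplacian f (l *: x).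
Proof.
move=> c2; rewrite /laplacian mulr_sumr; apply: eq_bigr => i _.
by apply: partial_eq; exact: second_partial_scale.
Qed.

Lemma compact_shell (r s : R) : compact [set x : 'rV[R]_N | r <= sqnorm x <= s].
Proof.
apply: bounded_closed_compact.
  exists (s + 1); split; first exact: num_real.
  move=> M sM x /andP[_ xs].
  rewrite /= [leLHS]/Num.Def.normr/= mx_normrE (bigmax_le _ _)//=.
    have := sqnorm_ge0 x; lra.
  move=> -[i j] _/=; rewrite (ord1 i); apply: ltW; apply: le_lt_trans sM.
  have := le_trans (sqr_coord_le x j) xs; rewrite -real_normK ?num_real//.
  have := normr_ge0 (x 0 j); nra.
rewrite (_ : [set _ | _] = sqnorm @^-1` `[r, s]); last first.
  by apply/seteqP; split => x /=; rewrite in_itv.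
by apply: closed_comp; [move=> x _; exact: continuous_sqnorm|exact: interval_closed].
Qed.

(* Strict subsolutions that are nonpositive on the boundary of a shell cannot be
   positive inside: otherwise the smallest multiple of the positive supersolution
   above them touches them at an interior point. *)
Lemma no_bump (r s : R) (phi psi f g a b : 'rV[R]_N -> R) x1 :
  continuous phi -> continuous psi ->
  (forall x, 0 < phi x) -> (forall x, 0 < psi x) ->
  (forall x, regular2 phi x) -> (forall x, regular2 psi x) ->
  (forall x, 0 <= a x) -> (forall x, 0 <= b x) ->
  (forall x, - laplacian phi x >= a x * psi x) ->
  (forall x, - laplacian psi x >= b x * phi x) ->
  (forall x, r <= sqnorm x <= s -> {for x, continuous f} /\ {for x, continuous g}) ->
  (forall x, r < sqnorm x < s -> [/\ regular2 f x, regular2 g x,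
     - laplacian f x < a x * g x & - laplacian g x < b x * f x]) ->
  (forall x, sqnorm x = r \/ sqnorm x = s -> f x <= 0 /\ g x <= 0) ->
  r <= sqnorm x1 <= s -> f x1 <= 0.
Proof.
move=> cphi cpsi phi0 psi0 rphi rpsi a0 b0 sphi spsi cfg sub bd x1K.
(* The maximum [t] of [h] is the smallest multiple of $(\phi,\psi)$ above $(f,g)$ on the shell, and
   a maximum point is a point of contact. *)
pose h x := Num.max (f x / phi x) (g x / psi x).
rewrite leNgt; apply/negP => fx1.
have [|x0 x0K hmax] := @EVT_max_rV R N h [set x | r <= sqnorm x <= s]
    (ex_intro _ x1 x1K) (@compact_shell r s).
  apply: continuous_in_subspaceT => x; rewrite inE /= => /cfg[cf cg].
  apply: (@continuous_max _ _ (fun x => f x / phi x) (fun x => g x / psi x) x).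
    by apply: (@continuousM R _ f (fun x => (phi x)^-1)) => //;
      apply: continuousV; [rewrite gt_eqF|exact: cphi].
  by apply: (@continuousM R _ g (fun x => (psi x)^-1)) => //;
      apply: continuousV; [rewrite gt_eqF|exact: cpsi].
rewrite inE/= in x0K; set t := h x0 in hmax.
have t0 : 0 < t.
  have : h x1 <= t by apply: hmax; rewrite inE.
  by apply: lt_le_trans; rewrite lt_max divr_gt0.
have fle x : r <= sqnorm x <= s -> f x <= t * phi x.
  move=> xK; rewrite -ler_pdivrMr//; have : h x <= t by apply: hmax; rewrite inE.
  by rewrite ge_max => /andP[].
have gle x : r <= sqnorm x <= s -> g x <= t * psi x.
  move=> xK; rewrite -ler_pdivrMr//; have : h x <= t by apply: hmax; rewrite inE.
  by rewrite ge_max => /andP[].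
have interior : r < sqnorm x0 < s.
  have bd0 : ~ (sqnorm x0 = r \/ sqnorm x0 = s).
    move=> /bd[f0 g0]; move: t0; rewrite /t/h lt_max.
    by rewrite !pmulr_lgt0 ?invr_gt0// ltNge f0 ltNge g0.
  case/andP: x0K => rx xs; rewrite !lt_neqAle rx xs !andbT.
  apply/andP; split; apply/eqP => e; apply: bd0; [by left|by right].
have near_int : \forall z \near x0, r <= sqnorm z <= s.
  case/andP: interior => rx xs.
  have h1 : \forall z \near x0, r < sqnorm z.
    exact: (@cvgr_gt _ _ _ _ _ _ (@continuous_sqnorm _ _ x0) r rx).
  have h2 : \forall z \near x0, sqnorm z < s.
    exact: (@cvgr_lt _ _ _ _ _ _ (@continuous_sqnorm _ _ x0) s xs).
  by apply: filterS2 h1 h2 => z rz zs; rewrite !ltW.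
have [rf rg lf lg] := sub x0 interior.
have touch (phi' f' : 'rV[R]_N -> R) : regular2 phi' x0 -> regular2 f' x0 ->
    (forall x, r <= sqnorm x <= s -> f' x <= t * phi' x) -> f' x0 = t * phi' x0 ->
    laplacian f' x0 <= t * laplacian phi' x0.
  move=> rp rf' le_ eq_; have := @laplacian_min (fun z => t * phi' z + (-1) * f' z) x0
    (regular2_lin t (-1) rp rf').
  rewrite laplacian_lin// !mulN1r subr_ge0; apply.
  by apply: filterS near_int => z /le_; rewrite eq_ subrr mulN1r subr_ge0.
(* The touching component satisfies $-\Delta f\ge-t\Delta\phi\ge t\,a\psi\ge a g$ at [x0], against
   strictness. The last inequality is the cooperative sign $a\ge0$ of the coupling. *)
have [e|e] : f x0 / phi x0 = t \/ g x0 / psi x0 = t.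
  by rewrite /t /h /Num.max; case: ifP; [right|left].
- have /touch : f x0 = t * phi x0 by rewrite -e divfK// gt_eqF.
  move=> /(_ (rphi x0) rf fle) lap.
  move: lf; rewrite ltNge => /negP; apply.
  apply: (@le_trans _ _ (t * (a x0 * psi x0))).
    by rewrite mulrCA ler_wpM2l// gle.
  by apply: le_trans (ler_wpM2l (ltW t0) (sphi x0)) _; rewrite mulrN lerN2.
- have /touch : g x0 = t * psi x0 by rewrite -e divfK// gt_eqF.
  move=> /(_ (rpsi x0) rg gle) lap.
  move: lg; rewrite ltNge => /negP; apply.
  apply: (@le_trans _ _ (t * (b x0 * phi x0))).
    by rewrite mulrCA ler_wpM2l// fle.
  by apply: le_trans (ler_wpM2l (ltW t0) (spsi x0)) _; rewrite mulrN lerN2.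
Qed.

End Touching.

(** * Profiles of radial functions *)

Section Profiles.
Context {R : realType} {N : nat}.
Implicit Types (f g u v : 'rV[R]_N -> R) (x z : 'rV[R]_N) (i j : 'I_N).
Local Notation e_ i := (delta_mx 0 i : 'rV[R]_N).

Lemma sqrt_expR2 (y : R) : 0 < y -> expR (2^-1 * ln y) = Num.sqrt y.
Proof.
move=> y0; rewrite -[in RHS](lnK (x := y)) ?posrE//.
rewrite [in RHS](_ : ln y = 2^-1 * ln y + 2^-1 * ln y); last by field.
by rewrite expRD -expr2 sqrtr_sqr ger0_norm ?expR_ge0.
Qed.

Section LogProfile.
Variables (c U U1 U2 : R -> R).
Hypotheses (dU : forall t, der t U (U1 t)) (dU1 : forall t, der t U1 (U2 t)).
Hypothesis cU : forall y, 0 < y -> c y = U (2^-1 * ln y).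

Let c1 y := U1 (2^-1 * ln y) / (2 * y).

Lemma der_half_ln (y : R) : 0 < y -> der y (fun y => 2^-1 * ln y) (2 * y)^-1.
Proof.
move=> y0; apply: der_eq.
  exact: derM (der_cst _ _) (der_ln y0 (der_id y)).
rewrite mul0r add0r mulr1 invfM.
by [].
Qed.

Lemma der_log_profile (y : R) : 0 < y -> der y c (c1 y).
Proof.
move=> y0; apply: (@der_near _ (fun y => U (2^-1 * ln y))).
  by near=> z; rewrite cU//; near: z; exact: lt_nbhsr.
by apply: (der_comp (f := U)) (dU _) (der_half_ln y0).
Unshelve. all: by end_near. Qed.

Lemma der_log_profile1 (y : R) : 0 < y ->
  der y c1 (U2 (2^-1 * ln y) / (4 * y ^+ 2) - U1 (2^-1 * ln y) / (2 * y ^+ 2)).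
Proof.
move=> y0; apply: der_eq.
  apply: derM; first exact: (der_comp (f := U1)) (dU1 _) (der_half_ln y0).
  apply: derV; first by rewrite mulf_neq0// gt_eqF.
  by apply: derM; [exact: der_cst|exact: der_id].
by cbv beta delta [idfun]; field; lra.
Qed.

Lemma near_log_profile x : x != 0 -> \forall y \near sqnorm x, der y c (c1 y).
Proof.
move=> /sqnorm_gt0 x0; near=> y; apply: der_log_profile; near: y; exact: lt_nbhsr.
Unshelve. all: by end_near. Qed.

Lemma regular2_log x : x != 0 -> regular2 (fun z => c (sqnorm z)) x.
Proof.
move=> x0; apply: regular2_radial (near_log_profile x0) _.
exact/der_log_profile1/sqnorm_gt0.
Qed.

Lemma laplacian_log x : x != 0 ->
  laplacian (fun z => c (sqnorm z)) x =
  (U2 (2^-1 * ln (sqnorm x)) + (N%:R - 2) * U1 (2^-1 * ln (sqnorm x))) / sqnorm x.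
Proof.
move=> x0; have s0 := sqnorm_gt0 x0.
rewrite (laplacian_radial (near_log_profile x0) (der_log_profile1 s0)) /c1.
by cbv beta delta [idfun]; field; lra.
Qed.

End LogProfile.

Variable i0 : 'I_N.

Lemma sqnorm_delta : sqnorm (e_ i0) = 1.
Proof.
rewrite /sqnorm (bigD1 i0)//= !mxE !eqxx expr1n big1 ?addr0// => j ji.
by rewrite !mxE eqxx (negbTE ji) expr0n.
Qed.

Definition profile f (t : R) := f (expR t *: e_ i0).

Lemma radialE f x y : radial f -> 0 <= y -> sqnorm x = y -> f x = f (Num.sqrt y *: e_ i0).
Proof.
move=> rf y0 xy; apply: rf; rewrite /enorm -/(sqnorm _) -/(sqnorm _) xy.
by rewrite sqnormZ sqnorm_delta mulr1 sqr_sqrtr.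
Qed.

Lemma profileE f x : radial f -> x != 0 -> f x = profile f (2^-1 * ln (sqnorm x)).
Proof.
move=> rf /sqnorm_gt0 x0; rewrite /profile sqrt_expR2//.
by apply: radialE => //; exact: ltW.
Qed.

Section C2Profile.
Variable f : 'rV[R]_N -> R.
Hypotheses (c2 : C2 f) (rf : radial f).

Let g1 (r : R) := partial i0 f (r *: e_ i0).
Let g2 (r : R) := partial i0 (partial i0 f) (r *: e_ i0).

Let dg (r : R) : der r (fun r => f (r *: e_ i0)) (g1 r).
Proof.
have [[_ /(_ i0)[d1 _]] _] := c2.
suff : der r (fun h : R => f (h *: e_ i0 + 0)) (g1 r) by under eq_fun do rewrite addr0.
by apply: der_slice; rewrite addr0; exact/derivableP/d1.
Qed.

Let dg1 (r : R) : der r g1 (g2 r).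
Proof.
have [_ /(_ i0)[_ /(_ i0)[d1 _]]] := c2.
suff : der r (fun h : R => partial i0 f (h *: e_ i0 + 0)) (g2 r).
  by under eq_fun do rewrite addr0.
by apply: der_slice; rewrite addr0; exact/derivableP/d1.
Qed.

Definition profile1 (t : R) := expR t * g1 (expR t).
Definition profile2 (t : R) := expR t * g1 (expR t) + expR t ^+ 2 * g2 (expR t).

Lemma der_profile t : der t (profile f) (profile1 t).
Proof.
apply: der_eq; first apply: (der_comp (f := fun r => f (r *: e_ i0)) (dg _)).
  exact: is_derive_expR.
by rewrite mulrC.
Qed.

Lemma der_profile1 t : der t profile1 (profile2 t).
Proof.
apply: der_eq; first apply: derM (is_derive_expR _) _.
  by apply: (der_comp (f := g1)) (dg1 _) (is_derive_expR _).
by rewrite /profile2; ring.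
Qed.

(** $e^{-t}$ times the derivative of the profile is $u'(r)$, and $u'(0)=0$ because a radial function
    is even along the axis. *)
Lemma profile1_ninf : ninf0 (fun t => expR (- t) * profile1 t).
Proof.
have g10 : g1 0 = 0.
  have even : (fun r : R => f (- r *: e_ i0)) = (fun r => f (r *: e_ i0)).
    by apply/funext => r; apply: rf; rewrite /enorm -/(sqnorm _) -/(sqnorm _) !sqnormZ sqrrN.
  have d1 : der 0 (fun r : R => f (- r *: e_ i0)) (g1 0 * - 1).
    apply: (der_comp (f := fun r => f (r *: e_ i0))); first by rewrite oppr0; exact: dg.
    by apply: derN; exact: der_id.
  move: d1; rewrite even => -[_ e1]; have [_ e2] := dg 0.
  by have := etrans (esym e2) e1; lra.
move=> e e0; have cg : {for 0, continuous g1} := der_cont (dg1 0).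
have g1e : g1 0 < e by rewrite g10.
have g1e' : - e < g1 0 by rewrite g10 oppr_lt0.
have [d d0 hd] := cont_lt_near cg g1e; have [d' d'0 hd'] := cont_gt_near cg g1e'.
exists (ln (Num.min d d' / 2)) => t.
have m0 : 0 < Num.min d d' / 2 by rewrite divr_gt0// lt_min d0.
rewrite -ler_expR lnK ?posrE// => te.
rewrite /profile1 mulrA -expRD addNr expR0 mul1r ler_norml.
have md : Num.min d d' <= d by rewrite ge_min lexx.
have md' : Num.min d d' <= d' by rewrite ge_min lexx orbT.
have et := expR_gt0 t.
by apply/andP; split; apply/ltW; [apply: hd'|apply: hd]; rewrite subr0 gtr0_norm//; lra.
Qed.

Lemma laplacian_profile t :
  expR t ^+ 2 * laplacian f (expR t *: e_ i0) = profile2 t + (N%:R - 2) * profile1 t.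
Proof.
have ef : f = (fun z => (fun y => f (Num.sqrt y *: e_ i0)) (sqnorm z)).
  by apply/funext => z; exact: radialE (sqnorm_ge0 _) _.
have e0 : expR t *: e_ i0 != 0.
  apply/eqP => /(congr1 (@sqnorm R N)); rewrite sqnormZ sqnorm_delta mulr1.
  rewrite [sqnorm 0](_ : _ = 0) => [/eqP|]; first by rewrite sqrf_eq0 gt_eqF ?expR_gt0.
  by rewrite /sqnorm big1// => i _; rewrite mxE expr0n.
have cU y : 0 < y -> f (Num.sqrt y *: e_ i0) = profile f (2^-1 * ln y).
  by move=> y0; rewrite /profile sqrt_expR2.
rewrite [in LHS]ef (laplacian_log der_profile der_profile1 cU e0).
rewrite sqnormZ sqnorm_delta mulr1.
have -> : 2^-1 * ln (expR t ^+ 2) = t.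
  by rewrite lnXn ?expR_gt0// expRK -mulr_natr; field.
by field; have := expR_gt0 t; lra.
Qed.

End C2Profile.

Lemma emden_profile (r : R) u v : C2 u -> radial u -> (forall x, 0 < u x) ->
  (forall x, - laplacian u x = v x `^ r) ->
  emden (N%:R - 2) r (profile u) (profile1 u) (profile v).
Proof.
move=> c2 ru u0 eq; split.
- exact: der_profile.
- move=> t; apply: der_eq (der_profile1 c2 t) _.
  have := laplacian_profile c2 ru t.
  have := eq (expR t *: e_ i0); rewrite -/(profile v t) => /(canRL (@opprK _)) ->.
  have -> : expR (2 * t) = expR t ^+ 2 by rewrite -expRM_natl.
  set X := profile2 u t; set Y := profile1 u t; set E := expR t ^+ 2.
  by set V := profile v t `^ r; rewrite mulrN => e; lra.
- by move=> t; exact: u0.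
- exact: profile1_ninf.
Qed.

End Profiles.

(** * Regularization of a singular supersolution *)

Section Cap.
Context {R : realType}.

Definition pos_part (x : R) := Num.max x 0.

Lemma der_pos_part_sqr x : der x (fun x => pos_part x ^+ 2) (2 * pos_part x).
Proof.
rewrite /pos_part; have [x0|x0|->] := ltgtP x 0.
- apply: (@der_near _ (fun=> 0)); last by rewrite mulr0; exact: der_cst.
  near=> z; rewrite max_r ?expr0n//; apply: ltW; near: z; exact: lt_nbhsl.
- apply: (@der_near _ (fun x => x ^+ 2)).
    near=> z; rewrite max_l//; apply: ltW; near: z; exact: lt_nbhsr.
  by apply: der_eq; [exact: (derM (der_id x) (der_id x))|cbv beta; ring].
- rewrite mulr0; apply/is_derive1_caratheodory.
  exists (fun z => Num.max z 0); split => [z||].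
  + rewrite !subr0 maxxx expr0n subr0.
    by have [z0|z0] := leP z 0; rewrite ?expr0n ?mul0r.
  + apply: continuous_max; [by []|exact: cst_continuous].
  + by rewrite maxxx.
Unshelve. all: by end_near. Qed.

Lemma der_pos_part_cube x : der x (fun x => pos_part x ^+ 3) (3 * pos_part x ^+ 2).
Proof.
have -> : (fun x => pos_part x ^+ 3) = (fun x => x * pos_part x ^+ 2).
  apply/funext => z; rewrite /pos_part.
  by have [z0|z0] := leP z 0; rewrite ?expr0n ?mulr0// exprS.
apply: der_eq; first by apply: derM (der_id _) (der_pos_part_sqr _).
by rewrite /pos_part; have [z0|z0] := leP x 0; rewrite ?expr0n/=; ring.
Qed.

Lemma continuous_pos_part : continuous pos_part.
Proof. by move=> x; apply: continuous_max; [by []|exact: cst_continuous]. Qed.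

(* A concave C^2 function equal to the identity on [s <= 1] and constant for [3 <= s];
   [f * cap (g / f)] is a smooth concave 1-homogeneous substitute for [min f g]. *)
Definition cap (s : R) := s - 6^-1 *
  (pos_part (s - 1) ^+ 3 - 2 * pos_part (s - 2) ^+ 3 + pos_part (s - 3) ^+ 3).
Definition cap1 (s : R) := 1 - 2^-1 *
  (pos_part (s - 1) ^+ 2 - 2 * pos_part (s - 2) ^+ 2 + pos_part (s - 3) ^+ 2).
(** Minus the tent of height $1$ over $[1,3]$. The tent has area $1$, which lowers the slope [cap1]
    from $1$ to exactly $0$. *)
Definition cap2 (s : R) := -
  (pos_part (s - 1) - 2 * pos_part (s - 2) + pos_part (s - 3)).

Lemma der_cap s : der s cap (cap1 s).
Proof.
have d k : der s (fun s => pos_part (s - k) ^+ 3) (3 * pos_part (s - k) ^+ 2 * (1 + - 0)).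
  apply: (der_comp (f := fun x => pos_part x ^+ 3)); first exact: der_pos_part_cube.
  by apply: derD (der_id _) _; apply: derN; exact: der_cst.
have := (d 1, d 2, d 3) => -[[d1 d2] d3].
by rewrite /cap; der; rewrite /cap1; field.
Qed.

Lemma der_cap1 s : der s cap1 (cap2 s).
Proof.
have d k : der s (fun s => pos_part (s - k) ^+ 2) (2 * pos_part (s - k) * (1 + - 0)).
  apply: (der_comp (f := fun x => pos_part x ^+ 2)); first exact: der_pos_part_sqr.
  by apply: derD (der_id _) _; apply: derN; exact: der_cst.
have := (d 1, d 2, d 3) => -[[d1 d2] d3].
by rewrite /cap1; der; rewrite /cap2; field.
Qed.

Lemma continuous_cap2 : continuous cap2.
Proof.
have c k : continuous (fun s => pos_part (s - k)).
  move=> s; apply: (continuous_comp (f := fun s => s - k)); last exact: continuous_pos_part.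
  by apply: (der_cont (a := 1 + - 0)); apply: derD (der_id _) _; apply: derN; exact: der_cst.
rewrite (_ : cap2 = fun s => (-1) * (pos_part (s - 1) + (-2) * pos_part (s - 2) + pos_part (s - 3))).
  apply: contM; first exact: cont_cst.
  by apply: contD => //; apply: contD => //; apply: contM => //; exact: cont_cst.
by apply/funext => s; rewrite /cap2; ring.
Qed.

Ltac pos_cases s := rewrite /pos_part;
  have [?|?] := leP (s - 1) 0; have [?|?] := leP (s - 2) 0; have [?|?] := leP (s - 3) 0.

Lemma cap2_le0 s : cap2 s <= 0.
Proof. by rewrite /cap2; pos_cases s; lra. Qed.

Lemma cap_id s : s <= 1 -> cap s = s.
Proof. by move=> s1; rewrite /cap /pos_part !max_r; (lra || ring). Qed.

Lemma cap1_eq0 s : 3 <= s -> cap1 s = 0.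
Proof. by move=> s3; rewrite /cap1 /pos_part !max_l; (lra || field). Qed.

Lemma cap1_decr s t : s <= t -> cap1 t <= cap1 s.
Proof. by move=> st; apply: der_le st (fun t _ => der_cap1 t) _ => x _; exact: cap2_le0. Qed.

Lemma cap1_ge0 s : 0 <= cap1 s.
Proof.
have [/cap1_eq0 -> //|/ltW/cap1_decr] := leP 3 s.
by rewrite (cap1_eq0 (lexx 3)).
Qed.

Lemma cap_tangent s t : cap t <= cap s + cap1 s * (t - s).
Proof.
have [st|ts|->] := ltgtP s t; last by rewrite subrr mulr0 addr0.
- have [c /andP[sc ct] e] := der_mvt st (fun t _ => der_cap t).
  have : cap1 c * (t - s) <= cap1 s * (t - s).
    by rewrite ler_wpM2r ?subr_ge0 ?(ltW st)// cap1_decr// ltW.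
  by lra.
- have [c /andP[tc cs] e] := der_mvt ts (fun t _ => der_cap t).
  have : cap1 s * (s - t) <= cap1 c * (s - t).
    by rewrite ler_wpM2r ?subr_ge0 ?(ltW ts)// cap1_decr// ltW.
  by lra.
Qed.

Lemma cap_gt0 s : 0 < s -> 0 < cap s.
Proof.
move=> s0; have [s1|s1] := leP s 1; first by rewrite cap_id.
have : cap 1 <= cap s.
  by apply: der_ge (ltW s1) (fun t _ => der_cap t) _ => x _; exact: cap1_ge0.
by rewrite (cap_id (lexx 1)); lra.
Qed.

(** This is the partial derivative in $f$ of $f\,\mathrm{cap}(g/f)$; the tangent at $s$, evaluated
    at $0$, lies above $\mathrm{cap}(0)=0$. *)
Lemma cap_slope s : 0 <= cap s - s * cap1 s.
Proof. by have := cap_tangent s 0; rewrite cap_id ?ler01//; lra. Qed.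

End Cap.

(** * The smooth minimum of two profiles and its supersolution property *)

Section SmoothMin.
Context {R : realType}.
Variables (f f1 f2 g g1 g2 : R -> R).
Hypotheses (df : forall t, der t f (f1 t)) (df1 : forall t, der t f1 (f2 t)).
Hypotheses (dg : forall t, der t g (g1 t)) (dg1 : forall t, der t g1 (g2 t)).
Hypothesis f0 : forall t, 0 < f t.

Let s t := g t / f t.
Let s1 t := (g1 t - s t * f1 t) / f t.

Definition smin t := f t * cap (s t).
Definition smin1 t := f1 t * (cap (s t) - s t * cap1 (s t)) + cap1 (s t) * g1 t.
Definition smin2 t := f2 t * (cap (s t) - s t * cap1 (s t)) + cap1 (s t) * g2 t +
  cap2 (s t) * f t * s1 t ^+ 2.

Let fN0 t : f t != 0. Proof. by rewrite gt_eqF. Qed.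

Let ds t : der t s (s1 t).
Proof.
rewrite /s; apply: der_eq; first by apply: derM (dg t) (derV (fN0 t) (df t)).
by rewrite /s1 /s; field; exact: fN0.
Qed.

Let dcap t : der t (fun t => cap (s t)) (cap1 (s t) * s1 t).
Proof. exact: der_comp (der_cap _) (ds t). Qed.

Let dcap1 t : der t (fun t => cap1 (s t)) (cap2 (s t) * s1 t).
Proof. exact: der_comp (der_cap1 _) (ds t). Qed.

Lemma der_smin t : der t smin (smin1 t).
Proof.
apply: der_eq; first exact: derM (df t) (dcap t).
by rewrite /smin1 /s1; field; exact: fN0.
Qed.

Lemma der_smin1 t : der t smin1 (smin2 t).
Proof.
apply: der_eq.
  apply: derD; last exact: derM (dcap1 t) (dg1 t).
  apply: derM (df1 t) _; apply: derD (dcap t) _; apply: derN.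
  exact: derM (ds t) (dcap1 t).
have e : g1 t = s t * f1 t + f t * s1 t by rewrite /s1; field; exact: fN0.
by rewrite /smin2 e; ring.
Qed.

Lemma continuous_smin2 : continuous f2 -> continuous g2 -> continuous smin2.
Proof.
move=> cf2 cg2; have cont (h h1 : R -> R) : (forall t, der t h (h1 t)) -> continuous h.
  by move=> dh t; exact: der_cont (dh t).
have cf := cont _ _ df; have cf1 := cont _ _ df1; have cg1 := cont _ _ dg1.
have cs := cont _ _ ds; have cc := cont _ _ dcap; have cc1 := cont _ _ dcap1.
have cV : continuous (fun t => (f t)^-1).
  by move=> t; exact: der_cont (derV (fN0 t) (df t)).
have cs1 : continuous s1.
  rewrite (_ : s1 = fun t => (g1 t + (-1) * (s t * f1 t)) * (f t)^-1); last first.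
    by apply/funext => t; rewrite /s1 mulN1r.
  exact: contM (contD cg1 (contM (@cont_cst R R (-1)) (contM cs cf1))) cV.
have cc2 : continuous (fun t => cap2 (s t)).
  by move=> t; apply: continuous_comp; [exact: cs|exact: continuous_cap2].
rewrite (_ : smin2 = fun t => f2 t * (cap (s t) + (-1) * (s t * cap1 (s t))) + cap1 (s t) * g2 t +
  cap2 (s t) * f t * (s1 t * s1 t)); last by apply/funext => t; rewrite /smin2; ring.
have c1 : continuous (fun t => cap (s t) + (-1) * (s t * cap1 (s t))).
  exact: contD cc (contM (@cont_cst R R (-1)) (contM cs cc1)).
have c2 := contM (contM cc2 cf) (contM cs1 cs1).
exact: contD (contD (contM cf2 c1) (contM cc1 cg2)) c2.
Qed.

Lemma smin_gt0 t : 0 < g t -> 0 < smin t.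
Proof. by move=> g0; rewrite mulr_gt0// cap_gt0// divr_gt0. Qed.

Lemma smin_eq t : g t <= f t -> smin t = g t.
Proof.
move=> gf; have s1t : s t <= 1 by rewrite /s ler_pdivrMr// mul1r.
by rewrite /smin (cap_id s1t) /s mulrC divfK.
Qed.

(* [h] is the other component of the singular supersolution. *)
Lemma smin_super (n w h t : R) : 0 < h -> 0 <= w ->
  f2 t + n * f1 t <= - (w * h) ->
  3 * f t <= g t \/ g2 t + n * g1 t <= - (w * g t) ->
  smin2 t + n * smin1 t <= - (w * (h * cap (g t / h))).
Proof.
move=> h0 w0 lf lg; have fp := f0 t.
have e : smin2 t + n * smin1 t = (cap (s t) - s t * cap1 (s t)) * (f2 t + n * f1 t) +
    cap1 (s t) * (g2 t + n * g1 t) + cap2 (s t) * f t * s1 t ^+ 2 by rewrite /smin2 /smin1; ring.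
have h1 : (cap (s t) - s t * cap1 (s t)) * (f2 t + n * f1 t) <=
    (cap (s t) - s t * cap1 (s t)) * - (w * h) by rewrite ler_wpM2l ?cap_slope.
have h2 : cap1 (s t) * (g2 t + n * g1 t) <= cap1 (s t) * - (w * g t).
  case: lg => [lg|lg]; last by rewrite ler_wpM2l ?cap1_ge0.
  by rewrite cap1_eq0 ?mul0r// /s ler_pdivlMr.
have h3 : cap2 (s t) * f t * s1 t ^+ 2 <= 0.
  by rewrite mulr_le0_ge0 ?sqr_ge0// mulr_le0_ge0 ?cap2_le0// ltW.
(* For the concave 1-homogeneous $m(f,g)=f\,\mathrm{cap}(g/f)$, the gradient at $(f,g)$ paired with
   $(h,g)$ dominates $m(h,g)$. This is how the coupled inequality for $f$ becomes one for the two
   minima. *)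
have := ler_wpM2l (mulr_ge0 w0 (ltW h0)) (cap_tangent (s t) (g t / h)).
have -> : w * h * (cap (s t) + cap1 (s t) * (g t / h - s t)) =
   (cap (s t) - s t * cap1 (s t)) * (w * h) + cap1 (s t) * (w * g t).
  by field; rewrite gt_eqF.
rewrite e => h4; apply: le_trans (lerD (lerD h1 h2) h3) _.
move: h4; rewrite !mulrN addr0 -opprD lerN2. by rewrite [w * (h * _)]mulrA.
Qed.

End SmoothMin.

(** * Radial $C^2$ functions given by two overlapping formulas *)

Section Glue.
Context {R : realType} {N : nat}.
Variables (c c1 c2 F F1 F2 : R -> R) (y0 : R).
Hypothesis y00 : 0 < y0.
Hypotheses (dc : forall y, der y c (c1 y)) (dc1 : forall y, der y c1 (c2 y)) (cc2 : continuous c2).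
Hypotheses (dF : forall t, der t F (F1 t)) (dF1 : forall t, der t F1 (F2 t)) (cF2 : continuous F2).
Hypothesis glue_eq : forall y, 0 < y < y0 -> F (2^-1 * ln y) = c y.

(** A profile on the whole line, as [C2_radial] demands; the branch at $y\le0$ avoids the default
    values of [ln]. Both formulas agree on $0<y<y_0$, so every point has a neighborhood where one
    smooth formula holds. *)
Definition glue (y : R) := if y <= 0 then c y else F (2^-1 * ln y).

Let k1 (y : R) := F1 (2^-1 * ln y) / (2 * y).
Let k2 (y : R) := F2 (2^-1 * ln y) / (4 * y ^+ 2) - F1 (2^-1 * ln y) / (2 * y ^+ 2).

Lemma glue_pos y : 0 < y -> glue y = F (2^-1 * ln y).
Proof. by move=> yp; rewrite /glue leNgt yp. Qed.

Lemma glue_small y : y < y0 -> glue y = c y.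
Proof. by move=> yy; rewrite /glue; have [//|yp] := leP y 0; rewrite glue_eq// yp. Qed.

Let dsmall y : y < y0 -> der y glue (c1 y).
Proof.
move=> yy; apply: der_near (dc y); near=> z; rewrite glue_small//.
by near: z; exact: lt_nbhsl.
Unshelve. all: by end_near. Qed.

Let dpos y : 0 < y -> der y glue (k1 y).
Proof. by move=> yp; apply: (der_log_profile dF) => //; exact: glue_pos. Qed.

Let h1 (y : R) : R := 'D_1 glue y.
Let h2 (y : R) : R := 'D_1 h1 y.

Let h1_small y : y < y0 -> h1 y = c1 y.
Proof. by move=> /dsmall[]. Qed.

Let h1_pos y : 0 < y -> h1 y = k1 y.
Proof. by move=> /dpos[]. Qed.

Let dh1 y : der y glue (h1 y).
Proof.
have [yp|y0'] := ltP 0 y; first by rewrite h1_pos//; exact: dpos.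
by rewrite h1_small; [apply: dsmall|]; exact: le_lt_trans y00.
Qed.

Let d2small y : y < y0 -> der y h1 (c2 y).
Proof.
move=> yy; apply: der_near (dc1 y); near=> z; rewrite h1_small//.
by near: z; exact: lt_nbhsl.
Unshelve. all: by end_near. Qed.

Let d2pos y : 0 < y -> der y h1 (k2 y).
Proof.
move=> yp; apply: der_near (der_log_profile1 dF1 yp); near=> z; rewrite h1_pos//.
by near: z; exact: lt_nbhsr.
Unshelve. all: by end_near. Qed.

Let dh2 y : der y h1 (h2 y).
Proof.
have [yp|y0'] := ltP 0 y.
  by have [_ e] := d2pos yp; rewrite /h2 e; exact: d2pos.
have yy : y < y0 by exact: le_lt_trans y00.
by have [_ e] := d2small yy; rewrite /h2 e; exact: d2small.
Qed.

Let ck2 y : 0 < y -> {for y, continuous k2}.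
Proof.
move=> yp; have cl : {for y, continuous (fun y : R => 2^-1 * ln y)} := der_cont (der_half_ln yp).
have cF1 : continuous F1 by move=> t; exact: der_cont (dF1 t).
have sq (k : R) : 0 < k -> {for y, continuous (fun y : R => (k * y ^+ 2)^-1)}.
  move=> k0; have [d hd] : exists d, der y (fun y : R => (k * y ^+ 2)^-1) d.
    eexists; apply: derV; first by rewrite mulf_neq0 ?expf_neq0// gt_eqF.
    by repeat der_step.
  exact: der_cont hd.
apply: continuousB; apply: continuousM; try exact: sq.
  by apply: continuous_comp; [exact: cl|exact: cF2].
by apply: continuous_comp; [exact: cl|exact: cF1].
Qed.

Let ch2 : continuous h2.
Proof.
move=> y; have [yp|y0'] := ltP 0 y.
  have e : \forall z \near y, k2 z = h2 z.
    near=> z; have zp : 0 < z by near: z; exact: lt_nbhsr.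
    by have [_ <-] := d2pos zp.
  have e2 : h2 y = k2 y by have [_ <-] := d2pos yp.
  suff : h2 z @[z --> y] --> k2 y by rewrite -e2.
  by apply: cvg_trans (ck2 yp); exact: near_eq_cvg.
have yy : y < y0 by exact: le_lt_trans y00.
have e : \forall z \near y, c2 z = h2 z.
  near=> z; have zz : z < y0 by near: z; exact: lt_nbhsl.
  by have [_ <-] := d2small zz.
have e2 : h2 y = c2 y by have [_ <-] := d2small yy.
suff : h2 z @[z --> y] --> c2 y by rewrite -e2.
by apply: cvg_trans (@cc2 y); exact: near_eq_cvg.
Unshelve. all: by end_near. Qed.

Lemma C2_glue : C2 (fun x : 'rV[R]_N => glue (sqnorm x)).
Proof. exact: C2_radial dh1 dh2 ch2. Qed.

Lemma laplacian_glue (x : 'rV[R]_N) : x != 0 ->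
  laplacian (fun z => glue (sqnorm z)) x =
  (F2 (2^-1 * ln (sqnorm x)) + (N%:R - 2) * F1 (2^-1 * ln (sqnorm x))) / sqnorm x.
Proof. by move=> x0; apply: laplacian_log => //; exact: glue_pos. Qed.

Lemma laplacian_glue0 :
  laplacian (fun z : 'rV[R]_N => glue (sqnorm z)) 0 = 2 * N%:R * c1 0.
Proof.
have s0 : sqnorm (0 : 'rV[R]_N) = 0 by rewrite /sqnorm big1// => i _; rewrite mxE expr0n.
rewrite (@laplacian_radial _ _ glue c1 0 (c2 0)) s0 ?mulr0 ?mul0r ?add0r//.
by near=> z; apply: dsmall; near: z; exact: lt_nbhsl.
Unshelve. all: by end_near. Qed.

End Glue.

(** * A polynomial barrier at the origin and the construction of $C^2$ supersolutions *)

Section Regularize.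
Context {R : realType} {N : nat}.

Section Barrier.
Variables (n K C : R).

(** Second Taylor polynomial of $Ce^{-Ky}$ at $0$, with $y=|x|^2$. The linear term yields
    $-\Delta\ge K\cdot$[barrier] near the origin, and the square keeps the function above $C/2$
    everywhere. *)
Definition barrier (y : R) := C * (1 - K * y + K ^+ 2 * y ^+ 2 / 2).
Definition barrier1 (y : R) := C * (- K + K ^+ 2 * y).
Definition barrier2 (y : R) := C * K ^+ 2.

Lemma der_barrier y : der y barrier (barrier1 y).
Proof.
rewrite /barrier; apply: der_eq; first by repeat der_step.
by cbv beta delta [idfun]; rewrite /barrier1; field.
Qed.

Lemma der_barrier1 y : der y barrier1 (barrier2 y).
Proof.
rewrite /barrier1; apply: der_eq; first by repeat der_step.
by cbv beta delta [idfun]; rewrite /barrier2; ring.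
Qed.

Definition lbarrier t := barrier (expR (2 * t)).
Definition lbarrier1 t := 2 * expR (2 * t) * barrier1 (expR (2 * t)).
Definition lbarrier2 t := 4 * expR (2 * t) * barrier1 (expR (2 * t)) +
  4 * expR (2 * t) ^+ 2 * barrier2 (expR (2 * t)).

Let dexp2 (t : R) : der t (fun t => expR (2 * t)) (2 * expR (2 * t)).
Proof. by der; ring. Qed.

Lemma der_lbarrier t : der t lbarrier (lbarrier1 t).
Proof.
apply: der_eq; first exact: der_comp (der_barrier _) (dexp2 t).
by rewrite /lbarrier1; ring.
Qed.

Lemma der_lbarrier1 t : der t lbarrier1 (lbarrier2 t).
Proof.
apply: der_eq.
  exact: derM (derM (der_cst 2 _) (dexp2 t)) (der_comp (der_barrier1 _) (dexp2 t)).
by rewrite /lbarrier2; ring.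
Qed.

Lemma continuous_lbarrier2 : continuous lbarrier2.
Proof.
move=> t; have [d hd] : exists d, der t lbarrier2 d; last exact: der_cont hd.
by eexists; rewrite /lbarrier2 /barrier1 /barrier2; repeat der_step.
Qed.

Hypotheses (n0 : 0 <= n) (K0 : 0 < K) (C0 : 0 < C).

Lemma barrier_half y : C / 2 <= barrier y.
Proof.
rewrite /barrier; apply: ler_wpM2l; first exact: ltW.
have -> : 1 - K * y + K ^+ 2 * y ^+ 2 / 2 = 2^-1 + (K * y - 1) ^+ 2 / 2 by field.
by have := sqr_ge0 (K * y - 1); lra.
Qed.

Lemma lbarrier_super t : K * expR (2 * t) <= 1 / 4 ->
  lbarrier2 t + n * lbarrier1 t <= - (expR (2 * t) * K * lbarrier t).
Proof.
set y := expR (2 * t) => Ky; have y0 : 0 < y by exact: expR_gt0.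
rewrite /lbarrier2 /lbarrier1 /lbarrier -/y /barrier /barrier1 /barrier2.
have -> : 4 * y * (C * (- K + K ^+ 2 * y)) + 4 * y ^+ 2 * (C * K ^+ 2) +
   n * (2 * y * (C * (- K + K ^+ 2 * y))) =
   y * K * C * (- 4 + 8 * (K * y) - 2 * n * (1 - K * y)) by ring.
have -> : y * K * (C * (1 - K * y + K ^+ 2 * y ^+ 2 / 2)) =
  y * K * C * (1 - K * y + (K * y) ^+ 2 / 2) by ring.
rewrite -[leRHS]mulrN ler_wpM2l ?mulr_ge0 ?ltW//.
set z := K * y in Ky *; have z0 : 0 < z by rewrite mulr_gt0.
have : 0 <= n * (1 - z) by rewrite mulr_ge0//; lra.
nra.
Qed.

End Barrier.

(** Each component of the singular pair is replaced by its smooth minimum with one barrier [G]. Near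
    the origin this minimum is [G], a polynomial in $|x|^2$; beyond [tau], where [G] may fail to be
    a supersolution, it is so large that [cap] is constant and only a multiple of the singular
    component is left. *)
Lemma regularize (f f1 f2 g g1 g2 wa wb : R -> R) (a b : 'rV[R]_N -> R) (K : R) :
  2 <= N%:R :> R ->
  (forall t, der t f (f1 t)) -> (forall t, der t f1 (f2 t)) -> continuous f2 ->
  (forall t, der t g (g1 t)) -> (forall t, der t g1 (g2 t)) -> continuous g2 ->
  (forall t, 0 < f t) -> (forall t, 0 < g t) -> (forall t, f1 t < 0) -> (forall t, g1 t < 0) ->
  (forall c : R, exists T, forall t, t <= T -> c <= f t) ->
  (forall c : R, exists T, forall t, t <= T -> c <= g t) ->
  (forall t, f2 t + (N%:R - 2) * f1 t <= - (expR (2 * t) * wa t * g t)) ->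
  (forall t, g2 t + (N%:R - 2) * g1 t <= - (expR (2 * t) * wb t * f t)) ->
  (forall t, 0 <= wa t <= K) -> (forall t, 0 <= wb t <= K) -> a 0 <= K -> b 0 <= K ->
  0 < K ->
  (forall x, x != 0 -> a x = wa (2^-1 * ln (sqnorm x))) ->
  (forall x, x != 0 -> b x = wb (2^-1 * ln (sqnorm x))) ->
  exists phi psi : 'rV[R]_N -> R,
    [/\ C2 phi, C2 psi, (forall x, 0 < phi x /\ 0 < psi x),
        (forall x, - laplacian phi x >= a x * psi x) &
        (forall x, - laplacian psi x >= b x * phi x)].
Proof.
move=> N2 df df1 cf2 dg dg1 cg2 f0 g0 f1n g1n fbig gbig lf lg wa0 wb0 a0 b0 K0 ea eb.
have n0 : 0 <= N%:R - 2 :> R by lra.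
have e2 (z : R) : 2 * (2^-1 * z) = z by field.
pose tau := 2^-1 * ln ((1 / 4) / K).
have Etau : K * expR (2 * tau) = 1 / 4.
  by rewrite /tau e2 lnK ?posrE ?divr_gt0//; field; lra.
(* From [tau] on $f$ and $g$ are below their values at [tau], so $G\ge C/2$ exceeds $3f$ and $3g$,
   where [cap1] vanishes. *)
pose C := 6 * (f tau + g tau).
have C0 : 0 < C by rewrite mulr_gt0// addr_gt0.
pose G := lbarrier K C.
have dG := der_lbarrier K C; have dG1 := der_lbarrier1 K C.
have cG2 := @continuous_lbarrier2 K C.
have G_half t : C / 2 <= G t by exact: barrier_half.
have G0 t : 0 < G t by apply: lt_le_trans (G_half t); rewrite divr_gt0.
have decr (h h1 : R -> R) t :
    (forall t, der t h (h1 t)) -> (forall t, h1 t < 0) -> tau <= t -> h t <= h tau.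
  by move=> dh h1n tt; apply: der_le tt (fun t _ => dh t) _ => x _; exact: ltW.
have Gsup t w : 0 <= w <= K -> t <= tau ->
    lbarrier2 K C t + (N%:R - 2) * lbarrier1 K C t <= - (expR (2 * t) * w * G t).
  move=> /andP[w0 wK] tt; apply: le_trans (lbarrier_super n0 K0 C0 _) _.
    by rewrite -Etau ler_wpM2l ?(ltW K0)// ler_expR; lra.
  by rewrite lerN2 ler_wpM2r ?(ltW (G0 _))// ler_wpM2l ?expR_ge0.
have [Tf hTf] := fbig C; have [Tg hTg] := gbig C.
(* Before [T] one has $G\le C\le f,g$, so both minima equal [G]. *)
pose T := Num.min (Num.min Tf Tg) tau.
have Gle t : t <= T -> G t <= C.
  rewrite le_min => /andP[_ tt]; rewrite /G /lbarrier /barrier -[leRHS]mulr1 ler_wpM2l ?(ltW C0)//.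
  have : K * expR (2 * t) <= 1 / 4 by rewrite -Etau ler_wpM2l ?(ltW K0)// ler_expR; lra.
  have : 0 <= K * expR (2 * t) by rewrite mulr_ge0 ?expR_ge0// ltW.
  rewrite -exprMn; nra.
pose y0 := expR (2 * T).
have y00 : 0 < y0 by exact: expR_gt0.
have smin_glue (h : R -> R) : (forall t, 0 < h t) -> (forall t, t <= T -> C <= h t) ->
    forall y, 0 < y < y0 -> smin h G (2^-1 * ln y) = barrier K C y.
  move=> h0 hC y /andP[yp yy].
  have tT : 2^-1 * ln y <= T.
    have : ln y < 2 * T by rewrite -ltr_expR lnK ?posrE.
    lra.
  rewrite smin_eq//; last by apply: le_trans (Gle _ tT) (hC _ tT).
  by rewrite /G /lbarrier e2 lnK ?posrE.
have gf : forall y, 0 < y < y0 -> smin f G (2^-1 * ln y) = barrier K C y.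
  by apply: smin_glue => // t; rewrite !le_min => /andP[/andP[/hTf]].
have gg : forall y, 0 < y < y0 -> smin g G (2^-1 * ln y) = barrier K C y.
  by apply: smin_glue => // t; rewrite !le_min => /andP[/andP[_ /hTg]].
have cb2 : continuous (barrier2 K C) by exact: cont_cst.
pose phi (x : 'rV[R]_N) := glue (barrier K C) (smin f G) (sqnorm x).
pose psi (x : 'rV[R]_N) := glue (barrier K C) (smin g G) (sqnorm x).
have db := der_barrier K C; have db1 := der_barrier1 K C.
have dsf := der_smin df dG f0; have dsf1 := der_smin1 df df1 dG dG1 f0.
have dsg := der_smin dg dG g0; have dsg1 := der_smin1 dg dg1 dG dG1 g0.
have csf := continuous_smin2 df df1 dG dG1 f0 cf2 cG2.
have csg := continuous_smin2 dg dg1 dG dG1 g0 cg2 cG2.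
have s0 : sqnorm (0 : 'rV[R]_N) = 0 by rewrite /sqnorm big1// => i _; rewrite mxE expr0n.
have glue0 F : glue (barrier K C) F (sqnorm (0 : 'rV[R]_N)) = C.
  by rewrite /glue s0 lexx /barrier; ring.
have pos (h : R -> R) (x : 'rV[R]_N) : (forall t, 0 < h t) ->
    0 < glue (barrier K C) (smin h G) (sqnorm x).
  move=> h0; have [->|/sqnorm_gt0 x0] := eqVneq x 0; first by rewrite glue0.
  by rewrite glue_pos// smin_gt0.
exists phi, psi; split.
- exact: (C2_glue y00 db db1 cb2 dsf dsf1 csf gf).
- exact: (C2_glue y00 db db1 cb2 dsg dsg1 csg gg).
- by move=> x; split; exact: pos.
- move=> x; have [->|x0] := eqVneq x 0.
    rewrite /phi /psi (laplacian_glue0 y00 db db1 gf) glue0 /barrier1 mulr0 addr0.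
    have : a 0 * C <= K * C by rewrite ler_wpM2r// ltW.
    have : 2 * (K * C) <= N%:R * (K * C) by rewrite ler_wpM2r// mulr_ge0 ?ltW.
    have : 0 < K * C by rewrite mulr_gt0.
    nra.
  have sx := sqnorm_gt0 x0.
  rewrite /phi /psi (laplacian_glue _ dsf dsf1 x0) glue_pos// ea//.
  set t := 2^-1 * ln (sqnorm x).
  have Et : expR (2 * t) = sqnorm x by rewrite /t e2 lnK ?posrE.
  rewrite -mulNr ler_pdivlMr// mulrC -Et mulrA.
  rewrite [X in _ <= X](_ : _ = - (smin2 f f1 f2 G (lbarrier1 K C) (lbarrier2 K C) t +
     (N%:R - 2) * smin1 f f1 G (lbarrier1 K C) t)); last by [].
  rewrite lerNr; have /andP[w0 wK] := wa0 t.
  apply: smin_super => //; first by rewrite mulr_ge0 ?expR_ge0.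
  have [tt|/ltW tt] := leP t tau; [right; apply: Gsup => //; exact: wa0|left].
  apply: le_trans (G_half t); have := decr f f1 t df f1n tt; have := g0 tau; rewrite /C; lra.
- move=> x; have [->|x0] := eqVneq x 0.
    rewrite /phi /psi (laplacian_glue0 y00 db db1 gg) glue0 /barrier1 mulr0 addr0.
    have : b 0 * C <= K * C by rewrite ler_wpM2r// ltW.
    have : 2 * (K * C) <= N%:R * (K * C) by rewrite ler_wpM2r// mulr_ge0 ?ltW.
    have : 0 < K * C by rewrite mulr_gt0.
    nra.
  have sx := sqnorm_gt0 x0.
  rewrite /phi /psi (laplacian_glue _ dsg dsg1 x0) glue_pos// eb//.
  set t := 2^-1 * ln (sqnorm x).
  have Et : expR (2 * t) = sqnorm x by rewrite /t e2 lnK ?posrE.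
  rewrite -mulNr ler_pdivlMr// mulrC -Et mulrA.
  rewrite [X in _ <= X](_ : _ = - (smin2 g g1 g2 G (lbarrier1 K C) (lbarrier2 K C) t +
     (N%:R - 2) * smin1 g g1 G (lbarrier1 K C) t)); last by [].
  rewrite lerNr; have /andP[w0 wK] := wb0 t.
  apply: smin_super => //; first by rewrite mulr_ge0 ?expR_ge0.
  have [tt|/ltW tt] := leP t tau; [right; apply: Gsup => //; exact: wb0|left].
  apply: le_trans (G_half t); have := decr g g1 t dg g1n tt; have := f0 tau; rewrite /C; lra.
Qed.

End Regularize.

(** * Comparison with the singular solution *)

Section Ordering.
Context {R : realType}.

Lemma ninf0D (F G : R -> R) : ninf0 F -> ninf0 G -> ninf0 (fun t => F t + G t).
Proof.
move=> F0 G0 e e0; have e20 : 0 < e / 2 by lra.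
have [T hT] := F0 _ e20; have [T' hT'] := G0 _ e20.
exists (Num.min T T') => t; rewrite le_min => /andP[/hT h /hT' h'].
by apply: le_trans (ler_normD _ _) _; lra.
Qed.

(* [k1] is the exponent of a positive power solution [r^(-k1)] of the system
   linearized at the singular solution. *)
Lemma power_exponents (n m a b : R) : 0 < a -> 0 < b -> 1 < m -> a + b <= n ->
  m * a * b * (n - a) * (n - b) <= ((n ^+ 2 - (a - b) ^+ 2) / 4) ^+ 2 ->
  exists k1 k2, [/\ k2 = k1 + b - a, 0 < k1 < n - b, 0 < k2 < n - a &
    k1 * (n - k1) * (k2 * (n - k2)) = m * a * b * (n - a) * (n - b)].
Proof.
move=> a0 b0 m1 abn ineq.
(* If $a+b=n$, the inequality would read $m(ab)^2\le(ab)^2$. Strictness puts [k0] below $n-b$, and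
   thereby gives the upper bounds on both exponents. *)
have abn' : a + b < n.
  rewrite lt_neqAle abn andbT; apply/eqP => nE.
  have ab0 : 0 < (a * b) * (a * b) by rewrite !mulr_gt0.
  have e1 : ((n ^+ 2 - (a - b) ^+ 2) / 4) ^+ 2 = (a * b) * (a * b) by rewrite -nE; field.
  have e2 : m * a * b * (n - a) * (n - b) = m * ((a * b) * (a * b)) by rewrite -nE; ring.
  by move: ineq; rewrite e1 e2; nra.
(* Since $-\Delta r^{-k}=k(n-k)r^{-k-2}$, the exponents solve $P(k)=m\,ab(n-a)(n-b)$. [P] is
   symmetric about [k0], where it equals the large side of the hypothesis, and at $a$ it is too
   small by the factor $m$; the intermediate value theorem applies. *)
pose P k := k * (n - k) * ((k + b - a) * (n - (k + b - a))).
pose k0 := (n + a - b) / 2.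
have ak0 : a <= k0 by rewrite /k0; lra.
have Pk0 : P k0 = ((n ^+ 2 - (a - b) ^+ 2) / 4) ^+ 2 by rewrite /P /k0; field.
have Pa : P a = a * b * (n - a) * (n - b) by rewrite /P; ring.
have X0 : 0 < a * b * (n - a) * (n - b) by rewrite !mulr_gt0//; lra.
have cP : {within `[a, k0], continuous P}.
  apply: continuous_subspaceT => k.
  have [d dP] : exists d, der k P d by eexists; rewrite /P; repeat der_step.
  exact: der_cont dP.
have [|k] := IVT ak0 cP (v := m * a * b * (n - a) * (n - b)).
  rewrite Pa Pk0 ge_min le_max ineq orbT andbT; apply/orP; left.
  rewrite -!mulrA ler_peMl ?ltW//; move: X0; rewrite -!mulrA; lra.
rewrite in_itv/= => /andP[ak kk0] eP; exists k, (k + b - a); split => //.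
- by apply/andP; split; [lra|move: kk0; rewrite /k0; lra].
- by apply/andP; split; [lra|move: kk0; rewrite /k0; lra].
Qed.

Lemma singular_constants (S T p q : R) : 0 < S -> 0 < T -> 1 < p * q ->
  let A := (S * T `^ p) `^ (p * q - 1)^-1 in
  let B := (S `^ q * T) `^ (p * q - 1)^-1 in
  [/\ 0 < A, 0 < B, S * A = B `^ p & T * B = A `^ q].
Proof.
move=> S0 T0 pq A B.
have Sq : 0 < S `^ q by rewrite powR_gt0.
have Tp : 0 < T `^ p by rewrite powR_gt0.
have A0 : 0 < A by rewrite powR_gt0// mulr_gt0.
have B0 : 0 < B by rewrite powR_gt0// mulr_gt0.
have lA : ln A = (p * q - 1)^-1 * (ln S + p * ln T).
  by rewrite ln_powR lnM ?posrE// ln_powR.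
have lB : ln B = (p * q - 1)^-1 * (q * ln S + ln T).
  by rewrite ln_powR lnM ?posrE// ln_powR.
have pq0 : p * q - 1 != 0 by rewrite gt_eqF//; lra.
split => //; apply: ln_inj; rewrite ?posrE ?powR_gt0 ?mulr_gt0//.
  by rewrite ln_powR lnM ?posrE// lA lB; field.
by rewrite ln_powR lnM ?posrE// lA lB; field.
Qed.

(* Half of the Wronskian-type functional pairing the difference with a power. *)
Lemma der_pairing (n k : R) (g g1 g2 : R -> R) t :
  (forall t, der t g (g1 t)) -> (forall t, der t g1 (g2 t)) ->
  der t (fun t => expR ((n - k) * t) * (g1 t + k * g t))
    (expR ((n - k) * t) * (g2 t + n * g1 t + k * (n - k) * g t)).
Proof. by move=> dg dg1; der; ring. Qed.

Lemma not_below_neg_decay (f : R -> R) C a : 0 < a -> 0 < C ->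
  (forall t, - (C * expR (- (a * t))) <= f t) -> not_below_neg f.
Proof.
move=> a0 C0 h c T c0.
have cC : 0 < c / C by rewrite divr_gt0.
pose t := Num.max T (- (ln (c / C) / a) + 1).
exists t; first by rewrite le_max lexx.
apply: lt_le_trans (h t); rewrite ltrN2.
have tge : - (ln (c / C) / a) + 1 <= t by rewrite le_max lexx orbT.
have : expR (- (a * t)) < c / C.
  rewrite -[ltRHS]lnK ?posrE// ltr_expR.
  have : a * (- (ln (c / C) / a) + 1) <= a * t by rewrite ler_wpM2l// ltW.
  have -> : a * (- (ln (c / C) / a) + 1) = - ln (c / C) + a by field; rewrite gt_eqF.
  lra.
by rewrite ltr_pdivlMr// mulrC.
Qed.

(** One equation for the difference with the singular solution. The last two bounds are the tangent
    inequality at the singular profile, used in the pairing, and at the solution itself, used to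
    produce the supersolution for stability. *)
Lemma emden_half (n p a b A B : R) U U1 V :
  emden n p U U1 V -> 1 <= p -> p * b = a + 2 -> 0 < B -> a * (n - a) * A = B `^ p ->
  (forall t, 0 < V t) ->
  let f t := A * expR (- (a * t)) - U t in
  let f1 t := - a * A * expR (- (a * t)) - U1 t in
  let f2 t := a * a * A * expR (- (a * t)) + n * U1 t + expR (2 * t) * V t `^ p in
  let g t := B * expR (- (b * t)) - V t in
  [/\ forall t, der t f (f1 t), forall t, der t f1 (f2 t),
      forall t, 0 <= g t -> f2 t + n * f1 t <= 0,
      forall t, - (expR ((b - a) * t) * (p * B `^ (p - 1) * g t)) <= f2 t + n * f1 t &
      forall t, f2 t + n * f1 t <= - (expR (2 * t) * (p * V t `^ (p - 1) * g t))].
Proof.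
move=> hU p1 pb B0 eB V0 f f1 f2 g.
have dU := emden_der hU; have dU1 := emden_der1 hU.
have Bp t : (B * expR (- (b * t))) `^ p = B `^ p * expR (- ((a + 2) * t)).
  by rewrite powRM ?expR_ge0 ?ltW// -expRM; congr (_ * expR _); rewrite -pb; ring.
have Bt0 t : 0 < B * expR (- (b * t)) by rewrite mulr_gt0 ?expR_gt0.
have fE t : f2 t + n * f1 t = expR (2 * t) * (V t `^ p - (B * expR (- (b * t))) `^ p).
  rewrite Bp -eB /f2 /f1.
  have -> : expR (- (a * t)) = expR (2 * t) * expR (- ((a + 2) * t)).
    by rewrite -expRD; congr expR; ring.
  ring.
have f1E t : der t f (f1 t) by rewrite /f /f1; der; ring.
have f2E t : der t f1 (f2 t) by rewrite /f1 /f2; der; ring.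
split => // t.
- move=> g0; rewrite fE mulr_ge0_le0 ?expR_ge0// subr_le0.
  rewrite ge0_ler_powR ?nnegrE ?(ltW (V0 _)) ?(ltW (Bt0 _))//; first by lra.
  by move: g0; rewrite /g; lra.
- rewrite fE.
  have -> : expR ((b - a) * t) * (p * B `^ (p - 1) * g t) =
      expR (2 * t) * (p * (B * expR (- (b * t))) `^ (p - 1) * g t).
    rewrite powRM ?expR_ge0 ?(ltW B0)// -expRM.
    have -> : (b - a) * t = 2 * t + - (b * t) * (p - 1).
      have -> : a = p * b - 2 by rewrite pb; ring.
      ring.
    by rewrite expRD; ring.
  rewrite -[leLHS]mulrN ler_wpM2l ?expR_ge0//.
  by have := powR_tangent p1 (V0 t) (Bt0 t); rewrite /g; lra.
- rewrite fE -[leRHS]mulrN ler_wpM2l ?expR_ge0//.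
  by have := powR_tangent p1 (Bt0 t) (V0 t); rewrite /g; lra.
Qed.

Lemma decay_start (n p a A : R) U U1 V : emden n p U U1 V -> 0 <= n -> 0 < a -> 0 < A ->
  (forall t, 0 < V t) -> exists T, forall t, t <= T ->
   0 <= A * expR (- (a * t)) - U t /\ - a * A * expR (- (a * t)) - U1 t < 0.
Proof.
move=> hU n0 a0 A0 V0; have n1 : -1 <= n by lra.
have [M M0 UM] := emden_ub n1 hU V0.
pose K := (M + n * M / a) / A + 1.
have nM : 0 <= n * M / a by rewrite divr_ge0 ?mulr_ge0// ltW.
have K0 : 0 < K.
  have : 0 <= (M + n * M / a) / A by rewrite divr_ge0 ?(ltW A0)//; lra.
  by rewrite /K; lra.
have AK : A * K = M + n * M / a + A by rewrite /K; field; rewrite !gt_eqF.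
exists (- (ln K / a)) => t tT.
have le1 : K <= expR (- (a * t)).
  rewrite -[leLHS]lnK ?posrE// ler_expR.
  have : a * t <= a * - (ln K / a) by rewrite ler_wpM2l// ltW.
  have -> : a * - (ln K / a) = - ln K by field; rewrite gt_eqF.
  lra.
have le2 : M + n * M / a + A <= A * expR (- (a * t)) by rewrite -AK ler_wpM2l// ltW.
split; first by have := UM t; lra.
have := emden_low t n0 hU V0; have := UM t => UMt low.
have : n * U t <= n * M by rewrite ler_wpM2l.
have : a * (M + n * M / a + A) <= a * (A * expR (- (a * t))) by rewrite ler_wpM2l// ltW.
have -> : a * (M + n * M / a + A) = a * M + n * M + a * A by field; rewrite gt_eqF.
have : 0 < a * A by rewrite mulr_gt0.
have : 0 < a * M by rewrite mulr_gt0.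
lra.
Qed.

Lemma emden_below_singular (n p q a b A B : R) U U1 V V1 :
  0 < n -> 1 <= p -> 1 <= q -> 1 < p * q ->
  0 < a -> 0 < b -> p * b = a + 2 -> q * a = b + 2 ->
  0 < A -> 0 < B -> a * (n - a) * A = B `^ p -> b * (n - b) * B = A `^ q ->
  a + b <= n ->
  p * q * a * b * (n - a) * (n - b) <= ((n ^+ 2 - (a - b) ^+ 2) / 4) ^+ 2 ->
  emden n p U U1 V -> emden n q V V1 U ->
  forall t, [/\ U t < A * expR (- (a * t)), - a * A * expR (- (a * t)) < U1 t,
                V t < B * expR (- (b * t)) & - b * B * expR (- (b * t)) < V1 t].
Proof.
move=> n0 p1 q1 pq a0 b0 pb qa A0 B0 eB eA abn ineq hU hV.
have n1 : -1 <= n by lra.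
have U0 := emden_pos hU; have V0 := emden_pos hV.
pose f t := A * expR (- (a * t)) - U t.
pose f1 t := - a * A * expR (- (a * t)) - U1 t.
pose f2 t := a * a * A * expR (- (a * t)) + n * U1 t + expR (2 * t) * V t `^ p.
pose g t := B * expR (- (b * t)) - V t.
pose g1 t := - b * B * expR (- (b * t)) - V1 t.
pose g2 t := b * b * B * expR (- (b * t)) + n * V1 t + expR (2 * t) * U t `^ q.
have [df df1 hf lf _] : [/\ forall t, der t f (f1 t), forall t, der t f1 (f2 t),
    forall t, 0 <= g t -> f2 t + n * f1 t <= 0,
    forall t, - (expR ((b - a) * t) * (p * B `^ (p - 1) * g t)) <= f2 t + n * f1 t & _] :=
  emden_half hU p1 pb B0 eB V0.
have [dg dg1 hg lg _] : [/\ forall t, der t g (g1 t), forall t, der t g1 (g2 t),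
    forall t, 0 <= f t -> g2 t + n * g1 t <= 0,
    forall t, - (expR ((a - b) * t) * (q * A `^ (q - 1) * f t)) <= g2 t + n * g1 t & _] :=
  emden_half hV q1 qa A0 eA U0.
have [k1 [k2 [ek /andP[k10 k1n] /andP[k20 k2n] eP]]] := power_exponents a0 b0 pq abn ineq.
have pB0 : 0 < p * B `^ (p - 1) by rewrite mulr_gt0 ?powR_gt0//; lra.
have qA0 : 0 < q * A `^ (q - 1) by rewrite mulr_gt0 ?powR_gt0//; lra.
(* The weights $e^{(n-k_1)t}$ and $\kappa e^{(n-k_2)t}$ solve the transpose of the linearization at
   the singular solution: [e1] and [e2] are its two equations. In the derivative of [H] the lower
   bounds [lf] and [lg] then cancel the zeroth-order terms. *)
pose kap := k1 * (n - k1) / (p * B `^ (p - 1)).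
have kap0 : 0 < kap by rewrite divr_gt0// mulr_gt0//; lra.
have e1 : kap * (p * B `^ (p - 1)) = k1 * (n - k1) by rewrite divfK// gt_eqF.
have e2 : kap * (k2 * (n - k2)) = q * A `^ (q - 1).
  have eB' : B `^ (p - 1) * B = B `^ p by rewrite -powRS_gt0// subrK.
  have eA' : A `^ (q - 1) * A = A `^ q by rewrite -powRS_gt0// subrK.
  have : (k1 * (n - k1)) * (k2 * (n - k2)) * (A * B) = p * B `^ (p - 1) * (q * A `^ (q - 1)) * (A * B).
    rewrite eP (_ : p * B `^ (p - 1) * _ * _ = p * q * (B `^ (p - 1) * B) * (A `^ (q - 1) * A)); last by ring.
    by rewrite eB' eA' -eB -eA; ring.
  move=> /(mulIf (_ : A * B != 0)); rewrite gt_eqF ?mulr_gt0// => /(_ isT) e.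
  by rewrite /kap mulrAC e mulrAC mulfV ?mul1r// gt_eqF.
pose H t := expR ((n - k1) * t) * (g1 t + k1 * g t) + kap * (expR ((n - k2) * t) * (f1 t + k2 * f t)).
have dH t : der t H (expR ((n - k1) * t) * (g2 t + n * g1 t + k1 * (n - k1) * g t) +
   kap * (expR ((n - k2) * t) * (f2 t + n * f1 t + k2 * (n - k2) * f t))).
  apply: der_eq; first by apply: derD (der_pairing n k1 _ dg dg1)
    (derM (der_cst kap _) (der_pairing n k2 _ df df1)).
  by cbv beta; ring.
have dH0 t : 0 <= expR ((n - k1) * t) * (g2 t + n * g1 t + k1 * (n - k1) * g t) +
   kap * (expR ((n - k2) * t) * (f2 t + n * f1 t + k2 * (n - k2) * f t)).
  have x1 : expR ((n - k1) * t) * - (expR ((a - b) * t) * (q * A `^ (q - 1) * f t)) <=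
     expR ((n - k1) * t) * (g2 t + n * g1 t) by rewrite ler_wpM2l ?expR_ge0.
  have x2 : kap * (expR ((n - k2) * t) * - (expR ((b - a) * t) * (p * B `^ (p - 1) * g t))) <=
     kap * (expR ((n - k2) * t) * (f2 t + n * f1 t)).
    by rewrite ler_wpM2l ?(ltW kap0)// ler_wpM2l ?expR_ge0.
  have x3 : expR ((n - k1) * t) * expR ((a - b) * t) = expR ((n - k2) * t).
    by rewrite -expRD ek; congr expR; ring.
  have x4 : expR ((n - k2) * t) * expR ((b - a) * t) = expR ((n - k1) * t).
    by rewrite -expRD ek; congr expR; ring.
  have x5 : expR ((n - k1) * t) * - (expR ((a - b) * t) * (q * A `^ (q - 1) * f t)) =
      - (kap * (expR ((n - k2) * t) * (k2 * (n - k2) * f t))).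
    by rewrite -e2 -x3; ring.
  have x6 : kap * (expR ((n - k2) * t) * - (expR ((b - a) * t) * (p * B `^ (p - 1) * g t))) =
      - (expR ((n - k1) * t) * (k1 * (n - k1) * g t)).
    by rewrite -e1 -x4; ring.
  move: x1 x2; rewrite x5 x6 => x1 x2; rewrite !mulrDr.
  by rewrite -mulrDr in x1 x2 *; move: x1 x2; rewrite !mulrDr; lra.
have [M M0 UM] := emden_ub n1 hU V0; have [M' M'0 VM] := emden_ub n1 hV U0.
have U1n t : U1 t < 0 := emden_neg t n1 hU V0.
have V1n t : V1 t < 0 := emden_neg t n1 hV U0.
(* [H] is nondecreasing and bounded below by minus exponentials that vanish at the origin, because
   $k_1<n-b$ and $k_2<n-a$. *)
have H0 t : 0 <= H t.
  rewrite -oppr_le0.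
  apply: (@ninf0_ge _ (fun t => (b * B + k1 * M') * expR ((n - k1 - b) * t) +
     (kap * (a * A + k2 * M)) * expR ((n - k2 - a) * t)) _ (Num.min t 0)).
    have c1 : 0 < n - k1 - b by lra.
    have c2 : 0 < n - k2 - a by lra.
    have d1 : 0 <= b * B + k1 * M' by rewrite addr_ge0// mulr_ge0// ltW.
    have d2 : 0 <= kap * (a * A + k2 * M).
      by apply: mulr_ge0; [exact: ltW|rewrite addr_ge0// mulr_ge0// ltW].
    by apply: ninf0D; exact: ninf0_exp.
  move=> s; rewrite le_min => /andP[st s0]; apply: (@le_trans _ _ (- H s)).
    rewrite lerN2; exact: der_ge st (fun t _ => dH t) (fun t _ => dH0 t).
  have bound (d D D' k W W1 : R) : 0 < d -> 0 <= k -> 0 <= D -> 0 <= D' -> W <= D' -> W1 < 0 ->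
      - ((- d * D * expR (- (d * s)) - W1) + k * (D * expR (- (d * s)) - W)) <=
      (d * D + k * D') * expR (- (d * s)).
    move=> d0 k0 D0 D'0 WD W10.
    have E1 : 1 <= expR (- (d * s)) by rewrite -expR0 ler_expR oppr_ge0 mulr_ge0_le0// ltW.
    have : k * W <= k * D' by rewrite ler_wpM2l.
    have : k * D' * 1 <= k * D' * expR (- (d * s)) by rewrite ler_wpM2l// mulr_ge0.
    have : 0 <= k * D * expR (- (d * s)) by rewrite !mulr_ge0 ?expR_ge0.
    by move: W10; clear; lra.
  have y1 := bound b B M' k1 (V s) (V1 s) b0 (ltW k10) (ltW B0) (ltW M'0) (VM s) (V1n s).
  have y2 := bound a A M k2 (U s) (U1 s) a0 (ltW k20) (ltW A0) (ltW M0) (UM s) (U1n s).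
  rewrite /H opprD lerD//.
    rewrite -[leLHS]mulrN [leRHS]mulrC (_ : (n - k1 - b) * s = (n - k1) * s + - (b * s)); last by ring.
    by rewrite expRD -mulrA ler_wpM2l ?expR_ge0// mulrC; exact: y1.
  rewrite -[leLHS]mulrN -[leRHS]mulrA ler_wpM2l ?(ltW kap0)//.
  rewrite -[leLHS]mulrN [leRHS]mulrC (_ : (n - k2 - a) * s = (n - k2) * s + - (a * s)); last by ring.
  by rewrite expRD -mulrA ler_wpM2l ?expR_ge0// mulrC; exact: y2.
have n0' : 0 <= n by exact: ltW.
have [T1 hT1] := decay_start hU n0' a0 A0 V0.
have [T2 hT2] := decay_start hV n0' b0 B0 U0.
pose T := Num.min T1 T2.
have hT t : t <= T -> [/\ 0 <= f t, 0 <= g t, f1 t < 0 & g1 t < 0].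
  by rewrite le_min => /andP[/hT1[? ?] /hT2[? ?]].
have p0 : 0 <= p := le_trans ler01 p1.
have q0 : 0 <= q := le_trans ler01 q1.
have ea : a * (p * q - 1) = 2 * (p + 1).
  by have h : p * (q * a) = p * (b + 2) by [rewrite qa]; move: h pb; lra.
have eb : b * (q * p - 1) = 2 * (q + 1).
  by have h : q * (p * b) = q * (a + 2) by [rewrite pb]; move: h qa; lra.
have qp : 1 < q * p by rewrite mulrC.
have [Cu Cu0 hCu] := emden_decay n0' p0 q0 pq ea hU hV.
have [Cv Cv0 hCv] := emden_decay n0' q0 p0 qp eb hV hU.
have nbf : not_below_neg f.
  apply: (not_below_neg_decay a0 Cu0) => t.
  have := hCu t; have : 0 <= A * expR (- (a * t)) by rewrite mulr_ge0 ?expR_ge0// ltW.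
  by rewrite /f; move: (U t) => y; clear; lra.
have nbg : not_below_neg g.
  apply: (not_below_neg_decay b0 Cv0) => t.
  have := hCv t; have : 0 <= B * expR (- (b * t)) by rewrite mulr_ge0 ?expR_ge0// ltW.
  by rewrite /g; move: (V t) => y; clear; lra.
have [_ _ f1T g1T] := hT T (lexx _).
have [pos|[t [ft gt f1t g1t [neg _]]]] := crossing df df1 dg dg1 hf hg nbf nbg
    (fun t tT => let: And4 x y _ _ := hT t tT in conj x y) f1T g1T; last first.
  (* At a crossing all four values are nonpositive and one derivative is negative, so [H] is
     negative. *)
  exfalso; have := H0 t; rewrite leNgt => /negP; apply.
  have h1 : expR ((n - k1) * t) * (g1 t + k1 * g t) <= expR ((n - k1) * t) * g1 t.
    by rewrite ler_wpM2l ?expR_ge0// gerDl mulr_ge0_le0// ltW.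
  have h2 : kap * (expR ((n - k2) * t) * (f1 t + k2 * f t)) <= kap * (expR ((n - k2) * t) * f1 t).
    by rewrite ler_wpM2l ?(ltW kap0)// ler_wpM2l ?expR_ge0// gerDl mulr_ge0_le0// ltW.
  apply: le_lt_trans (lerD h1 h2) _.
  have h3 : expR ((n - k1) * t) * g1 t <= 0 by rewrite mulr_ge0_le0 ?expR_ge0.
  have h4 : kap * (expR ((n - k2) * t) * f1 t) <= 0.
    by rewrite mulr_ge0_le0 ?(ltW kap0)// mulr_ge0_le0 ?expR_ge0.
  case: neg => neg.
    by rewrite -[ltRHS]addr0 ler_ltD// pmulr_rlt0// pmulr_rlt0 ?expR_gt0.
  by rewrite -[ltRHS]addr0 ltr_leD// pmulr_rlt0 ?expR_gt0.
have f1n t : f1 t < 0.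
  have [tT|/ltW Tt] := leP t T; first by have [] := hT t tT.
  by apply: (flux_neg Tt df1) f1T => x _; apply: hf; have [] := pos x.
have g1n t : g1 t < 0.
  have [tT|/ltW Tt] := leP t T; first by have [] := hT t tT.
  by apply: (flux_neg Tt dg1) g1T => x _; apply: hg; have [] := pos x.
move=> t; have t1 : t < t + 1 by rewrite ltrDl.
have ff : f (t + 1) < f t by apply: der_lt t1 (fun t _ => df t) _ => x _.
have gg : g (t + 1) < g t by apply: der_lt t1 (fun t _ => dg t) _ => x _.
have [fp gp] := pos (t + 1).
split.
- by rewrite -subr_gt0; exact: le_lt_trans fp ff.
- by rewrite -subr_lt0; exact: f1n.
- by rewrite -subr_gt0; exact: le_lt_trans gp gg.
- by rewrite -subr_lt0; exact: g1n.
Qed.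

End Ordering.

(** * Stability and ordering when the inequality holds *)

Section Supercritical.
Context {R : realType} {N : nat}.
Implicit Types (u v : 'rV[R]_N -> R).

Lemma exp_decay_big (a A c : R) : 0 < a -> 0 < A ->
  exists T, forall t, t <= T -> c <= A * expR (- (a * t)).
Proof.
move=> a0 A0; pose K := `|c| / A + 1.
have cA : 0 <= `|c| / A by rewrite divr_ge0// ltW.
have K0 : 0 < K by rewrite /K; lra.
exists (- (ln K / a)) => t tT.
have le1 : K <= expR (- (a * t)).
  rewrite -[leLHS]lnK ?posrE// ler_expR.
  have : a * t <= a * - (ln K / a) by rewrite ler_wpM2l// ltW.
  have -> : a * - (ln K / a) = - ln K by field; rewrite gt_eqF.
  lra.
have : A * K <= A * expR (- (a * t)) by rewrite ler_wpM2l// ltW.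
have -> : A * K = `|c| + A by rewrite /K; field; rewrite gt_eqF.
have := ler_norm c; lra.
Qed.

Lemma stable_aux (i0 : 'I_N) (n p q a b A B : R) u v (U U1 V V1 : R -> R) :
  n = N%:R - 2 -> 0 < n -> 1 <= p -> 1 <= q -> 1 < p * q ->
  0 < a -> 0 < b -> p * b = a + 2 -> q * a = b + 2 ->
  0 < A -> 0 < B -> a * (n - a) * A = B `^ p -> b * (n - b) * B = A `^ q ->
  emden n p U U1 V -> emden n q V V1 U ->
  (forall t, [/\ U t < A * expR (- (a * t)), - a * A * expR (- (a * t)) < U1 t,
                V t < B * expR (- (b * t)) & - b * B * expR (- (b * t)) < V1 t]) ->
  (forall x, x != 0 -> u x = U (2^-1 * ln (sqnorm x))) ->
  (forall x, x != 0 -> v x = V (2^-1 * ln (sqnorm x))) ->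
  stable p q u v.
Proof.
move=> en n0 p1 q1 pq a0 b0 pb qa A0 B0 eA eB hU hV below uE vE.
have U0 := emden_pos hU; have V0 := emden_pos hV.
have n1 : -1 <= n by lra.
have [M M0 UM] := emden_ub n1 hU V0; have [M' M'0 VM] := emden_ub n1 hV U0.
have [df df1 _ _ lf] := emden_half hU p1 pb B0 eA V0.
have [dg dg1 _ _ lg] := emden_half hV q1 qa A0 eB U0.
have pw0 (r x : R) : 1 <= r -> 0 <= r * x `^ (r - 1).
  by move=> r1; rewrite mulr_ge0 ?powR_ge0//; lra.
have wle (r x y : R) : 1 <= r -> 0 < x -> x <= y -> r * x `^ (r - 1) <= r * y `^ (r - 1).
  move=> r1 x0 xy; rewrite ler_wpM2l//; first by lra.
  by rewrite ge0_ler_powR ?nnegrE ?subr_ge0 ?(ltW x0)// ltW// (lt_le_trans x0).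
have contf2 (k r c0 : R) (W W1 Z Z1 : R -> R) :
    emden n r W W1 Z -> (forall t, der t Z (Z1 t)) -> (forall t, 0 < Z t) ->
    continuous (fun t => k * k * c0 * expR (- (k * t)) + n * W1 t + expR (2 * t) * Z t `^ r).
  move=> hW dZ Z0 t; have dW1 := emden_der1 hW.
  have [d hd] : exists d,
      der t (fun t => k * k * c0 * expR (- (k * t)) + n * W1 t + expR (2 * t) * Z t `^ r) d.
    by eexists; repeat der_step.
  exact: der_cont hd.
have fbig (k c0 D : R) (W : R -> R) : 0 < k -> 0 < c0 -> (forall t, W t <= D) ->
   forall c, exists T, forall t, t <= T -> c <= c0 * expR (- (k * t)) - W t.
  move=> k0 c00 WD c; have [T hT] := exp_decay_big (c + D) k0 c00.
  by exists T => t /hT; have := WD t; lra.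
(* A common bound for both potentials. The values at $0$ are included separately since the
   logarithmic profiles only describe $x\ne0$. *)
have [K [K0 KM KM' Ku Kv]] : exists K : R, [/\ 0 < K, q * M `^ (q - 1) <= K, p * M' `^ (p - 1) <= K,
    q * u 0 `^ (q - 1) <= K & p * v 0 `^ (p - 1) <= K].
  have := (pw0 p M' p1, pw0 q M q1, pw0 p (v 0) p1, pw0 q (u 0) q1).
  move: (p * M' `^ (p - 1)) (q * M `^ (q - 1)) (p * v 0 `^ (p - 1)) (q * u 0 `^ (q - 1)).
  by move=> k1 k2 k3 k4 [[[h1 h2] h3] h4]; exists (k1 + k2 + k3 + k4 + 1); move: h1 h2 h3 h4; clear; split; lra.
have N2 : 2 <= N%:R :> R by rewrite -subr_ge0 -en ltW.
apply: (@regularize R N (fun t => A * expR (- (a * t)) - U t) _ _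
  (fun t => B * expR (- (b * t)) - V t) _ _
  (fun t => p * V t `^ (p - 1)) (fun t => q * U t `^ (q - 1))
  (fun x => p * v x `^ (p - 1)) (fun x => q * u x `^ (q - 1)) K N2
  df df1 (contf2 a p A _ _ _ _ hU (emden_der hV) V0)
  dg dg1 (contf2 b q B _ _ _ _ hV (emden_der hU) U0)) => //.
- by move=> t; have [? _ _ _] := below t; rewrite subr_gt0.
- by move=> t; have [_ _ ? _] := below t; rewrite subr_gt0.
- by move=> t; have [_ ? _ _] := below t; rewrite subr_lt0.
- by move=> t; have [_ _ _ ?] := below t; rewrite subr_lt0.
- exact: fbig a A M U a0 A0 UM.
- exact: fbig b B M' V b0 B0 VM.
- by move=> t; rewrite -en -[expR _ * _ * _]mulrA; exact: lf.
- by move=> t; rewrite -en -[expR _ * _ * _]mulrA; exact: lg.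
- by move=> t; rewrite pw0//= (le_trans _ KM')// wle.
- by move=> t; rewrite pw0//= (le_trans _ KM)// wle.
- by move=> x x0; rewrite vE.
- by move=> x x0; rewrite uE.
Qed.

Section Exponents.
Variables (p q : R).
Hypotheses (hq : 1 <= q) (hqp : q <= p) (hpq : 1 < p * q).

Lemma LE_exponents : let a := LEalpha p q in let b := LEbeta p q in
  [/\ 0 < a, 0 < b, p * b = a + 2 & q * a = b + 2] /\
  [/\ a * (p * q - 1) = 2 * (p + 1), b * (p * q - 1) = 2 * (q + 1), b <= a & a <= b + 2].
Proof.
move: hq hqp hpq => q1 qp pq a b.
have pq1 : 0 < p * q - 1 by lra.
have pq0 : p * q - 1 != 0 by rewrite gt_eqF.
have a0 : 0 < a by rewrite divr_gt0//; lra.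
have b0 : 0 < b by rewrite divr_gt0//; lra.
have pb : p * b = a + 2 by rewrite /a /b /LEalpha /LEbeta; field.
have qa : q * a = b + 2 by rewrite /a /b /LEalpha /LEbeta; field.
split; split => //.
- by rewrite /a /LEalpha divfK.
- by rewrite /b /LEbeta divfK.
- by rewrite /a /b /LEalpha /LEbeta ler_pM2r ?invr_gt0//; lra.
- by rewrite -qa ler_peMl// ltW.
Qed.

Variables (i0 : 'I_N) (u v : 'rV[R]_N -> R).
Hypotheses (sol : lane_emden_solution p q u v) (ru : radial u) (rv : radial v).

Lemma emden_solution :
  emden (N%:R - 2) p (profile i0 u) (profile1 i0 u) (profile i0 v) /\
  emden (N%:R - 2) q (profile i0 v) (profile1 i0 v) (profile i0 u).
Proof.
have [cu cv pos eu ev] := sol.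
by split; apply: emden_profile => // x; have [] := pos x.
Qed.

Lemma solution_dim : 0 < N%:R - 2 :> R.
Proof.
have [hU hV] := emden_solution.
apply: emden_dim hU (emden_pos hV).
have : (1 <= N)%N by case: (N) i0 => // -[].
by rewrite -(ler_nat R); lra.
Qed.

Lemma solution_supercritical : LEalpha p q + LEbeta p q <= N%:R - 2.
Proof.
have [[a0 b0 pb qa] [ea eb _ _]] := LE_exponents; have [hU hV] := emden_solution.
by apply: emden_pohozaev solution_dim _ _ hpq ea eb hU hV; move: hq hqp; lra.
Qed.

Lemma u_singE a A (x : 'rV[R]_N) : x != 0 ->
  A * enorm x `^ (- a) = A * expR (- (a * (2^-1 * ln (sqnorm x)))).
Proof.
move=> /sqnorm_gt0 x0; rewrite /enorm -/(sqnorm x) -sqrt_expR2// -expRM.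
by congr (_ * expR _); ring.
Qed.

Hypothesis ineq : stability_ineq N p q.

Lemma stable_below_singular :
  stable p q u v /\ (forall x, x != 0 -> u x < u_sing p q x /\ v x < v_sing p q x).
Proof.
have [[a0 b0 pb qa] _] := LE_exponents; have [hU hV] := emden_solution.
have n0 := solution_dim; have abn := solution_supercritical.
have p1 : 1 <= p by apply: le_trans hqp.
have S0 : 0 < LES N p q.
  by rewrite mulr_gt0// subr_gt0 (lt_le_trans _ abn)// ltrDl.
have T0 : 0 < LET N p q.
  by rewrite mulr_gt0// subr_gt0 (lt_le_trans _ abn)// ltrDr.
have [A0 B0 eA eB] := singular_constants S0 T0 hpq.
have below := emden_below_singular n0 p1 hq hpq a0 b0 pb qa A0 B0 eA eB abn ineq hU hV.
have uE x : x != 0 -> u x = profile i0 u (2^-1 * ln (sqnorm x)) by exact: profileE.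
have vE x : x != 0 -> v x = profile i0 v (2^-1 * ln (sqnorm x)) by exact: profileE.
split.
  exact: (stable_aux i0 erefl n0 p1 hq hpq a0 b0 pb qa A0 B0 eA eB hU hV below uE vE).
move=> x x0; rewrite /u_sing /v_sing !u_singE// uE// vE//.
by have [] := below (2^-1 * ln (sqnorm x)).
Qed.

End Exponents.
End Supercritical.

(** * Oscillation at infinity *)

Section Oscillation.
Context {R : realType}.

(* With [x = (a + b) / 2], [d = (a - b) / 2] and [y = n / 2 - x] the claim reads
   [(n + 2 y - y^2) (n^2 / 2 - y^2 + n + 2 y - 2 d^2) > 4 d^2 (1 - y)^2]. *)
Lemma low_dim_strict (n a b : R) : 0 < b -> b <= a -> a <= b + 2 -> a + b <= n -> n <= 8 ->
  ((n ^+ 2 - (a - b) ^+ 2) / 4) ^+ 2 < (a + 2) * (b + 2) * (n - a) * (n - b).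
Proof.
move=> b0 ba ab abn n8.
pose d := (a - b) / 2; pose z := (a + b) / 2; pose y := n / 2 - z.
have -> : a = z + d by rewrite /z /d; field.
have -> : b = z - d by rewrite /z /d; field.
have -> : n = 2 * (y + z) by rewrite /y; field.
have d0 : 0 <= d by rewrite /d; lra.
have d1 : d <= 1 by rewrite /d; lra.
have dz : d < z by rewrite /d /z; lra.
have y0 : 0 <= y by rewrite /y /z; lra.
have yz4 : y + z <= 4 by rewrite /y; lra.
clearbody d z y; clear a b n b0 ba ab abn n8.
have z0 : 0 < z by lra.
pose E := 2 * z + 4 * y - y ^+ 2; pose F := y ^+ 2 + 4 * y * z + 4 * y + 2 * z + 2 * (z ^+ 2 - d ^+ 2).
rewrite -subr_gt0.
have -> : (z + d + 2) * (z - d + 2) * (2 * (y + z) - (z + d)) * (2 * (y + z) - (z - d)) -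
   (((2 * (y + z)) ^+ 2 - (z + d - (z - d)) ^+ 2) / 4) ^+ 2 = E * F - 4 * d ^+ 2 * (1 - y) ^+ 2.
  by rewrite /E /F; field.
rewrite subr_gt0.
have dd : d ^+ 2 <= z by nra.
have dz2 : d ^+ 2 < z ^+ 2 by nra.
(* This is $y(4-y-z)\ge0$; here the bound $n\le8$ enters. *)
have hE : z * (2 + y) <= E by rewrite /E; nra.
have hF : y ^+ 2 + 4 * y + 2 * z <= F.
  have : 0 <= y * z by rewrite mulr_ge0// ltW.
  by rewrite /F; lra.
have zy : 0 <= z * (2 + y) by rewrite mulr_ge0//; lra.
have EF : z * (2 + y) * (y ^+ 2 + 4 * y + 2 * z) <= E * F.
  by rewrite ler_pM//; have := sqr_ge0 y; lra.
apply: lt_le_trans EF.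
have [y2|y2] := leP y 2.
  have h1 : 4 * d ^+ 2 * (1 - y) ^+ 2 <= 4 * d ^+ 2.
    have : (1 - y) ^+ 2 <= 1 by nra.
    have := sqr_ge0 d; nra.
  apply: le_lt_trans h1 _; apply: (@lt_le_trans _ _ (z * 2 * (2 * z))); first by lra.
  have : 0 <= y ^+ 2 by exact: sqr_ge0.
  have : 0 <= z * y by rewrite mulr_ge0// ltW.
  by move=> zy0 y20; apply: ler_pM; lra.
have h1 : 4 * d ^+ 2 * (1 - y) ^+ 2 <= z * (4 * (1 - y) ^+ 2).
  by rewrite mulrAC mulrC ler_wpM2r// mulr_ge0// sqr_ge0.
apply: le_lt_trans h1 _; rewrite -mulrA ltr_pM2l//.
apply: (@lt_le_trans _ _ (4 * y ^+ 2)); first by nra.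
nra.
Qed.

Lemma powR_close (p B eta : R) (z : R -> R) : 0 < B -> 0 < eta ->
  (forall t, 0 < z t <= B) -> (forall e : R, 0 < e -> exists T, forall t, T <= t -> B - e <= z t) ->
  exists T, forall t, T <= t -> `|p * z t `^ (p - 1) - p * B `^ (p - 1)| <= eta.
Proof.
move=> B0 eta0 zB zlim; pose h x := p * x `^ (p - 1).
have [d hd] : exists d, der B h d.
  by eexists; apply: derM; [exact: der_cst|apply: der_powR B0 (der_id _)].
have ch := der_cont hd.
have lt1 : h B < h B + eta by lra. have lt2 : h B - eta < h B by lra.
have [d1 d10 h1] := cont_lt_near ch lt1; have [d2 d20 h2] := cont_gt_near ch lt2.
have m0 : 0 < Num.min d1 d2 / 2 by rewrite divr_gt0// lt_min d10.
have md1 : Num.min d1 d2 <= d1 by rewrite ge_min lexx.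
have md2 : Num.min d1 d2 <= d2 by rewrite ge_min lexx orbT.
have [T hT] := zlim _ m0; exists T => t /hT zt; have /andP[z0 zle] := zB t.
have zd : `|z t - B| <= Num.min d1 d2 / 2 by rewrite ler_norml; apply/andP; split; lra.
have z1 : `|z t - B| < d1 by lra. have z2 : `|z t - B| < d2 by lra.
by have := h1 _ z1; have := h2 _ z2; rewrite /h ler_norml => ? ?; apply/andP; split; lra.
Qed.

(** In $w=e^{at}U$ and $z=e^{bt}V$ the system is autonomous. The decay estimates bound $w$ and $z$,
    so monotonicity gives limits, and [limit_balance] shows that they satisfy the algebraic
    relations of the singular constants. *)
Lemma monotone_limits (n p q a b : R) U U1 V V1 :
  0 < n -> 1 <= p -> 1 <= q -> 1 < p * q ->
  0 < a -> 0 < b -> p * b = a + 2 -> q * a = b + 2 ->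
  emden n p U U1 V -> emden n q V V1 U ->
  (forall s t, s <= t -> expR (a * s) * U s <= expR (a * t) * U t) ->
  (forall s t, s <= t -> expR (b * s) * V s <= expR (b * t) * V t) ->
  exists A B, [/\ 0 < A, 0 < B, a * (n - a) * A = B `^ p, b * (n - b) * B = A `^ q &
    forall eta, 0 < eta -> exists T, forall t, T <= t ->
     `|p * (expR (b * t) * V t) `^ (p - 1) - p * B `^ (p - 1)| <= eta /\
     `|q * (expR (a * t) * U t) `^ (q - 1) - q * A `^ (q - 1)| <= eta].
Proof.
move=> n0 p1 q1 pq a0 b0 pb qa hU hV mU mV.
have U0 := emden_pos hU; have V0 := emden_pos hV.
have dU := emden_der hU; have dU1 := emden_der1 hU.
have dV := emden_der hV; have dV1 := emden_der1 hV.
have p0 : 0 <= p by lra. have q0 : 0 <= q by lra.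
have ea : a * (p * q - 1) = 2 * (p + 1).
  by have h : p * (q * a) = p * (b + 2) by [rewrite qa]; move: h pb; lra.
have eb : b * (q * p - 1) = 2 * (q + 1).
  by have h : q * (p * b) = q * (a + 2) by [rewrite pb]; move: h qa; lra.
have qp : 1 < q * p by rewrite mulrC.
have [Cu Cu0 hCu] := emden_decay (ltW n0) p0 q0 pq ea hU hV.
have [Cv Cv0 hCv] := emden_decay (ltW n0) q0 p0 qp eb hV hU.
have bdd (k C : R) (W : R -> R) t : W t <= C * expR (- (k * t)) -> expR (k * t) * W t <= C.
  by move=> le1; rewrite -ler_pdivlMl ?expR_gt0// -expRN mulrC.
pose w t := expR (a * t) * U t; pose z t := expR (b * t) * V t.
have w0 t : 0 < w t by rewrite mulr_gt0 ?expR_gt0.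
have z0 t : 0 < z t by rewrite mulr_gt0 ?expR_gt0.
have [A [wA wlim]] := monotone_sup mU (fun t => bdd a Cu U t (hCu t)).
have [B [zB zlim]] := monotone_sup mV (fun t => bdd b Cv V t (hCv t)).
have A0 : 0 < A by apply: lt_le_trans (wA 0); exact: w0.
have B0 : 0 < B by apply: lt_le_trans (zB 0); exact: z0.
have wA' t : 0 < w t <= A by rewrite w0 wA.
have zB' t : 0 < z t <= B by rewrite z0 zB.
exists A, B; split => //.
- apply: (@limit_balance R w (fun t => expR (a * t) * (a * U t + U1 t))
    (fun t => expR (a * t) * (a * a * U t + 2 * a * U1 t + (- n * U1 t - expR (2 * t) * V t `^ p)))
    z (n - 2 * a) (a * (n - a)) p A B p1 A0 B0) => // t.
  + by rewrite /w; der; ring.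
  + by der; ring.
  + rewrite /z powRM ?expR_ge0 ?(ltW (V0 _))// -expRM (_ : b * t * p = a * t + 2 * t).
      by rewrite expRD /w; ring.
    by rewrite mulrAC [b * p]mulrC pb; ring.
- apply: (@limit_balance R z (fun t => expR (b * t) * (b * V t + V1 t))
    (fun t => expR (b * t) * (b * b * V t + 2 * b * V1 t + (- n * V1 t - expR (2 * t) * U t `^ q)))
    w (n - 2 * b) (b * (n - b)) q B A q1 B0 A0) => // t.
  + by rewrite /z; der; ring.
  + by der; ring.
  + rewrite /w powRM ?expR_ge0 ?(ltW (U0 _))// -expRM (_ : a * t * q = b * t + 2 * t).
      by rewrite expRD /z; ring.
    by rewrite mulrAC [a * q]mulrC qa; ring.
- move=> eta eta0; have [T1 h1] := powR_close p B0 eta0 zB' zlim.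
  have [T2 h2] := powR_close q A0 eta0 wA' wlim.
  exists (Num.max T1 T2) => t; rewrite ge_max => /andP[t1 t2].
  by split; [exact: h1|exact: h2].
Qed.

(** The characteristic equation at the complex exponents $k=\frac n2\mp d+iw$: the two values of
    $k(n-k)$ are the conjugates $m+w^2\pm2iwd$, so their product is a sum of squares. It is a
    quadratic equation in $w^2$. *)
Lemma frequency (m d PQ : R) : 0 < m -> m ^+ 2 < PQ ->
  exists2 w, 0 < w & (m + w ^+ 2) ^+ 2 + (2 * w * d) ^+ 2 = PQ.
Proof.
move=> m0 mPQ; pose h := m + 2 * d ^+ 2; pose D := h ^+ 2 + (PQ - m ^+ 2).
have h0 : 0 < h by rewrite /h; have := sqr_ge0 d; lra.
have D0 : 0 <= D by rewrite /D addr_ge0 ?sqr_ge0//; lra.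
have sD : h < Num.sqrt D.
  rewrite -[ltLHS](ger0_norm (ltW h0)) -sqrtr_sqr ltr_sqrt /D; first by lra.
  by rewrite ltr_wpDl ?sqr_ge0// subr_gt0.
pose y := Num.sqrt D - h; have y0 : 0 < y by rewrite subr_gt0.
exists (Num.sqrt y); first by rewrite sqrtr_gt0.
have sy : Num.sqrt y ^+ 2 = y by rewrite sqr_sqrtr// ltW.
have -> : (m + Num.sqrt y ^+ 2) ^+ 2 + (2 * Num.sqrt y * d) ^+ 2 =
  (m + y) ^+ 2 + 4 * d ^+ 2 * y by rewrite -[in RHS]sy; ring.
have sD2 : Num.sqrt D ^+ 2 = D by rewrite sqr_sqrtr.
have : (y + h) ^+ 2 = D by rewrite /y subrK.
rewrite /D /h; lra.
Qed.

Section Pair.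
Variables (n d m w X Y P Q eps kap t0 : R).
Hypotheses (eX : X = m + w ^+ 2) (eY : Y = 2 * w * d) (em : m = (n / 2) ^+ 2 - d ^+ 2).
Hypotheses (P0 : 0 < P) (ePQ : X ^+ 2 + Y ^+ 2 = P * Q).

(** [cos] and the trigonometric part of [osc'] come from the real part of $e^{-kt}$ with $k=\frac
    n2-d+iw$, for which $k(n-k)=X+iY$; [eps] and [eps * kap] raise the two components. *)
Definition osc t := cos (w * (t - t0)) + eps.
Definition osc' t := (X * cos (w * (t - t0)) + Y * sin (w * (t - t0))) / P + eps * kap.

Definition bumpf t := expR (- ((n / 2 - d) * t)) * osc t.
Definition bumpf1 t := expR (- ((n / 2 - d) * t)) *
  (- (n / 2 - d) * osc t - w * sin (w * (t - t0))).
Definition bumpf2 t := expR (- ((n / 2 - d) * t)) *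
  ((n / 2 - d) ^+ 2 * osc t + 2 * (n / 2 - d) * w * sin (w * (t - t0)) -
   w ^+ 2 * cos (w * (t - t0))).

Definition bumpg t := expR (- ((n / 2 + d) * t)) * osc' t.
Definition bumpg1 t := expR (- ((n / 2 + d) * t)) *
  (- (n / 2 + d) * osc' t + (Y * cos (w * (t - t0)) - X * sin (w * (t - t0))) * w / P).
Definition bumpg2 t := expR (- ((n / 2 + d) * t)) *
  ((n / 2 + d) ^+ 2 * osc' t - 2 * (n / 2 + d) * ((Y * cos (w * (t - t0)) - X * sin (w * (t - t0))) * w / P)
   - (X * cos (w * (t - t0)) + Y * sin (w * (t - t0))) * w ^+ 2 / P).

Lemma der_bumpf t : der t bumpf (bumpf1 t).
Proof. by rewrite /bumpf /bumpf1 /osc; der; ring. Qed.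

Lemma der_bumpf1 t : der t bumpf1 (bumpf2 t).
Proof. by rewrite /bumpf1 /bumpf2 /osc; der; ring. Qed.

Lemma der_bumpg t : der t bumpg (bumpg1 t).
Proof. by rewrite /bumpg /bumpg1 /osc'; der; field; exact: lt0r_neq0. Qed.

Lemma der_bumpg1 t : der t bumpg1 (bumpg2 t).
Proof. by rewrite /bumpg1 /bumpg2 /osc'; der; field; exact: lt0r_neq0. Qed.

(** The trigonometric parts solve the limiting system exactly. Only the added constants leave a
    residue, with $m=k(n-k)$ at the real exponents $k=\frac n2\mp d$. *)
Lemma bumpf_eq t : bumpf2 t + n * bumpf1 t =
  - (expR (- ((n / 2 - d) * t)) * (P * osc' t - eps * (P * kap - m))).
Proof.
rewrite /bumpf2 /bumpf1 /osc /osc' eX eY em; field; exact: lt0r_neq0.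
Qed.

Lemma bumpg_eq t : bumpg2 t + n * bumpg1 t =
  - (expR (- ((n / 2 + d) * t)) * (Q * osc t - eps * (Q - m * kap))).
Proof.
have -> : Q = (X ^+ 2 + Y ^+ 2) / P by rewrite ePQ mulrAC mulfV ?mul1r// lt0r_neq0.
rewrite /bumpg2 /bumpg1 /osc /osc' eX eY em; field; exact: lt0r_neq0.
Qed.

End Pair.

End Oscillation.

(** * Monotonicity of rescalings *)

Section Instability.
Context {R : realType} {N : nat}.
Implicit Types (u v : 'rV[R]_N -> R) (x : 'rV[R]_N).

Lemma stable_no_bump (p q r s : R) u v (f g : 'rV[R]_N -> R) x1 : 0 <= p -> 0 <= q ->
  stable p q u v ->
  (forall x, r <= sqnorm x <= s -> {for x, continuous f} /\ {for x, continuous g}) ->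
  (forall x, r < sqnorm x < s -> [/\ regular2 f x, regular2 g x,
     - laplacian f x < p * v x `^ (p - 1) * g x & - laplacian g x < q * u x `^ (q - 1) * f x]) ->
  (forall x, sqnorm x = r \/ sqnorm x = s -> f x <= 0 /\ g x <= 0) ->
  r <= sqnorm x1 <= s -> f x1 <= 0.
Proof.
move=> p0 q0 [phi [psi [cphi cpsi pos sphi spsi]]] cfg sub bd x1K.
apply: (@no_bump R N r s phi psi f g (fun x => p * v x `^ (p - 1)) (fun x => q * u x `^ (q - 1))) => //.
- by have [[]] := cphi.
- by have [[]] := cpsi.
- by move=> x; have [] := pos x.
- by move=> x; have [] := pos x.
- by move=> x; exact: C2_regular2.
- by move=> x; exact: C2_regular2.
- by move=> x; rewrite mulr_ge0 ?powR_ge0.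
- by move=> x; rewrite mulr_ge0 ?powR_ge0.
Qed.

Lemma ninf0_shift (k h : R) (F : R -> R) : 0 <= h -> ninf0 F -> ninf0 (fun t => k * F (t - h)).
Proof.
move=> h0 F0 e e0; have k1 : 0 < `|k| + 1 by have := normr_ge0 k; lra.
have [d d0 ed] : exists2 d, 0 < d & (`|k| + 1) * d = e.
  by exists (e / (`|k| + 1)); [rewrite divr_gt0|field; rewrite gt_eqF].
have [T hT] := F0 d d0; exists T => t tT; rewrite normrM.
have th : t - h <= T by lra.
have : `|k| * `|F (t - h)| <= `|k| * d by rewrite ler_wpM2l// hT.
by have := normr_ge0 k; lra.
Qed.

(* [e^(-a h) U (t - h)] is the profile of the rescaled solution [l^a u (l x)], [l = e^(-h)]. *)
Lemma emden_shift_diff (n p a b h : R) (U U1 V : R -> R) : emden n p U U1 V -> (forall t, 0 < V t) ->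
  1 <= p -> p * b = a + 2 ->
  let f t := U t - expR (- (a * h)) * U (t - h) in
  let f1 t := U1 t - expR (- (a * h)) * U1 (t - h) in
  let g t := V t - expR (- (b * h)) * V (t - h) in
  exists f2 : R -> R, [/\ forall t, der t f (f1 t), forall t, der t f1 (f2 t) &
    forall t, f2 t + n * f1 t =
      - (expR (2 * t) * (V t `^ p - (expR (- (b * h)) * V (t - h)) `^ p))].
Proof.
move=> hU V0 p1 pb f f1 g; have dU := emden_der hU; have dU1 := emden_der1 hU.
exists (fun t => - n * U1 t - expR (2 * t) * V t `^ p -
  expR (- (a * h)) * (- n * U1 (t - h) - expR (2 * (t - h)) * V (t - h) `^ p)); split => t.
- by rewrite /f /f1; der; ring.
- by rewrite /f1; der; ring.
- rewrite powRM ?expR_ge0 ?(ltW (V0 _))// -expRM.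
  have e1 : expR (- (a * h)) * expR (2 * (t - h)) = expR (2 * t) * expR (- (b * h) * p).
    rewrite -!expRD; congr expR; rewrite (_ : - (b * h) * p = - (p * b) * h); last by ring.
    by rewrite pb; ring.
  set E := expR (- (b * h) * p) in e1 *.
  have -> : expR (2 * t) * (V t `^ p - E * V (t - h) `^ p) =
    expR (2 * t) * V t `^ p - expR (2 * t) * E * V (t - h) `^ p by ring.
  by rewrite /f1 -e1; ring.
Qed.

(** As $t\to-\infty$, $U$ increases to a positive limit $L$, and $cU(t-h)\le cL<L$. *)
Lemma eventually_above_multiple (U : R -> R) c M h : (forall s t, s <= t -> U t <= U s) ->
  (forall t, 0 < U t <= M) -> 0 < c < 1 ->
  exists T, forall t, t <= T -> c * U (t - h) < U t.
Proof.
move=> Ud UM /andP[c0 c1].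
have [|t|L [UL Llim]] := @monotone_sup R (fun t => U (- t)) M.
- by move=> s t st; apply: Ud; rewrite lerN2.
- by have /andP[] := UM (- t).
have L0 : 0 < L by apply: lt_le_trans (UL 0); have /andP[] := UM (- 0).
have [|T hT] := Llim ((1 - c) * L / 2); first by rewrite divr_gt0// mulr_gt0// subr_gt0.
exists (- T) => t tT; have Tt : T <= - t by lra.
have := hT _ Tt; rewrite opprK => Ut.
have := UL (- (t - h)); rewrite opprK => ULh.
have : c * U (t - h) <= c * L by rewrite ler_wpM2l// ltW.
have : 0 < (1 - c) * L by rewrite mulr_gt0// subr_gt0.
lra.
Qed.

Section RescalingGap.
Variable i0 : 'I_N.

(** The paraboloid has Laplacian $2N$, so a small multiple makes the rescaled difference a strict
    subsolution. The factors [1] match the shape of [laplacian_lin]. *)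
Definition rescaling_gap (a h e : R) (w : 'rV[R]_N -> R) x :=
  1 * (1 * w x + - expR (- (a * h)) * w (expR (- h) *: x)) + e * (1 + sqnorm x).

Lemma C2_bowl : C2 (fun x : 'rV[R]_N => 1 + sqnorm x).
Proof.
apply: (@C2_radial _ _ (fun y => 1 + y) (fun _ => 1) (fun _ => 0)) => [y|y|].
- by der; ring.
- exact: der_cst.
- exact: cont_cst.
Qed.

Lemma laplacian_bowl x : laplacian (fun x : 'rV[R]_N => 1 + sqnorm x) x = 2 * N%:R.
Proof.
rewrite (@laplacian_radial _ _ (fun y => 1 + y) (fun _ => 1) x 0).
- by ring.
- by near=> y; der; ring.
- exact: der_cst.
Unshelve. all: by end_near. Qed.

Lemma rescaling_gapE a h e (w : 'rV[R]_N -> R) x : radial w -> x != 0 ->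
  rescaling_gap a h e w x = profile i0 w (2^-1 * ln (sqnorm x)) -
    expR (- (a * h)) * profile i0 w (2^-1 * ln (sqnorm x) - h) + e * (1 + sqnorm x).
Proof.
move=> rw x0; rewrite /rescaling_gap !mul1r mulNr -(profileE i0 rw x0).
have x0' : expR (- h) *: x != 0 by rewrite scaler_eq0 negb_or x0 andbT gt_eqF ?expR_gt0.
rewrite (profileE i0 rw x0') sqnormZ lnM ?posrE ?exprn_gt0 ?expR_gt0 ?sqnorm_gt0//.
rewrite lnXn ?expR_gt0// expRK; congr (_ - _ * profile _ _ _ + _).
by rewrite -mulr_natr; field.
Qed.

Lemma rescaling_gap_regular a h e (w : 'rV[R]_N -> R) x : C2 w ->
  regular2 (rescaling_gap a h e w) x /\
  laplacian (rescaling_gap a h e w) x =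
    laplacian w x - expR (- (a * h)) * expR (- h) ^+ 2 * laplacian w (expR (- h) *: x) + e * (2 * N%:R).
Proof.
move=> c2; have r1 := C2_regular2 x c2; have r2 := regular2_scale x (expR (- h)) c2.
have r3 := regular2_lin 1 (- expR (- (a * h))) r1 r2.
have r4 := C2_regular2 x C2_bowl.
split; first exact: (regular2_lin 1 e r3 r4).
rewrite (laplacian_lin 1 e r3 r4) (laplacian_lin _ _ r1 r2) laplacian_scale// laplacian_bowl.
by move: (laplacian w x) (laplacian w (expR (- h) *: x)) => L L'; ring.
Qed.

Lemma rescaling_gap_continuous a h e (w : 'rV[R]_N -> R) :
  C2 w -> continuous (rescaling_gap a h e w).
Proof.
move=> [[cw _] _]; apply: contD.
  apply: contM; first exact: cont_cst.
  apply: contD; first by apply: contM; [exact: cont_cst|exact: cw].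
  apply: contM; first exact: cont_cst.
  by move=> x; apply: (continuous_comp (f := fun x => expR (- h) *: x));
    [exact: scaler_continuous|exact: cw].
apply: contM; first exact: cont_cst.
by apply: contD; [exact: cont_cst|exact: continuous_sqnorm].
Qed.

(** The tangent at [z x] bounds the difference of the powers by the linearized term; the paraboloid
    gives strictness, and in the coupled component it only enlarges the right-hand side, since the
    coefficient is nonnegative. *)
Lemma rescaling_gap_sub (a b h e r : R) (w z : 'rV[R]_N -> R) x :
  C2 w -> 1 <= r -> r * b = a + 2 -> 0 < e -> 0 < N%:R :> R ->
  (forall x, - laplacian w x = z x `^ r) -> (forall x, 0 < z x) ->
  - laplacian (rescaling_gap a h e w) x < r * z x `^ (r - 1) * rescaling_gap b h e z x.
Proof.
move=> c2 r1 rb e0 N0 ew z0; have [_ ->] := rescaling_gap_regular a h e x c2.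
have -> : laplacian w x = - z x `^ r by rewrite -ew opprK.
have -> : laplacian w (expR (- h) *: x) = - z (expR (- h) *: x) `^ r by rewrite -ew opprK.
set y := z (expR (- h) *: x); have y0 : 0 < y by exact: z0.
have e1 : expR (- (a * h)) * expR (- h) ^+ 2 * y `^ r = (expR (- (b * h)) * y) `^ r.
  rewrite powRM ?expR_ge0 ?(ltW y0)// -expRM -expRM_natl -expRD; congr (expR _ * _).
  have -> : - (b * h) * r = - (r * b) * h by ring.
  by rewrite rb; ring.
have y1 : 0 < expR (- (b * h)) * y by rewrite mulr_gt0 ?expR_gt0.
have tan := powR_tangent r1 y1 (z0 x).
have pz : 0 <= r * z x `^ (r - 1) by rewrite mulr_ge0 ?powR_ge0//; lra.
have big : 0 <= r * z x `^ (r - 1) * (e * (1 + sqnorm x)).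
  rewrite mulr_ge0// mulr_ge0 ?(ltW e0)//; have := sqnorm_ge0 x; lra.
rewrite mulrN e1 /rescaling_gap -/y.
have eN : 0 < e * (2 * N%:R) by rewrite !mulr_gt0.
move: tan big eN; move: (r * z x `^ (r - 1)) ((expR (- (b * h)) * y) `^ r) (z x `^ r)
  (expR (- (b * h)) * y) (e * (2 * N%:R)) (e * (1 + sqnorm x)) (z x) (expR (- (b * h))) => P Q S T W X Z E.
rewrite mulNr; nra.
Qed.

End RescalingGap.
End Instability.

Section Monotone.
Context {R : realType} {N : nat}.
Implicit Types (u v : 'rV[R]_N -> R) (x : 'rV[R]_N).
Variables (p q : R).
Hypotheses (hq : 1 <= q) (hqp : q <= p) (hpq : 1 < p * q).
Variables (i0 : 'I_N) (u v : 'rV[R]_N -> R).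
Hypotheses (sol : lane_emden_solution p q u v) (ru : radial u) (rv : radial v).
Hypothesis st : stable p q u v.

(** If both differences were negative on a sphere, the enclosed ball would carry a forbidden bump:
    at the origin the first gap is at least $(1-e^{-ah})u(0)>0$. *)
Lemma stable_not_crossed h : 0 < h ->
  let f t := profile i0 u t - expR (- (LEalpha p q * h)) * profile i0 u (t - h) in
  let g t := profile i0 v t - expR (- (LEbeta p q * h)) * profile i0 v (t - h) in
  ~ exists t, f t < 0 /\ g t < 0.
Proof.
move=> h0 f g [t [ft gt]].
have [[a0 b0 pb qa] _] := LE_exponents hq hqp hpq.
have [cu cv pos eu ev] := sol.
have p1 : 1 <= p by apply: le_trans hqp.
have p0 : 0 <= p by apply: le_trans p1. have q0 : 0 <= q by apply: le_trans hq.
have N0 : 0 < N%:R :> R by rewrite ltr0n; case: (N) i0 => // -[].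
set a := LEalpha p q in a0 pb qa f ft *; set b := LEbeta p q in b0 pb qa g gt *.
pose D := 1 + expR (2 * t); have D0 : 0 < D by rewrite addr_gt0 ?expR_gt0.
(* The largest [e] for which both gaps are still nonpositive on the sphere $|x|=e^t$. *)
pose e := Num.min (- f t) (- g t) / D.
have e0 : 0 < e by rewrite divr_gt0// lt_min !oppr_gt0 ft.
have eD : e * D = Num.min (- f t) (- g t) by rewrite divfK// gt_eqF.
have sub0 : rescaling_gap a h e u 0 <= 0.
  (* The negative inner radius turns the shell into a ball, leaving only the outer boundary. *)
  apply: (@stable_no_bump R N p q (-1) (expR (2 * t)) u v _ (rescaling_gap b h e v)) => //.
  - by move=> x _; split; exact: rescaling_gap_continuous.
  - move=> x _; have [r1 _] := rescaling_gap_regular a h e x cu.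
    have [r2 _] := rescaling_gap_regular b h e x cv.
    split => //.
      by apply: (@rescaling_gap_sub R N a b h e p u v) => // y; have [] := pos y.
    by apply: (@rescaling_gap_sub R N b a h e q v u) => // y; have [] := pos y.
  - move=> x [sx|sx]; first by have := sqnorm_ge0 x; rewrite sx; lra.
    have x0 : x != 0.
      apply/eqP => x0; move: sx; rewrite x0 /sqnorm big1 => [e1|i _]; last by rewrite mxE expr0n.
      by have := expR_gt0 (2 * t); rewrite -e1 ltxx.
    have tE : 2^-1 * ln (sqnorm x) = t by rewrite sx expRK; field.
    rewrite (rescaling_gapE i0 _ _ _ ru x0) (rescaling_gapE i0 _ _ _ rv x0) tE sx -/(f t) -/(g t).
    have -> : e * (1 + expR (2 * t)) = Num.min (- f t) (- g t) by exact: eD.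
    by split; rewrite addrC -lerBrDr sub0r ge_min lexx ?orbT.
  - have -> : sqnorm (0 : 'rV[R]_N) = 0 by rewrite /sqnorm big1// => i _; rewrite mxE expr0n.
    by rewrite expR_ge0 andbT; lra.
move: sub0; rewrite leNgt => /negP; apply.
rewrite /rescaling_gap scaler0 !mul1r mulNr.
have -> : sqnorm (0 : 'rV[R]_N) = 0 by rewrite /sqnorm big1// => i _; rewrite mxE expr0n.
rewrite addr0 mulr1; have [u0 _] := pos 0.
have E1 : expR (- (a * h)) < 1 by rewrite expR_lt1 oppr_lt0 mulr_gt0.
have -> : u 0 - expR (- (a * h)) * u 0 = (1 - expR (- (a * h))) * u 0 by ring.
by rewrite addr_gt0// mulr_gt0// subr_gt0.
Qed.

(** [crossing] applied to the solution and its rescaling. Near the origin the rescaling lies below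
    since its factors $e^{-ah}$ and $e^{-bh}$ are less than $1$; at infinity the decay bounds give
    [not_below_neg]. *)
Lemma stable_rescaled_order h : 0 < h -> forall t,
  0 <= profile i0 u t - expR (- (LEalpha p q * h)) * profile i0 u (t - h) /\
  0 <= profile i0 v t - expR (- (LEbeta p q * h)) * profile i0 v (t - h).
Proof.
move=> h0; have [[a0 b0 pb qa] [ea eb _ _]] := LE_exponents hq hqp hpq.
have := stable_not_crossed h0.
have [hU hV] := emden_solution i0 sol ru rv.
have n0 := solution_dim i0 sol ru rv.
have p1 : 1 <= p by apply: le_trans hqp.
have p0 : 0 <= p by apply: le_trans p1. have q0 : 0 <= q by apply: le_trans hq.
move: (LEalpha p q) (LEbeta p q) a0 b0 pb qa ea eb => a b a0 b0 pb qa ea eb.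
move: (profile i0 u) (profile1 i0 u) (profile i0 v) (profile1 i0 v) hU hV => U U1 V V1.
move: (N%:R - 2) n0 => n n0 hU hV not_crossed.
have n1 : -1 <= n by lra.
have U0 := emden_pos hU; have V0 := emden_pos hV.
have eb' : b * (q * p - 1) = 2 * (q + 1) by rewrite [q * p]mulrC.
have qp : 1 < q * p by rewrite mulrC.
have [Cu Cu0 hCu] := emden_decay (ltW n0) p0 q0 hpq ea hU hV.
have [Cv Cv0 hCv] := emden_decay (ltW n0) q0 p0 qp eb' hV hU.
pose f t := U t - expR (- (a * h)) * U (t - h).
pose f1 t := U1 t - expR (- (a * h)) * U1 (t - h).
pose g t := V t - expR (- (b * h)) * V (t - h).
pose g1 t := V1 t - expR (- (b * h)) * V1 (t - h).
have [f2 [df df1 ef]] := emden_shift_diff h hU V0 p1 pb.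
have [g2 [dg dg1 eg]] := emden_shift_diff h hV U0 hq qa.
have [M M0 UM] := emden_ub n1 hU V0; have [M' M'0 VM] := emden_ub n1 hV U0.
have UM' t : 0 < U t <= M by rewrite U0 UM.
have VM' t : 0 < V t <= M' by rewrite V0 VM.
have Ud s t : s <= t -> U t <= U s := emden_decr n1 hU V0.
have Vd s t : s <= t -> V t <= V s := emden_decr n1 hV U0.
have ca : 0 < expR (- (a * h)) < 1 by rewrite expR_gt0 expR_lt1 oppr_lt0 mulr_gt0.
have cb : 0 < expR (- (b * h)) < 1 by rewrite expR_gt0 expR_lt1 oppr_lt0 mulr_gt0.
have [T1 hT1] := eventually_above_multiple h Ud UM' ca.
have [T2 hT2] := eventually_above_multiple h Vd VM' cb.
pose T := Num.min T1 T2.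
have hT t : t <= T -> 0 < f t /\ 0 < g t.
  by rewrite le_min => /andP[/hT1 ? /hT2 ?]; rewrite /f /g !subr_gt0.
have mono r (x y : R) : 1 <= r -> 0 <= y -> 0 <= x - y -> y `^ r <= x `^ r.
  move=> r1 y0; rewrite subr_ge0 => xy.
  by rewrite ge0_ler_powR ?nnegrE//; [exact: le_trans ler01 r1|exact: le_trans xy].
have smono r (x y : R) : 1 <= r -> 0 <= y -> 0 < x - y -> y `^ r < x `^ r.
  move=> r1 y0; rewrite subr_gt0 => xy.
  by rewrite gt0_ltr_powR ?nnegrE//; [exact: lt_le_trans ltr01 r1|exact/ltW/(le_lt_trans y0)].
have yV t : 0 <= expR (- (b * h)) * V (t - h) by rewrite mulr_ge0 ?expR_ge0// ltW.
have yU t : 0 <= expR (- (a * h)) * U (t - h) by rewrite mulr_ge0 ?expR_ge0// ltW.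
have hf t : 0 <= g t -> f2 t + n * f1 t <= 0.
  by move=> g0; rewrite ef oppr_le0 mulr_ge0 ?expR_ge0// subr_ge0 mono.
have hg t : 0 <= f t -> g2 t + n * g1 t <= 0.
  by move=> f0; rewrite eg oppr_le0 mulr_ge0 ?expR_ge0// subr_ge0 mono.
have hf' t : 0 < g t -> f2 t + n * f1 t < 0.
  by move=> g0; rewrite ef oppr_lt0 mulr_gt0 ?expR_gt0// subr_gt0 smono.
have hg' t : 0 < f t -> g2 t + n * g1 t < 0.
  by move=> f0; rewrite eg oppr_lt0 mulr_gt0 ?expR_gt0// subr_gt0 smono.
(* The flux of the difference starts from $0$ at the origin and decreases strictly up to [T], where
   both differences are positive. *)
have start (k r : R) (W W1 Z k2 : R -> R) : emden n r W W1 Z ->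
    let k1 t := W1 t - expR (- (k * h)) * W1 (t - h) in
    (forall t, der t k1 (k2 t)) -> (forall t, t <= T -> k2 t + n * k1 t < 0) -> k1 T < 0.
  move=> hW k1 dk1 k2n; pose F t := expR (n * t) * k1 t.
  have F0 : ninf0 F.
    have := ninf0D (emden_flux0 n1 hW)
      (ninf0_shift (- (expR (- (k * h)) * expR (n * h))) (ltW h0) (emden_flux0 n1 hW)).
    move=> H; apply: ninf0_ext H _ => t; rewrite /F /k1 (_ : n * t = n * h + n * (t - h)); last by ring.
    by rewrite expRD; ring.
  have dF t : der t F (expR (n * t) * (k2 t + n * k1 t)) by rewrite /F; der; ring.
  have Flt s t : s < t -> t <= T -> F t < F s.
    move=> st' tT; apply: der_lt st' (fun t _ => dF t) _ => x /andP[_ xt].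
    by rewrite pmulr_rlt0 ?expR_gt0// k2n// (le_trans _ tT)// ltW.
  have T1T : T - 1 < T by lra.
  have FT1 : F (T - 1) <= 0.
    apply: ninf0_le F0 _ => s; rewrite le_eqVlt => /predU1P[->//|sT].
    by apply/ltW/Flt => //; exact: ltW.
  have : F T < 0 by apply: lt_le_trans FT1; exact: Flt.
  by rewrite /F pmulr_rlt0 ?expR_gt0.
have f1T : f1 T < 0 by apply: start hU df1 _ => t /hT[_ /hf'].
have g1T : g1 T < 0 by apply: start hV dg1 _ => t /hT[/hg' + _].
have nb (k C : R) (W : R -> R) : 0 < k -> 0 < C -> (forall t, 0 < W t) ->
   (forall t, W t <= C * expR (- (k * t))) -> not_below_neg (fun t => W t - expR (- (k * h)) * W (t - h)).
  move=> k0 C0 W0 hW; apply: (not_below_neg_decay k0 C0) => t.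
  have : expR (- (k * h)) * W (t - h) <= expR (- (k * h)) * (C * expR (- (k * (t - h)))).
    by rewrite ler_wpM2l ?expR_ge0.
  have -> : expR (- (k * h)) * (C * expR (- (k * (t - h)))) = C * expR (- (k * t)).
    by rewrite mulrCA -expRD; congr (_ * expR _); ring.
  by have := W0 t; lra.
have nbf : not_below_neg f by exact: nb a0 Cu0 U0 hCu.
have nbg : not_below_neg g by exact: nb b0 Cv0 V0 hCv.
have [//|[t1 [_ _ _ _ [_ [t2 [ft2 gt2]]]]]] := crossing df df1 dg dg1 hf hg nbf nbg
  (fun t tT => let: conj x y := hT t tT in conj (ltW x) (ltW y)) f1T g1T.
by exfalso; apply: not_crossed; exists t2.
Qed.

Lemma stable_monotone :
  (forall s t, s <= t ->
    expR (LEalpha p q * s) * profile i0 u s <= expR (LEalpha p q * t) * profile i0 u t) /\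
  (forall s t, s <= t ->
    expR (LEbeta p q * s) * profile i0 v s <= expR (LEbeta p q * t) * profile i0 v t).
Proof.
have key k (W : R -> R) : (forall h, 0 < h -> forall t, 0 <= W t - expR (- (k * h)) * W (t - h)) ->
    forall s t, s <= t -> expR (k * s) * W s <= expR (k * t) * W t.
  move=> H s t; rewrite le_eqVlt => /predU1P[->//|]; rewrite -subr_gt0 => h0.
  have := H _ h0 t; rewrite subKr subr_ge0 => le1.
  have -> : expR (k * s) = expR (k * t) * expR (- (k * (t - s))) by rewrite -expRD; congr expR; ring.
  by rewrite -mulrA ler_wpM2l ?expR_ge0.
by split; apply: key => h h0 t; have [] := stable_rescaled_order h0 t.
Qed.

End Monotone.

(** * Instability *)

Section Bump.
Context {R : realType}.

Lemma perturbed_lt (P Pz G c eta M : R) : `|Pz - P| <= eta -> `|G| <= M -> eta * M < c ->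
  P * G - c < Pz * G.
Proof.
move=> h1 h2 h3; have : `|(Pz - P) * G| <= eta * M by rewrite normrM ler_pM.
by rewrite ler_norml => /andP[]; lra.
Qed.

(* An oscillating pair [r^(-k1) cos], [r^(-k2) (X cos + Y sin) / P], slightly raised,
   is a strict subsolution over one period far from the origin. *)
Lemma oscillating_bump (n p q a b A B : R) (U V : R -> R) :
  0 < n -> 1 <= p -> 1 <= q -> 0 < a -> 0 < b -> p * b = a + 2 -> q * a = b + 2 -> a + b <= n ->
  0 < A -> 0 < B -> a * (n - a) * A = B `^ p -> b * (n - b) * B = A `^ q ->
  ((n ^+ 2 - (a - b) ^+ 2) / 4) ^+ 2 < p * q * a * b * (n - a) * (n - b) ->
  (forall t, 0 < U t) -> (forall t, 0 < V t) ->
  (forall eta : R, 0 < eta -> exists T : R, forall t, T <= t ->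
     `|p * (expR (b * t) * V t) `^ (p - 1) - p * B `^ (p - 1)| <= eta /\
     `|q * (expR (a * t) * U t) `^ (q - 1) - q * A `^ (q - 1)| <= eta) ->
  exists f f1 f2 g g1 g2 : R -> R, exists r s t0 : R,
    [/\ (forall t, der t f (f1 t)) /\ (forall t, der t f1 (f2 t)),
        (forall t, der t g (g1 t)) /\ (forall t, der t g1 (g2 t)),
        forall t, r <= t <= s ->
          - (f2 t + n * f1 t) < expR (2 * t) * (p * V t `^ (p - 1)) * g t /\
          - (g2 t + n * g1 t) < expR (2 * t) * (q * U t `^ (q - 1)) * f t,
        [/\ f r <= 0, g r <= 0, f s <= 0 & g s <= 0] & r <= t0 <= s /\ 0 < f t0].
Proof.
move=> n0 p1 q1 a0 b0 pb qa abn A0 B0 eA eB fails U0 V0 close.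
pose P := p * B `^ (p - 1); pose Q := q * A `^ (q - 1).
have P0 : 0 < P by rewrite mulr_gt0 ?powR_gt0//; lra.
have Q0 : 0 < Q by rewrite mulr_gt0 ?powR_gt0//; lra.
have PQ : P * Q = p * q * a * b * (n - a) * (n - b).
  have eB' : B `^ (p - 1) * B = B `^ p by rewrite -powRS_gt0// subrK.
  have eA' : A `^ (q - 1) * A = A `^ q by rewrite -powRS_gt0// subrK.
  have AB : A * B != 0 by rewrite gt_eqF// mulr_gt0.
  apply: (mulIf AB); rewrite /P /Q.
  rewrite (_ : _ * (A * B) = p * q * (B `^ (p - 1) * B) * (A `^ (q - 1) * A)); last by ring.
  by rewrite eB' eA' -eA -eB; ring.
have {}close (eta : R) : 0 < eta -> exists T : R, forall t, T <= t ->
     `|p * (expR (b * t) * V t) `^ (p - 1) - P| <= eta /\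
     `|q * (expR (a * t) * U t) `^ (q - 1) - Q| <= eta by exact: close.
clearbody P Q; clear eA eB.
(* The two exponents must differ by $b-a$ for the powers to balance; then $m^2$ is the left-hand
   side of the stability inequality. *)
pose d := (b - a) / 2; pose m := (n / 2) ^+ 2 - d ^+ 2.
have em : (n ^+ 2 - (a - b) ^+ 2) / 4 = m by rewrite /m /d; field.
have m0 : 0 < m.
  rewrite /m subr_sqr mulr_gt0// /d; lra.
have mPQ : m ^+ 2 < P * Q by rewrite -em PQ.
have [w w0 ew] := frequency d m0 mPQ.
pose X := m + w ^+ 2; pose Y := 2 * w * d.
have X0 : 0 < X by rewrite addr_gt0// exprn_gt0.
(* The midpoint of $(m/P,Q/m)$, an interval because $m^2<PQ$; inside it both residues of the raised
   pair are positive. *)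
pose kap := (m / P + Q / m) / 2.
have kapP : m < P * kap.
  have -> : P * kap = (m + P * Q / m) / 2 by rewrite /kap; field; rewrite !gt_eqF.
  have : m < P * Q / m by rewrite ltr_pdivlMr// -expr2.
  lra.
have kapQ : m * kap < Q.
  have -> : m * kap = (m ^+ 2 / P + Q) / 2 by rewrite /kap; field; rewrite !gt_eqF.
  have : m ^+ 2 / P < Q by rewrite ltr_pdivrMr// mulrC.
  lra.
have kap0 : 0 < kap by have := lt_trans m0 kapP; rewrite pmulr_rgt0.
(* At the ends of the window the cosine is $-1$ and the sine $0$; these two bounds keep both raised
   components nonpositive there. *)
pose eps := Num.min 1 (X / (P * kap)).
have Pk0 : 0 < P * kap by rewrite mulr_gt0.
have eps0 : 0 < eps by rewrite lt_min ltr01 divr_gt0.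
have eps1 : eps <= 1 by rewrite ge_min lexx.
have epsX : eps * (P * kap) <= X by rewrite -ler_pdivlMr// ge_min lexx orbT.
pose c1 := eps * (P * kap - m); pose c2 := eps * (Q - m * kap).
have c10 : 0 < c1 by rewrite mulr_gt0// subr_gt0.
have c20 : 0 < c2 by rewrite mulr_gt0// subr_gt0.
pose M := (X + `|Y|) / P + eps * kap + 2.
have XYP : 0 <= (X + `|Y|) / P by rewrite divr_ge0 ?(ltW P0)// addr_ge0// ltW.
have ek0 : 0 < eps * kap by rewrite mulr_gt0.
have M2 : 2 <= M by rewrite /M; lra.
have M0 : 0 < M by lra.
(* With coefficients within [eta] of their limits, the error is at most half of the smaller
   residue. *)
pose eta := Num.min c1 c2 / (2 * M).
have c0 : 0 < Num.min c1 c2 by rewrite lt_min c10.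
have eta0 : 0 < eta by rewrite divr_gt0// mulr_gt0.
have etaM : eta * M = Num.min c1 c2 / 2 by rewrite /eta; field; rewrite gt_eqF.
have etaM1 : eta * M < c1.
  rewrite etaM; have : Num.min c1 c2 <= c1 by rewrite ge_min lexx.
  lra.
have etaM2 : eta * M < c2.
  rewrite etaM; have : Num.min c1 c2 <= c2 by rewrite ge_min lexx orbT.
  lra.
have [T hT] := close _ eta0.
have eX : X = m + w ^+ 2 by [].
have eY : Y = 2 * w * d by [].
have em' : m = (n / 2) ^+ 2 - d ^+ 2 by [].
have ed : 2 * d = b - a by rewrite /d; field.
have eXY : X ^+ 2 + Y ^+ 2 = P * Q by [].
have ec1 : c1 = eps * (P * kap - m) by [].
have ec2 : c2 = eps * (Q - m * kap) by [].
have eM : M = (X + `|Y|) / P + eps * kap + 2 by [].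
clearbody M eta c1 c2 eps kap X Y m d.
(* The window is one full period starting at [T], with the maximum of the cosine at its center. *)
pose t0 := T + pi / w.
have piw : 0 < pi / w by rewrite divr_gt0 ?pi_gt0.
exists (bumpf n d w eps t0), (bumpf1 n d w eps t0), (bumpf2 n d w eps t0).
exists (bumpg n d w X Y P eps kap t0), (bumpg1 n d w X Y P eps kap t0), (bumpg2 n d w X Y P eps kap t0).
exists (t0 - pi / w), (t0 + pi / w), t0.
have oscM t : `|osc w eps t0 t| <= M.
  rewrite /osc; apply: le_trans (ler_normD _ _) _.
  by rewrite (gtr0_norm eps0); have := cos_max (w * (t - t0)); lra.
have osc'M t : `|osc' w X Y P eps kap t0 t| <= M.
  rewrite /osc'; apply: le_trans (ler_normD _ _) _.
  rewrite (ger0_norm (mulr_ge0 (ltW eps0) (ltW kap0))) normrM normfV (gtr0_norm P0).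
  have : `|X * cos (w * (t - t0)) + Y * sin (w * (t - t0))| <= X + `|Y|.
    apply: le_trans (ler_normD _ _) _; rewrite !normrM (gtr0_norm X0).
    by rewrite lerD// ler_piMr ?(ltW X0)// ?cos_max ?sin_max.
  rewrite -(ler_pM2r (_ : 0 < P^-1)) ?invr_gt0// eM; lra.
(* Rewrites a potential in the autonomous variables, so that both sides carry the same exponential
   factor, which then cancels. *)
have conv (r k k' l : R) (Z : R -> R) t : 2 - k' = l * (r - 1) - k -> (forall t, 0 < Z t) ->
   expR (2 * t) * (r * Z t `^ (r - 1)) * expR (- (k' * t)) =
   expR (- (k * t)) * (r * (expR (l * t) * Z t) `^ (r - 1)).
  move=> ek Z0; rewrite powRM ?expR_ge0 ?(ltW (Z0 _))// -expRM.
  have e3 : expR (2 * t) * expR (- (k' * t)) = expR (- (k * t)) * expR (l * t * (r - 1)).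
    rewrite -!expRD; congr expR; have -> : 2 * t + - (k' * t) = (2 - k') * t by ring.
    by rewrite ek; ring.
  rewrite (_ : _ * expR (- (k' * t)) = r * Z t `^ (r - 1) * (expR (2 * t) * expR (- (k' * t)))); last by ring.
  by rewrite e3; ring.
have endpoint (sg : R) : sg = 1 \/ sg = -1 ->
    cos (w * (t0 + sg * (pi / w) - t0)) = -1 /\ sin (w * (t0 + sg * (pi / w) - t0)) = 0.
  move=> hsg; have -> : w * (t0 + sg * (pi / w) - t0) = sg * pi by field; rewrite gt_eqF.
  by case: hsg => ->; rewrite ?mul1r ?mulN1r ?cosN ?sinN ?cospi ?sinpi ?oppr0.
have neg (sg : R) : sg = 1 \/ sg = -1 ->
   bumpf n d w eps t0 (t0 + sg * (pi / w)) <= 0 /\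
   bumpg n d w X Y P eps kap t0 (t0 + sg * (pi / w)) <= 0.
  move=> /endpoint[hc hs]; rewrite /bumpf /bumpg /osc /osc' hc hs; split.
    by rewrite mulr_ge0_le0 ?expR_ge0//; lra.
  rewrite mulr_ge0_le0 ?expR_ge0// mulr0 addr0 mulrN1 mulNr addrC subr_le0.
  by rewrite ler_pdivlMr// -mulrA [kap * P]mulrC.
split.
- by split=> t; [exact: der_bumpf|exact: der_bumpf1].
- by split=> t; [exact: der_bumpg|exact: der_bumpg1].
- move=> t /andP[rt ts]; have Tt : T <= t by move: rt; rewrite /t0; lra.
  have [h1 h2] := hT t Tt.
  rewrite (bumpf_eq eps kap t0 eX eY em' P0 t) (bumpg_eq eps kap t0 eX eY em' P0 eXY t) !opprK -ec1 -ec2.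
  rewrite /bumpf /bumpg !mulrA.
  rewrite -[expR (2 * t) * p * _]mulrA -[expR (2 * t) * q * _]mulrA.
  rewrite (conv p (n / 2 - d) (n / 2 + d) b V t) //; last first.
    have -> : b * (p - 1) = a + 2 - b by rewrite -pb; ring.
    lra.
  rewrite (conv q (n / 2 + d) (n / 2 - d) a U t) //; last first.
    have -> : a * (q - 1) = b + 2 - a by rewrite -qa; ring.
    lra.
  rewrite -!mulrA !ltr_pM2l ?expR_gt0// !mulrA.
  by split; [apply: perturbed_lt h1 (osc'M t) etaM1|apply: perturbed_lt h2 (oscM t) etaM2].
- have [fr gr] := neg (-1) (or_intror erefl); have [fs gs] := neg 1 (or_introl erefl).
  by rewrite mulN1r in fr gr; rewrite mul1r in fs gs.
- split; first by apply/andP; split; lra.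
  by rewrite /bumpf /osc subrr mulr0 cos0 mulr_gt0 ?expR_gt0// addr_gt0.
Qed.

End Bump.

(** * Transfer of the bump to a shell in $\mathbb R^N$, and low dimensions *)

Section Unstable.
Context {R : realType} {N : nat}.
Variables (p q : R).
Hypotheses (hq : 1 <= q) (hqp : q <= p) (hpq : 1 < p * q).
Variables (i0 : 'I_N) (u v : 'rV[R]_N -> R).
Hypotheses (sol : lane_emden_solution p q u v) (ru : radial u) (rv : radial v).

Lemma bump_unstable (f f1 f2 g g1 g2 : R -> R) (r s t0 : R) : 0 <= p -> 0 <= q ->
  (forall t, der t f (f1 t)) -> (forall t, der t f1 (f2 t)) ->
  (forall t, der t g (g1 t)) -> (forall t, der t g1 (g2 t)) ->
  (forall t, r <= t <= s ->
     - (f2 t + (N%:R - 2) * f1 t) < expR (2 * t) * (p * profile i0 v t `^ (p - 1)) * g t /\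
     - (g2 t + (N%:R - 2) * g1 t) < expR (2 * t) * (q * profile i0 u t `^ (q - 1)) * f t) ->
  f r <= 0 -> g r <= 0 -> f s <= 0 -> g s <= 0 -> r <= t0 <= s -> 0 < f t0 -> ~ stable p q u v.
Proof.
move=> p0 q0 df df1 dg dg1 sub fr gr fs gs /andP[rt0 t0s] ft0 st.
have half (t : R) : 2^-1 * ln (expR (2 * t)) = t by rewrite expRK; field.
have halfE (y : R) : 0 < y -> expR (2 * (2^-1 * ln y)) = y.
  by move=> y0; rewrite (_ : 2 * _ = ln y) ?lnK ?posrE//; field.
pose ext (h : R -> R) (x : 'rV[R]_N) := h (2^-1 * ln (sqnorm x)).
have nz (x : 'rV[R]_N) (t : R) : expR (2 * t) <= sqnorm x -> x != 0.
  move=> le1; apply/eqP => x0; move: le1.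
  rewrite x0 [sqnorm 0]big1 => [|i _]; last by rewrite mxE expr0n.
  by rewrite leNgt expR_gt0.
have ccont (h h1 : R -> R) (x : 'rV[R]_N) : (forall t, der t h (h1 t)) -> x != 0 ->
    {for x, continuous (ext h)}.
  move=> dh /sqnorm_gt0 x0.
  apply: (continuous_comp (f := @sqnorm R N) (g := fun y => h (2^-1 * ln y))).
    exact: continuous_sqnorm.
  exact: (der_cont (der_comp (dh _) (der_half_ln x0))).
have lap (h h1 h2 k w : R -> R) (c : 'rV[R]_N -> R) (x : 'rV[R]_N) :
    (forall t, der t h (h1 t)) -> (forall t, der t h1 (h2 t)) -> x != 0 ->
    (forall t, t = 2^-1 * ln (sqnorm x) -> - (h2 t + (N%:R - 2) * h1 t) < expR (2 * t) * w t * k t) ->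
    c x = w (2^-1 * ln (sqnorm x)) ->
    regular2 (ext h) x /\ - laplacian (ext h) x < c x * ext k x.
  move=> dh dh1 x0 lt_ cw; have sx := sqnorm_gt0 x0.
  have cU (y : R) : 0 < y -> (fun y => h (2^-1 * ln y)) y = h (2^-1 * ln y) by [].
  split; first exact: (regular2_log dh dh1 cU x0).
  rewrite (laplacian_log dh dh1 cU x0) -mulNr ltr_pdivrMr// cw.
  have := lt_ _ erefl; rewrite halfE//; congr (_ < _); rewrite /ext; ring.
have [x1 sx1] : exists x1 : 'rV[R]_N, sqnorm x1 = expR (2 * t0).
  exists (expR t0 *: delta_mx 0 i0); rewrite sqnormZ sqnorm_delta mulr1.
  by rewrite -expRM_natl.
suff : ext f x1 <= 0 by rewrite /ext sx1 half leNgt ft0.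
apply: (@stable_no_bump R N p q (expR (2 * r)) (expR (2 * s)) u v _ (ext g)) => //.
- by move=> x /andP[/nz x0 _]; split; [exact: ccont df x0|exact: ccont dg x0].
- move=> x /andP[rx xs]; have x0 := nz _ _ (ltW rx); have sx := sqnorm_gt0 x0.
  have rts : r <= 2^-1 * ln (sqnorm x) <= s.
    have := halfE _ sx; set t := 2^-1 * ln (sqnorm x) => et.
    move: rx xs; rewrite -et !ltr_expR => rt ts; clearbody t.
    by apply/andP; split; lra.
  have [lf lg] := sub _ rts.
  have cv : p * v x `^ (p - 1) = p * profile i0 v (2^-1 * ln (sqnorm x)) `^ (p - 1).
    by rewrite -(profileE i0 rv x0).
  have cu : q * u x `^ (q - 1) = q * profile i0 u (2^-1 * ln (sqnorm x)) `^ (q - 1).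
    by rewrite -(profileE i0 ru x0).
  have [rf hf] := lap f f1 f2 g (fun t => p * profile i0 v t `^ (p - 1))
    (fun x => p * v x `^ (p - 1)) x
    df df1 x0 (fun t et => ltac:(rewrite et; exact: lf)) cv.
  have [rg hg] := lap g g1 g2 f (fun t => q * profile i0 u t `^ (q - 1))
    (fun x => q * u x `^ (q - 1)) x
    dg dg1 x0 (fun t et => ltac:(rewrite et; exact: lg)) cu.
  by [].
- by move=> x [e|e]; rewrite /ext e half.
- by rewrite sx1 !ler_expR; apply/andP; split; lra.
Qed.

Lemma unstable_of_ineq_fails : ~ stability_ineq N p q -> ~ stable p q u v.
Proof.
move=> fails st; have [[a0 b0 pb qa] _] := LE_exponents hq hqp hpq.
have n0 := solution_dim i0 sol ru rv; have abn := solution_supercritical hq hqp hpq i0 sol ru rv.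
have [hU hV] := emden_solution i0 sol ru rv.
have p1 : 1 <= p by apply: le_trans hqp.
have p0 : 0 <= p by apply: le_trans p1. have q0 : 0 <= q by apply: le_trans hq.
have [mU mV] := stable_monotone hq hqp hpq i0 sol ru rv st.
have [A [B [A0 B0 eA eB close]]] := monotone_limits n0 p1 hq hpq a0 b0 pb qa hU hV mU mV.
move: fails; rewrite /stability_ineq => /negP; rewrite -ltNge => fails.
have [f [f1 [f2 [g [g1 [g2 [r [s [t0 [[df df1] [dg dg1] sub [fr gr fs gs] [rts ft0]]]]]]]]]]] :=
  oscillating_bump n0 p1 hq a0 b0 pb qa abn A0 B0 eA eB fails (emden_pos hU) (emden_pos hV) close.
exact: (bump_unstable p0 q0 df df1 dg dg1 sub fr gr fs gs rts ft0) st.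
Qed.

Lemma ineq_fails_low_dim : (N <= 10)%N -> ~ stability_ineq N p q.
Proof.
move=> N10; have [[a0 b0 pb qa] [_ _ ba ab]] := LE_exponents hq hqp hpq.
have abn := solution_supercritical hq hqp hpq i0 sol ru rv.
have n8 : N%:R - 2 <= 8 :> R by rewrite lerBlDr -natrD ler_nat.
rewrite /stability_ineq; apply/negP; rewrite -ltNge.
apply: lt_le_trans (low_dim_strict b0 ba ab abn n8) _.
(* Here $pq\,\alpha\beta=(\alpha+2)(\beta+2)$. *)
by rewrite -pb -qa le_eqVlt; apply/orP; left; apply/eqP; ring.
Qed.

End Unstable.

Unset Implicit Arguments.

Theorem theorem1p2 (R : realType) (N : nat) (p q : R)
    (hN : (1 <= N)%N) (hq : 1 <= q) (hqp : q <= p) (hpq : 1 < p * q) :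
  ((11 <= N)%N -> stability_ineq N p q ->
     forall u v : 'rV[R]_N -> R,
       lane_emden_solution p q u v -> radial u -> radial v ->
       stable p q u v /\
       (forall x : 'rV[R]_N, x != 0 -> u x < u_sing p q x /\ v x < v_sing p q x))
  /\
  ((N <= 10)%N \/ ((11 <= N)%N /\ ~ stability_ineq N p q) ->
     ~ exists u v : 'rV[R]_N -> R,
         [/\ lane_emden_solution p q u v, radial u, radial v & stable p q u v]).
Proof.
split=> [_ ineq u v sol ru rv|dim [u [v [sol ru rv st]]]].
  (* [Ordinal hN] selects the coordinate axis along which the profiles are read; it exists as
     $N\ge1$. *)
  exact: (stable_below_singular hq hqp hpq (Ordinal hN) sol ru rv ineq).
apply: (unstable_of_ineq_fails hq hqp hpq (Ordinal hN) sol ru rv) st.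
case: dim => [N10|[]//]; exact: (ineq_fails_low_dim hq hqp hpq (Ordinal hN) sol ru rv N10).
Qed.
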